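(* For each pair $\sigma\in\mathcal E^1[2]$ and $\tau\in\mathcal E^k[k+1]$, $$\check{\overline\tau}_{\mathbf a^{k-2}}:=2\sigma^p\nabla^q\tau_{\mathbf a^{k-2}pq}+(n-k+1)(\nabla^p\sigma^q)\tau_{\mathbf a^{k-2}pq},\qquad k\in\{2,\dots,n\},$$ is a conformally invariant section of $\mathcal E^{k-2}[k-1]$, and $$\check{\underline\tau}_{\mathbf a^{k+2}}:=2\sigma_{a^{k+1}}\nabla_{a^{k+2}}\tau_{\mathbf a^k}+(k+1)(\nabla_{a^{k+1}}\sigma_{a^{k+2}})\tau_{\mathbf a^k},\qquad k\in\{0,\dots,n-2\},$$ is a conformally invariant section of $\mathcal E^{k+2}[k+3]$. If $\sigma$ and $\tau$ are solutions of the conformal Killing equation then: for $3\le k\le n-1$, $\check{\overline\tau}_{\mathbf a^{k-2}}$ is a solution of the conformal Killing equation if and only if $$(n-k+1)\,C^r{}_c{}^{pq}\tau_{\mathbf a^{k-2}pq}\sigma_r+(k-2)\,C_{ca^1}{}^{pq}\tau_{p\dot{\mathbf a}^{k-2}qr}\sigma^r\stackrel{\{c\mathbf a^{k-2}\}_0}{=}0,$$ and, for $1\le k\le n-3$, $\check{\underline\tau}_{\mathbf a^{k+2}}$ is a solution of the conformal Killing equation if and only if $$2\,C_{ca^{k+1}a^1}{}^{p}\tau_{p\dot{\mathbf a}^k}\sigma_{a^{k+2}}-C^p{}_{ca^{k+1}a^{k+2}}\tau_{\mathbf a^k}\sigma_p\stackrel{\{c\mathbf a^{k+2}\}_0}{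=}0.$$
   Context: Setting. $M$ is a smooth $n$-manifold, $n\ge3$, with a conformal structure $[g]$ (any signature); all objects are smooth. $\mathcal E[w]$: conformal densities of weight $w$ (a choice $g\in[g]$ trivialises $\mathcal E[w]$; under $\hat g=e^{2\Upsilon}g$ the representing function $f$ becomes $e^{w\Upsilon}f$); $[w]$ after a bundle means tensoring with it. $\mathbf g_{ab}$ is the conformal metric (tautological section of $S^2T^*M[2]$), used to raise, lower and contract abstract indices. $\nabla$ is the Levi-Civita connection of a chosen $g\in[g]$, acting also on densities via the trivialisation. ''Conformally invariant'' means independent of the choice of $g\in[g]$. $[\nabla_a,\nabla_b]v^c=R_{ab}{}^c{}_dv^d$, and $C_{abcd}$ is the Weyl tensor: the totally trace-free part of $R_{abcd}$, $R_{abcd}=C_{abcd}+2\mathbf g_{c[a}P_{b]d}+2\mathbf g_{d[b}P_{a]c}$ with $P$ symmetric. Form indices. $\mathcal E^k=\mathcal E_{\mathbf a^k}$ is the bundle of $k$-forms. Indices with sequential superscripts at the same level are implicitly skew-symmetrised, also when distributed over several factors: $\mathbf a^k=a^1\cdots a^k$, $\dot{\mathbf a}^k=a^2\cdots a^k$; e.g. expressions with free indices $a^1,\dots,a^{k+2}$ are skewed over all of these. Conformal Killing equation. $\{c\mathbf a^m\}_0$ denotes projection of $T^*M\otimes\Lambda^mT^*M[w]$ onto the trace-free part of $\{f_{c\mathbf a^m}: f_{[c\mathbf a^m]}=0\}$, and $T\stackrel{\{c\mathbf a^m\}_0}{=}S$ means that these projections of $T$ and $S$ agree. The conformal Killing equation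 for $\sigma\in\mathcal E^m[m+1]$, $1\le m\le n-1$, is $\nabla_{\{c}\sigma_{\mathbf a^m\}_0}=0$ (conformally invariant). *)

(* Defs.v *)
From HB Require Import structures.
From mathcomp Require Import all_boot all_order all_algebra perm.
From mathcomp Require Import all_classical all_reals all_analysis.

Set Implicit Arguments.
Unset Strict Implicit.
Unset Printing Implicit Defensive.
Import Order.TTheory GRing.Theory Num.Theory.
Import numFieldNormedType.Exports.
Local Open Scope classical_set_scope.
Local Open Scope ring_scope.

Definition pd (R : realType) (n : nat) (a : 'I_n) (f : 'rV[R]_n -> R)
  (x : 'rV[R]_n) : R := 'D_(delta_mx 0 a) f x.

Fixpoint Ck (R : realType) (n k : nat) (U : set 'rV[R]_n)
  (f : 'rV[R]_n -> R) : Prop :=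
  (forall x, U x -> {for x, continuous f}) /\
  if k is k'.+1 then
    forall a : 'I_n, (forall x, U x -> derivable f x (delta_mx 0 a)) /\
                     Ck k' U (pd a f)
  else True.

(* Only meant for open U. *)
Definition smooth_on (R : realType) (n : nat) (U : set 'rV[R]_n)
  (f : 'rV[R]_n -> R) : Prop := forall k, Ck k U f.

(* The atlas need not be maximal: it determines the smooth structure.         *)
(* chart_map and chart_inv are total functions, whose values outside          *)
(* chart_dom and outside its image are irrelevant.                            *)
Record manifold (R : realType) (n : nat) := Manifold {
  point :> topologicalType;
  point_hausdorff : hausdorff_space point;
  point_second_countable : @second_countable point;
  chart : Type;
  chart_dom : chart -> set point;
  chart_map : chart -> point -> 'rV[R]_n;
  chart_inv : chart -> 'rV[R]_n -> point;
  chart_dom_open : forall i, open (chart_dom i);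
  chart_cover : forall p, exists i, chart_dom i p;
  chart_img_open : forall i, open (chart_map i @` chart_dom i);
  chart_mapK : forall i p, chart_dom i p -> chart_inv i (chart_map i p) = p;
  chart_map_continuous : forall i p, chart_dom i p ->
    {for p, continuous (chart_map i)};
  chart_inv_continuous : forall i x, (chart_map i @` chart_dom i) x ->
    {for x, continuous (chart_inv i)};
  chart_transition_smooth : forall i j (b : 'I_n),
    smooth_on (chart_map i @` (chart_dom i `&` chart_dom j))
      (fun x => chart_map j (chart_inv i x) 0 b)
}.

Section Fields.
Variables (R : realType) (n : nat) (M : manifold R n).

Definition chart_img (i : chart M) : set 'rV[R]_n :=
  chart_map i @` chart_dom i.

Definition smooth_fun (u : M -> R) : Prop :=
  forall i : chart M, smooth_on (chart_img i) (u \o chart_inv i).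

(* Components of a covariant tensor, indexed by finite sequences of indices.  *)
(* For a tensor with p indices only the sequences of size p are meaningful.   *)
Definition comps := seq 'I_n -> R.

(* F i x a is the component with indices a, in the chart i, at the point with *)
(* coordinates x; it is meaningful only for x in chart_img i.                 *)
Definition field := chart M -> 'rV[R]_n -> comps.

Definition jacobian (i j : chart M) (x : 'rV[R]_n) (a b : 'I_n) : R :=
  pd a (fun y => chart_map j (chart_inv i y) 0 b) x.

Definition is_tensor (p : nat) (F : field) : Prop :=
  (forall i (a : p.-tuple 'I_n), smooth_on (chart_img i) (fun x => F i x a)) /\
  (forall i j m, chart_dom i m -> chart_dom j m -> forall a : p.-tuple 'I_n,
     F i (chart_map i m) a =
     \sum_(b : p.-tuple 'I_n)
       (\prod_(s < p) jacobian i j (chart_map i m) (tnth a s) (tnth b s)) *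
       F j (chart_map j m) b).

Definition is_form (k : nat) (F : field) : Prop :=
  is_tensor k F /\
  forall i x, chart_img i x -> forall (s : 'S_k) (a : k.-tuple 'I_n),
    F i x [tuple tnth a (s t) | t < k] = (-1) ^+ s * F i x a.

Definition gram (g : field) (i : chart M) (x : 'rV[R]_n) : 'M[R]_n :=
  \matrix_(a, b) g i x [:: a; b].

(* sg is the number of plus signs in the signature. *)
Definition is_metric (sg : nat) (g : field) : Prop :=
  is_tensor 2 g /\
  forall i x, chart_img i x -> exists2 P : 'M[R]_n, P \in unitmx &
    P^T *m gram g i x *m P = diag_mx (\row_a (if (a < sg)%N then 1 else -1)).

(* F' = e^(w u) F, as tensors with p indices. *)
Definition rescaled (w : R) (p : nat) (u : M -> R) (F F' : field) : Prop :=
  forall i x, chart_img i x -> forall a : p.-tuple 'I_n,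
    F' i x a = expR (w * u (chart_inv i x)) * F i x a.

Definition conf_related (u : M -> R) (g g' : field) : Prop :=
  smooth_fun u /\ rescaled 2 2 u g g'.

Definition conformal_structure (sg : nat) (c : set field) : Prop :=
  exists2 g0, is_metric sg g0 &
    forall g, c g <-> is_metric sg g /\ exists u, conf_related u g0 g.

(* A section of E^k[w] is given by the k-forms F g that represent it in the   *)
(* trivialisations of E[w] by the metrics g of the conformal class c.         *)
(* For F g given by a formula in the Levi-Civita connection of g, this says   *)
(* that the formula is a conformally invariant section of E^k[w].             *)
Definition is_section (c : set field) (k : nat) (w : R) (F : field -> field)
  : Prop :=
  (forall g, c g -> is_form k (F g)) /\
  (forall g g' u, c g -> c g' -> conf_related u g g' ->
     rescaled w k u (F g) (F g')).

Definition ginv (g : field) (i : chart M) (x : 'rV[R]_n) (a b : 'I_n) : R :=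
  invmx (gram g i x) a b.

(* Gamma^c_ab *)
Definition christoffel (g : field) (i : chart M) (x : 'rV[R]_n)
  (c a b : 'I_n) : R :=
  2^-1 * \sum_d ginv g i x c d *
    (pd a (fun y => g i y [:: b; d]) x + pd b (fun y => g i y [:: a; d]) x
     - pd d (fun y => g i y [:: a; b]) x).

(* nabla_c F_a, for a multi-index a; set_nth d a t d is a with its t-th index *)
(* replaced by d.                                                             *)
Definition nabla (g F : field) (i : chart M) (x : 'rV[R]_n)
  (c : 'I_n) (a : seq 'I_n) : R :=
  pd c (fun y => F i y a) x -
  \sum_(t < size a) \sum_d
    christoffel g i x d c (tnth (in_tuple a) t) * F i x (set_nth d a t d).

(* R_ab^c_d, with [nabla_a, nabla_b] v^c = R_ab^c_d v^d *)
Definition riemann (g : field) (i : chart M) (x : 'rV[R]_n)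
  (a b c d : 'I_n) : R :=
  pd a (fun y => christoffel g i y c b d) x
  - pd b (fun y => christoffel g i y c a d) x
  + \sum_e (christoffel g i x c a e * christoffel g i x e b d
            - christoffel g i x c b e * christoffel g i x e a d).

(* R_abcd *)
Definition riemann_low (g : field) (i : chart M) (x : 'rV[R]_n)
  (a b c d : 'I_n) : R :=
  \sum_e g i x [:: c; e] * riemann g i x a b e d.

Definition ricci (g : field) (i : chart M) (x : 'rV[R]_n) (b d : 'I_n) : R :=
  \sum_a riemann g i x a b a d.

Definition scalar_curv (g : field) (i : chart M) (x : 'rV[R]_n) : R :=
  \sum_b \sum_d ginv g i x b d * ricci g i x b d.

(* P_ab: tracing R_abcd = C_abcd + 2 g_c[a P_b]d + 2 g_d[b P_a]c over a, c    *)
(* gives Ric_bd = (n - 2) P_bd + g_bd P^a_a when C is trace-free.             *)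
Definition schouten (g : field) (i : chart M) (x : 'rV[R]_n) (a b : 'I_n) : R :=
  (n%:R - 2)^-1 *
  (ricci g i x a b
   - scalar_curv g i x / (2 * (n%:R - 1)) * g i x [:: a; b]).

(* C_abcd *)
Definition weyl (g : field) (i : chart M) (x : 'rV[R]_n) (a b c d : 'I_n) : R :=
  let G a b := g i x [:: a; b] in
  let P := schouten g i x in
  riemann_low g i x a b c d
  - (G c a * P b d - G c b * P a d) - (G d b * P a c - G d a * P b c).

Definition raise (g : field) (i : chart M) (x : 'rV[R]_n)
  (f : 'I_n -> R) (p : 'I_n) : R := \sum_q ginv g i x p q * f q.

(* (T_[a^1 ... a^p]), the skew part of T, with p = size a *)
Definition alt (T : comps) (a : seq 'I_n) : R :=
  ((size a)`!%:R)^-1 *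
  \sum_(s : 'S_(size a)) (-1) ^+ s *
    T [seq tnth (in_tuple a) (s t) | t <- enum 'I_(size a)].

(* The projection {c a^m}_0 of f_{c a^m} in T^* (x) Lambda^m, m = size a > 0, *)
(* i.e. f_{c a^m} - f_[c a^m] - m/(n-m+1) g_{c[a^1} t_{a^2...a^m]}, where     *)
(* t_{a^2...a^m} = f^p_{p a^2...a^m}. The skew part of f is trace-free, the   *)
(* trace part has no skew part, and the factor is the one that cancels the    *)
(* trace since the trace of g_{c[a^1} t_{a^2...a^m]} over c, a^1 is           *)
(* (n-m+1)/m t.                                                               *)
Definition proj0 (g : field) (i : chart M) (x : 'rV[R]_n)
  (f : 'I_n -> comps) (c : 'I_n) (a : seq 'I_n) : R :=
  let m := size a in
  let t b := \sum_p raise g i x (fun q => f q (p :: b)) p in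
  f c a
  - alt (fun s => if s is d :: s' then f d s' else 0) (c :: a)
  - m%:R / (n%:R - m%:R + 1) *
    alt (fun s => if s is b :: s' then g i x [:: c; b] * t s' else 0) a.

Definition eq_proj0 (m : nat) (g : field)
  (T S : chart M -> 'rV[R]_n -> 'I_n -> comps) : Prop :=
  forall i x, chart_img i x -> forall c (a : m.-tuple 'I_n),
    proj0 g i x (T i x) c a = proj0 g i x (S i x) c a.

Definition conformal_killing (c : set field) (m : nat) (F : field -> field)
  : Prop :=
  forall g, c g -> eq_proj0 m g (nabla g (F g)) (fun _ _ _ _ => 0).

(* 2 sigma^p nabla^q tau_{a p q} + (n-k+1) (nabla^p sigma^q) tau_{a p q} *)
Definition tau_over (k : nat) (sigma tau : field -> field) (g : field) : field :=
  fun i x a =>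
  let up := raise g i x in
  2 * (\sum_p \sum_q
    up (fun p' => sigma g i x [:: p']) p *
    up (fun q' => nabla g (tau g) i x q' (a ++ [:: p; q])) q) +
  (n%:R - k%:R + 1) * (\sum_p \sum_q
    up (fun p' => up (fun q' => nabla g (sigma g) i x p' [:: q']) q) p *
    tau g i x (a ++ [:: p; q])).

(* 2 sigma_{a^{k+1}} nabla_{a^{k+2}} tau_{a^k}                                *)
(*   + (k+1) (nabla_{a^{k+1}} sigma_{a^{k+2}}) tau_{a^k}, skewed over a^{k+2} *)
Definition tau_under (k : nat) (sigma tau : field -> field) (g : field)
  : field :=
  fun i x => alt (fun s =>
    if drop k s is [:: y; z] then
      2 * (sigma g i x [:: y] * nabla g (tau g) i x z (take k s)) +
      k.+1%:R * (nabla g (sigma g) i x y [:: z] * tau g i x (take k s))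
    else 0).

(* (n-k+1) C^r_c^{pq} tau_{a^{k-2} p q} sigma_r                               *)
(*   + (k-2) C_{c a^1}^{pq} tau_{p a^2...a^{k-2} q r} sigma^r                 *)
Definition weyl_over (k : nat) (sigma tau : field -> field) (g : field)
  (i : chart M) (x : 'rV[R]_n) (c : 'I_n) : comps :=
  let up := raise g i x in
  let C := weyl g i x in
  alt (fun s =>
    (n%:R - k%:R + 1) *
    (\sum_p \sum_q \sum_r
       up (fun r' => up (fun p' => up (fun q' => C r' c p' q') q) p) r *
       tau g i x (s ++ [:: p; q]) * sigma g i x [:: r]) +
    (k%:R - 2) *
    (if s is b :: s' then
       \sum_p \sum_q \sum_r
         up (fun p' => up (fun q' => C c b p' q') q) p *
         tau g i x (p :: s' ++ [:: q; r]) *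
         up (fun r' => sigma g i x [:: r']) r
     else 0)).

(* 2 C_{c a^{k+1} a^1}^p tau_{p a^2...a^k} sigma_{a^{k+2}}                    *)
(*   - C^p_{c a^{k+1} a^{k+2}} tau_{a^k} sigma_p, skewed over a^{k+2}         *)
Definition weyl_under (k : nat) (sigma tau : field -> field) (g : field)
  (i : chart M) (x : 'rV[R]_n) (c : 'I_n) : comps :=
  let up := raise g i x in
  let C := weyl g i x in
  alt (fun s =>
    if (take k s, drop k s) is (b :: s', [:: y; z]) then
      2 * (\sum_p up (fun p' => C c y b p') p * tau g i x (p :: s') *
                  sigma g i x [:: z])
      - \sum_p up (fun p' => C p' c y z) p * tau g i x (b :: s') *
               sigma g i x [:: p]
    else 0).

End Fields.

(* Main.v *)
Require Import Defs.
From HB Require Import structures.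
From mathcomp Require Import all_boot all_order all_algebra perm.
From mathcomp Require Import all_classical all_reals all_analysis.
From mathcomp Require Import ring lra zify.
Set Implicit Arguments.
Unset Strict Implicit.
Unset Printing Implicit Defensive.
Import Order.TTheory GRing.Theory Num.Theory.
Import numFieldNormedType.Exports.
Local Open Scope classical_set_scope.
Local Open Scope ring_scope.

(** In a chart, write i_c for the insertion of the index c into the first slot
    of a form. A form tau solves the conformal Killing equation iff
    nabla_c tau = i_c mu + g_c ^ rho for an exterior part mu, proportional to
    d tau, and a trace part rho, proportional to the divergence of tau
    (killing_ckf). Let mu' and nu be these parts for sigma. Then, up to constant
    factors, the two brackets are the double contraction of tau with mu' minus
    2 sigma^p i_p rho, and 2 sigma ^ mu + 2 mu' ^ tau (overA_killing,
    underA_killing).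

    Differentiating the equation again and comparing with the Ricci identity
    gives i_c X_b - i_b X_c + g_c ^ N_b - g_b ^ N_c = - D_bc tau (ckf_prolong),
    where X and N are nabla mu and nabla rho corrected by the Schouten tensor
    and D_bc is the action of the Weyl tensor on forms. The exterior product
    of this identity with dx^c gives X_b, and its trace gives N_c, in terms of
    the Weyl tensor and tau, up to a term g_b ^ (...) in X_b and a term
    i_c (...) in N_c (prolong_X, prolong_N); two further unknowns drop out by
    the first Bianchi identity (sum_dl_X, div_N). The Leibniz rule for the
    first bracket involves X of sigma and N of tau, that for the second X of
    both. Up to terms i_c (...) + g_c ^ (...), the derivative of each bracket
    is therefore a nonzero multiple of the stated expression in the Weyl
    tensor (nab_over0, W_overE, nab_under0, W_underE). On forms, the projection
    {c a}_0 annihilates exactly these remaining terms (proj0_pure, pure_proj0),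
    so that the two projections vanish together (over_proj, under_proj).

    These identities hold over any torsion-free commutative ring that contains
    the inverses of n - 2 and 2 (n - 1) and carries commuting derivations and a
    metric with its Levi-Civita connection. The ring is that of the smooth
    functions on the image of a chart, and evaluation at a point gives the
    components in the statement.

    That the brackets are forms follows because covariant derivatives commute
    with the pull-back by a transition map, which rests on the chain rule and
    the symmetry of second derivatives (christoffel_trans, nabla_trans). For a
    conformal change of the metric by e^(2u), with Y = du, the derivative of a
    k-form of weight k + 1 changes, up to the factor given by the weight, by
    i_c (Y ^ tau) + g_c ^ Y^p i_p tau (nabla_conf), and the contributions of
    sigma and tau to each bracket cancel (overR_conf, underR_conf). *)

(** * Exterior calculus over a commutative ring *)

(** Components of a covariant tensor, indexed by sequences of all lengths as
    in fields; a k-form is an alternating family supported in length k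
    (isform). The coefficients form a ring A, which will be the smooth
    functions on a chart image or the real numbers at a point. *)
Definition form (A : comPzRingType) (n : nat) := seq 'I_n -> A.
HB.instance Definition _ (A : comPzRingType) (n : nat) :=
  GRing.Lmodule.copy (form A n) (seq 'I_n -> A^o).
Definition covec (A : comPzRingType) (n : nat) := 'I_n -> A.
HB.instance Definition _ (A : comPzRingType) (n : nat) :=
  GRing.Lmodule.copy (covec A n) ('I_n -> A^o).

Section Exterior.
Variables (A : comPzRingType) (n : nat).
Local Notation form := (form A n).
Local Notation covec := (covec A n).
Implicit Types (F G : form) (v w : covec) (b c d : 'I_n) (s : seq 'I_n).

Lemma formD F G s : (F + G) s = F s + G s. Proof. by []. Qed.
Lemma formN F s : (- F) s = - F s. Proof. by []. Qed.
Lemma formZ (a : A) F s : (a *: F) s = a * F s. Proof. by []. Qed.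
Lemma form0 s : (0 : form) s = 0. Proof. by []. Qed.
Lemma form_sum (J : Type) (r : seq J) (P : pred J) (f : J -> form) s :
  (\sum_(j <- r | P j) f j) s = \sum_(j <- r | P j) f j s.
Proof. by elim/big_rec2: _ => //= j x y _ <-. Qed.
Definition formE := (formD, formN, formZ, form0, form_sum).

Lemma covD v w b : (v + w) b = v b + w b. Proof. by []. Qed.
Lemma covN v b : (- v) b = - v b. Proof. by []. Qed.
Lemma covZ (a : A) v b : (a *: v) b = a * v b. Proof. by []. Qed.
Lemma cov0 b : (0 : covec) b = 0. Proof. by []. Qed.
Lemma cov_sum (J : Type) (r : seq J) (P : pred J) (f : J -> covec) b :
  (\sum_(j <- r | P j) f j) b = \sum_(j <- r | P j) f j b.
Proof. by elim/big_rec2: _ => //= j x y _ <-. Qed.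
Definition covE := (covD, covN, covZ, cov0, cov_sum).

Definition ctr b F : form := fun s => F (b :: s).

Lemma ctr_linear b : linear (ctr b).
Proof. by move=> a F G; apply/funext => s. Qed.
HB.instance Definition _ b :=
  GRing.isLinear.Build A form form _ (ctr b) (ctr_linear b).

(** Defined by the anticommutation rule with contraction (ctr_wedge), so that
    identities follow by induction on the index sequence. On an alternating F
    with k indices this is k + 1 times the skew part of the tensor product of
    v and F. *)
Fixpoint wedge_rec v F s : A :=
  if s is b :: s' then v b * F s' - wedge_rec v (ctr b F) s' else 0.
Definition wedge v F : form := wedge_rec v F.
Arguments wedge : simpl never.
Lemma wedge_nil v F : wedge v F [::] = 0. Proof. by []. Qed.
Lemma wedge_cons v F b s : wedge v F (b :: s) = v b * F s - wedge v (ctr b F) s.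
Proof. by []. Qed.

Lemma wedge_linear v : linear (wedge v).
Proof.
move=> a F G; apply/funext => s; elim: s F G => [|b s IH] F G.
  by rewrite !formE mulr0 addr0.
by rewrite !formE !wedge_cons linearP IH !formE; ring.
Qed.
HB.instance Definition _ v :=
  GRing.isLinear.Build A form form _ (wedge v) (wedge_linear v).

Lemma wedgevP (a : A) v w F : wedge (a *: v + w) F = a *: wedge v F + wedge w F.
Proof.
apply/funext => s; elim: s F => [|b s IH] F.
  by rewrite !formE mulr0 addr0.
by rewrite !formE !wedge_cons IH !formE !covE; ring.
Qed.

Definition wedgev F v : form := wedge v F.
Lemma wedgev_linear F : linear (wedgev F).
Proof. by move=> a v w; rewrite /wedgev wedgevP. Qed.
HB.instance Definition _ F :=
  GRing.isLinear.Build A covec form _ (wedgev F) (wedgev_linear F).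

Lemma wedgevD v w F : wedge (v + w) F = wedge v F + wedge w F.
Proof. exact: (linearD (wedgev F)). Qed.
Lemma wedgevN v F : wedge (- v) F = - wedge v F.
Proof. exact: (linearN (wedgev F)). Qed.
Lemma wedgevZ a v F : wedge (a *: v) F = a *: wedge v F.
Proof. exact: (linearZ_LR (wedgev F)). Qed.
Lemma wedgev_sum (J : finType) (P : pred J) (f : J -> covec) F :
  wedge (\sum_(j | P j) f j) F = \sum_(j | P j) wedge (f j) F.
Proof. exact: (linear_sum (wedgev F)). Qed.

Lemma ctr_wedge b v F : ctr b (wedge v F) = v b *: F - wedge v (ctr b F).
Proof. by []. Qed.

Lemma ctrD b F G : ctr b (F + G) = ctr b F + ctr b G. Proof. by []. Qed.
Lemma ctrZ a b F : ctr b (a *: F) = a *: ctr b F. Proof. by []. Qed.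
Lemma wedgeZ a v F : wedge v (a *: F) = a *: wedge v F.
Proof. exact: (linearZ_LR (wedge v)). Qed.

Lemma wedgeDr v F G : wedge v (F + G) = wedge v F + wedge v G.
Proof. exact: (linearD (wedge v)). Qed.
Lemma wedgeNr v F : wedge v (- F) = - wedge v F.
Proof. exact: (linearN (wedge v)). Qed.
Lemma wedgeBr v F G : wedge v (F - G) = wedge v F - wedge v G.
Proof. by rewrite wedgeDr wedgeNr. Qed.

Lemma wedgeC v w F : wedge v (wedge w F) = - wedge w (wedge v F).
Proof.
apply/funext => s; elim: s F => [|b s IH] F; first by rewrite !formE oppr0.
have E x y G : wedge x (wedge y G) (b :: s) =
   x b * wedge y G s - (y b * wedge x G s - wedge x (wedge y (ctr b G)) s).
  by rewrite wedge_cons ctr_wedge linearB linearZ.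
by rewrite !formE !E IH !formE; ring.
Qed.

Definition altern F := forall s1 b c s2, F (s1 ++ b :: c :: s2) = - F (s1 ++ c :: b :: s2).
Definition deg k F := forall s, size s != k -> F s = 0.
Definition isform k F := altern F /\ deg k F.

Lemma altern_ctr b F : altern F -> altern (ctr b F).
Proof. by move=> aF s1 c d s2; rewrite /ctr -!cat_cons aF. Qed.

Lemma alternP (a : A) F G : altern F -> altern G -> altern (a *: F + G).
Proof. by move=> aF aG s1 b c s2; rewrite !formE aF aG; ring. Qed.

Lemma altern0 : altern 0.
Proof. by move=> *; rewrite form0 oppr0. Qed.

Lemma alternZ (a : A) F : altern F -> altern (a *: F).
Proof. by move=> aF; rewrite -[_ *: F]addr0; apply: alternP => //; exact: altern0. Qed.
Lemma alternD F G : altern F -> altern G -> altern (F + G).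
Proof. by move=> aF; rewrite -[F]scale1r; exact: alternP. Qed.
Lemma altern_sum (J : finType) (f : J -> form) :
  (forall j, altern (f j)) -> altern (\sum_j f j).
Proof.
by move=> aF; elim/big_rec: _ => [|j F _]; [exact: altern0|exact: alternD].
Qed.

Lemma ctrC b c F : altern F -> ctr b (ctr c F) = - ctr c (ctr b F).
Proof. by move=> aF; apply/funext => s; exact: (aF [::]). Qed.

(** Contracting twice leaves a skew expression in the two indices, because two
    contractions of F anticommute. *)
Lemma altern_wedge v F : altern F -> altern (wedge v F).
Proof.
move=> aF s1; elim: s1 F aF => [|a s1 IH] F aF b c s2.
  rewrite /= !wedge_cons.
  by rewrite (ctrC _ _ aF) linearN /= /ctr; rewrite !formE; ring.
rewrite /= !wedge_cons IH; last exact: altern_ctr.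
by rewrite (aF s1 b c s2) mulrN opprB opprK addrC.
Qed.

Lemma isform_ctr k b F : isform k F -> isform k.-1 (ctr b F).
Proof.
move=> [aF dF]; split; first exact: altern_ctr.
by move=> s sk; apply: dF; apply: contra sk => /= /eqP <-.
Qed.

Lemma ctr_deg0 b F : deg 0 F -> ctr b F = 0.
Proof. by move=> dF; apply/funext => s; exact: dF. Qed.

Lemma deg_wedge k v F : deg k F -> deg k.+1 (wedge v F).
Proof.
move=> dF s; elim: s k F dF => [//|b s IH] k F dF sk; rewrite wedge_cons.
rewrite dF //; case: k dF sk => [|k] dF sk.
  by rewrite (ctr_deg0 b dF) linear0 form0 subr0 mulr0.
rewrite (IH k) ?mulr0 ?subr0 // => t tk; exact: dF.
Qed.

Lemma isform_wedge k v F : isform k F -> isform k.+1 (wedge v F).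
Proof. by move=> [aF dF]; split; [exact: altern_wedge|exact: deg_wedge]. Qed.

Lemma isformP k (a : A) F G : isform k F -> isform k G -> isform k (a *: F + G).
Proof.
move=> [aF dF] [aG dG]; split; first exact: alternP.
by move=> s sk; rewrite !formE dF // dG // mulr0 addr0.
Qed.
Lemma isform0 k : isform k 0.
Proof. by split; [exact: altern0|]. Qed.
Lemma isformZ k (a : A) F : isform k F -> isform k (a *: F).
Proof. by move=> iF; rewrite -[_ *: _]addr0; apply: isformP => //; exact: isform0. Qed.
Lemma isformD k F G : isform k F -> isform k G -> isform k (F + G).
Proof. by move=> iF iG; rewrite -[F]scale1r; exact: isformP. Qed.
Lemma isform_sum k (J : finType) (P : pred J) (f : J -> form) :
  (forall j, isform k (f j)) -> isform k (\sum_(j | P j) f j).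
Proof.
by move=> iF; elim/big_rec: _ => [|j F _]; [exact: isform0|exact: isformD].
Qed.

Definition dl c : covec := fun b => (b == c)%:R.

Lemma sum_dl (V : lmodType A) (f : 'I_n -> V) b : \sum_c dl c b *: f c = f b.
Proof.
rewrite (bigD1 b) //= big1 ?addr0 /dl ?eqxx ?scale1r // => c /negbTE.
by rewrite eq_sym => ->; rewrite scale0r.
Qed.
Lemma sum_dlr (V : lmodType A) (f : 'I_n -> V) b : \sum_c dl b c *: f c = f b.
Proof. by rewrite -[RHS]sum_dl; apply: eq_bigr => c _; rewrite /dl eq_sym. Qed.
Lemma cov_dl v : v = \sum_c v c *: dl c.
Proof.
apply/funext => b; rewrite cov_sum -[LHS](sum_dl (v : 'I_n -> A^o)).
by apply: eq_bigr => c _; rewrite covZ mulrC.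
Qed.

(** A form of degree k has k slots, and each of them reproduces F once. *)
Lemma euler k F : isform k F -> \sum_c wedge (dl c) (ctr c F) = k%:R *: F.
Proof.
move=> [aF dF]; apply/funext => s; rewrite formE formZ.
have -> : k%:R * F s = (size s)%:R * F s.
  by case: (eqVneq (size s) k) => [->//|/dF->]; rewrite !mulr0.
clear dF k; elim: s F aF => [|b s IH] F aF /=.
  by rewrite big1 ?mul0r.
rewrite (eq_bigr _ (fun c _ => wedge_cons _ _ _ _)) big_split /= -natr1 mulrDl addrC; congr (_ + _); last first.
  by rewrite (sum_dl (fun c => F (c :: s) : A^o)) mul1r.
rewrite -(IH _ (altern_ctr b aF)); apply: eq_bigr => c _.
by rewrite ctrC // linearN /= formN opprK.
Qed.

Lemma sum_wedge_ctr (X : 'I_n -> form) b :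
  \sum_c (wedge (dl c) (ctr b (X c)) : form) =
  X b - ctr b (\sum_c wedge (dl c) (X c)).
Proof.
rewrite linear_sum /= (eq_bigr _ (fun c _ => ctr_wedge b (dl c) (X c))) big_split /=.
by rewrite sum_dl sumrN opprD opprK addrA subrr add0r.
Qed.

Lemma wedge_dl v F : wedge v F = \sum_c v c *: wedge (dl c) F.
Proof.
by rewrite {1}(cov_dl v) wedgev_sum; apply: eq_bigr => c _; rewrite wedgevZ.
Qed.

(** The endomorphism M acting on each slot in turn. Christoffel symbols give
    the correction in a covariant derivative, a curvature endomorphism gives
    the right-hand side of the Ricci identity. *)
Fixpoint der_rec (M : 'I_n -> covec) F s : A :=
  if s is b :: s' then \sum_d M d b * F (d :: s') + der_rec M (ctr b F) s' else 0.
Definition der (M : 'I_n -> covec) F : form := der_rec M F.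
Arguments der : simpl never.
Lemma der_nil M F : der M F [::] = 0. Proof. by []. Qed.
Lemma der_cons M F b s :
  der M F (b :: s) = \sum_d M d b * F (d :: s) + der M (ctr b F) s.
Proof. by []. Qed.

Lemma der_linear M : linear (der M).
Proof.
move=> a F G; apply/funext => s; elim: s F G => [|b s IH] F G.
  by rewrite !formE mulr0 addr0.
rewrite !formE !der_cons linearP IH !formE mulrDr addrACA; congr (_ + _).
by rewrite mulr_sumr -big_split /=; apply: eq_bigr => d _; rewrite !formE; ring.
Qed.
HB.instance Definition _ M :=
  GRing.isLinear.Build A form form _ (der M) (der_linear M).

Lemma derDr M F G : der M (F + G) = der M F + der M G.
Proof. exact: (linearD (der M)). Qed.
Lemma derNr M F : der M (- F) = - der M F.
Proof. exact: (linearN (der M)). Qed.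
Lemma derZr M a F : der M (a *: F) = a *: der M F.
Proof. exact: (linearZ_LR (der M)). Qed.

Lemma ctr_der b M F : ctr b (der M F) = \sum_d M d b *: ctr d F + der M (ctr b F).
Proof. by apply/funext => s; rewrite !formE. Qed.

Lemma der_wedgeE M F : altern F -> der M F = \sum_d wedge (M d) (ctr d F).
Proof.
move=> aF; apply/funext => s; rewrite formE.
elim: s F aF => [|b s IH] F aF; first by rewrite big1.
rewrite der_cons (eq_bigr _ (fun c _ => wedge_cons _ _ _ _)) big_split /=; congr (_ + _).
rewrite IH; last exact: altern_ctr.
by apply: eq_bigr => d _; rewrite (ctrC b d aF) linearN /= formN opprK.
Qed.

Lemma der_wedge M v F : der M (wedge v F) =
  wedge (fun b => \sum_d M d b * v d) F + wedge v (der M F).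
Proof.
apply/funext => s; elim: s F => [|b s IH] F; first by rewrite !formE addr0.
rewrite formE der_cons !wedge_cons ctr_wedge linearB linearZ /= !formE IH !formE ctr_der linearD /=.
rewrite !formE linear_sum formE.
under eq_bigr do rewrite wedge_cons.
have -> : \sum_d M d b * (v d * F s - wedge v (ctr d F) s) =
  (\sum_d M d b * v d) * F s - \sum_d wedge v (M d b *: ctr d F) s.
  rewrite mulr_suml -sumrB; apply: eq_bigr => d _.
  by rewrite linearZ /= formE; ring.
ring.
Qed.

Lemma derD M N F : der (fun d b => M d b + N d b) F = der M F + der N F.
Proof.
apply/funext => s; elim: s F => [|b s IH] F; first by rewrite !formE addr0.
rewrite der_cons IH !formE !der_cons addrACA; congr (_ + _); rewrite -big_split /=.
by apply: eq_bigr => d _; rewrite mulrDl.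
Qed.

Lemma derZ a M F : der (fun d b => a * M d b) F = a *: der M F.
Proof.
apply/funext => s; elim: s F => [|b s IH] F; first by rewrite !formE mulr0.
rewrite der_cons IH !formE !der_cons mulrDr; congr (_ + _); rewrite mulr_sumr.
by apply: eq_bigr => d _; rewrite mulrA.
Qed.

Lemma der_comm M N F : der M (der N F) - der N (der M F) =
  der (fun d b => \sum_e (N d e * M e b - M d e * N e b)) F.
Proof.
apply/funext => s; rewrite !formE; elim: s F => [|b s IH] F; first by rewrite subrr.
rewrite !der_cons.
have E P Q : \sum_d P d b * (\sum_e Q e d * F (e :: s) + der Q (ctr d F) s) +
   der P (ctr b (der Q F)) s = \sum_d (\sum_e Q d e * P e b) * F (d :: s) +
   ((\sum_d P d b * der Q (ctr d F) s + \sum_d Q d b * der P (ctr d F) s) + der P (der Q (ctr b F)) s).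
  rewrite ctr_der linearD linear_sum /= !formE !addrA; congr (_ + _).
  rewrite -!addrA addrA; congr (_ + _); last by apply: eq_bigr => d _; rewrite linearZ.
  rewrite -big_split /= (eq_bigr _ (fun d _ => mulrDr _ _ _)) big_split /=.
  rewrite [RHS]big_split /=; congr (_ + _).
  under eq_bigr do rewrite mulr_sumr; rewrite exchange_big /=; apply: eq_bigr => d _.
  by rewrite mulr_suml; apply: eq_bigr => e _; ring.
rewrite !E -IH.
have -> : \sum_d (\sum_e (N d e * M e b - M d e * N e b)) * F (d :: s) =
  \sum_d (\sum_e N d e * M e b) * F (d :: s) - \sum_d (\sum_e M d e * N e b) * F (d :: s).
  by rewrite -sumrB; apply: eq_bigr => d _; rewrite sumrB mulrBl.
ring.
Qed.

End Exterior.
Global Arguments wedge : simpl never.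
Global Arguments der : simpl never.

(** Identities between linear combinations of forms are ring identities in
    each component. *)
Ltac form_ring := apply/funext => ?; rewrite !formE; ring.

(** * Metric contractions, Weyl tensors and the prolonged Killing system *)

Section Metric.
Variables (A : comPzRingType) (n : nat).
Local Notation form := (form A n).
Local Notation covec := (covec A n).
Implicit Types (F G : form) (v w : covec) (b c d p q : 'I_n) (s : seq 'I_n).

Variables (g gi : 'I_n -> covec).

Definition metric_pair := [/\ forall a b, g a b = g b a,
  forall a b, gi a b = gi b a & forall a b, \sum_c gi a c * g c b = dl A a b].

Hypothesis gP : metric_pair.

Lemma g_sym a b : g a b = g b a. Proof. by case: gP. Qed.
Lemma gi_sym a b : gi a b = gi b a. Proof. by case: gP. Qed.
Lemma gi_g a b : \sum_c gi a c * g c b = dl A a b. Proof. by case: gP. Qed.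
Lemma g_gi a b : \sum_c g a c * gi c b = dl A b a.
Proof. by rewrite -gi_g; apply: eq_bigr => c _; rewrite mulrC g_sym gi_sym. Qed.

Definition rais v : covec := fun p => \sum_q gi p q * v q.
Definition up p F : form := \sum_a gi p a *: ctr a F.

Lemma upE p F : up p F = \sum_a gi p a *: ctr a F. Proof. by []. Qed.

Lemma up_linear p : linear (up p).
Proof.
move=> a F G; rewrite /up scaler_sumr -big_split /=; apply: eq_bigr => c _.
by rewrite (linearP (ctr c)) scalerDr !scalerA mulrC.
Qed.
HB.instance Definition _ p := GRing.isLinear.Build A form form _ (up p) (up_linear p).

Lemma upZ a p F : up p (a *: F) = a *: up p F.
Proof. exact: (linearZ_LR (up p)). Qed.

Lemma upD p F G : up p (F + G) = up p F + up p G.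
Proof. exact: (linearD (up p)). Qed.
Lemma upN p F : up p (- F) = - up p F.
Proof. exact: (linearN (up p)). Qed.

Lemma up_wedge p v F : up p (wedge v F) = rais v p *: F - wedge v (up p F).
Proof.
rewrite /up (eq_bigr _ (fun a _ => congr1 _ (ctr_wedge a v F))).
under eq_bigr do rewrite scalerBr scalerA.
rewrite sumrB -scaler_suml; congr (_ - _).
by rewrite linear_sum; apply: eq_bigr => a _; rewrite linearZ.
Qed.

Lemma ctr_up b p F : altern F -> ctr b (up p F) = - up p (ctr b F).
Proof.
move=> aF; rewrite /up linear_sum -sumrN; apply: eq_bigr => a _.
by rewrite linearZ /= ctrC // scalerN.
Qed.

Lemma altern_up p F : altern F -> altern (up p F).
Proof.
move=> aF; rewrite /up; elim/big_rec: _ => [|a G _ aG]; first exact: altern0.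
by apply: alternP => //; exact: altern_ctr.
Qed.

Lemma upC p q F : altern F -> up p (up q F) = - up q (up p F).
Proof.
move=> aF; rewrite [up p F]/up (linear_sum (up q)) -sumrN; apply: eq_bigr => a _.
by rewrite ctr_up // linearZ /= scalerN.
Qed.

Lemma isform_up k p F : isform k F -> isform k.-1 (up p F).
Proof. by move=> iF; apply: isform_sum => a; apply: isformZ; exact: isform_ctr. Qed.

Lemma rais_g c p : rais (g c) p = dl A p c.
Proof. by rewrite -gi_g; apply: eq_bigr => q _; rewrite (g_sym c). Qed.

Lemma g_up c F : \sum_p g c p *: up p F = ctr c F.
Proof.
under eq_bigr do rewrite scaler_sumr.
rewrite exchange_big /= -[RHS](sum_dl (fun a => ctr a F)); apply: eq_bigr => a _.
by rewrite -g_gi scaler_suml; apply: eq_bigr => p _; rewrite scalerA.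
Qed.

(** Contraction with the vector obtained from v by raising its index. *)
Definition ctrv v F : form := \sum_p v p *: up p F.

Lemma ctrvE v F : ctrv v F = \sum_p v p *: up p F. Proof. by []. Qed.

Lemma ctrv_linear v : linear (ctrv v).
Proof.
move=> a F G; rewrite /ctrv scaler_sumr -big_split /=; apply: eq_bigr => c _.
by rewrite (linearP (up c)) scalerDr !scalerA mulrC.
Qed.
HB.instance Definition _ v := GRing.isLinear.Build A form form _ (ctrv v) (ctrv_linear v).

Lemma ctrvZr a v F : ctrv v (a *: F) = a *: ctrv v F.
Proof. exact: (linearZ_LR (ctrv v)). Qed.

Lemma ctrvDr v F G : ctrv v (F + G) = ctrv v F + ctrv v G.
Proof. exact: (linearD (ctrv v)). Qed.
Lemma ctrvNr v F : ctrv v (- F) = - ctrv v F.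
Proof. exact: (linearN (ctrv v)). Qed.

Lemma ctrvP a v w F : ctrv (a *: v + w) F = a *: ctrv v F + ctrv w F.
Proof.
rewrite /ctrv scaler_sumr -big_split /=; apply: eq_bigr => p _.
by rewrite covD covZ scalerDl scalerA.
Qed.
Lemma ctrvD v w F : ctrv (v + w) F = ctrv v F + ctrv w F.
Proof. by rewrite -{1}[v]scale1r ctrvP scale1r. Qed.
Lemma ctrvZ a v F : ctrv (a *: v) F = a *: ctrv v F.
Proof. by rewrite -{1}[a *: v]addr0 ctrvP /ctrv [X in _ + X]big1 ?addr0 // => p _; rewrite scale0r. Qed.
Lemma ctrv_suml (J : finType) (f : J -> covec) F :
  ctrv (\sum_j f j) F = \sum_j ctrv (f j) F.
Proof.
elim/big_rec2: _ => [|j x y _ <-]; last exact: ctrvD.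
by rewrite /ctrv big1 // => p _; rewrite scale0r.
Qed.
Lemma ctrv_g c F : ctrv (g c) F = ctr c F. Proof. exact: g_up. Qed.

Lemma isform_ctrv k v F : isform k F -> isform k.-1 (ctrv v F).
Proof. by move=> iF; apply: isform_sum => a; apply: isformZ; exact: isform_up. Qed.

Lemma altern_ctrv v F : altern F -> altern (ctrv v F).
Proof.
move=> aF; rewrite /ctrv; elim/big_rec: _ => [|a G _ aG]; first exact: altern0.
by apply: alternP => //; exact: altern_up.
Qed.

Lemma ctr_ctrv b v F : altern F -> ctr b (ctrv v F) = - ctrv v (ctr b F).
Proof.
move=> aF; rewrite linear_sum -sumrN; apply: eq_bigr => p _.
by rewrite linearZ /= ctr_up // scalerN.
Qed.

Lemma up_ctrv q v F : altern F -> up q (ctrv v F) = - ctrv v (up q F).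
Proof.
move=> aF; rewrite linear_sum -sumrN; apply: eq_bigr => p _.
by rewrite linearZ /= upC // scalerN.
Qed.

Lemma ctrvC v w F : altern F -> ctrv v (ctrv w F) = - ctrv w (ctrv v F).
Proof.
move=> aF; rewrite [ctrv w F]/ctrv (linear_sum (ctrv v)) -sumrN; apply: eq_bigr => q _.
by rewrite linearZ /= up_ctrv // scalerN opprK.
Qed.

Lemma ctrv_wedge v w F :
  ctrv v (wedge w F) = (\sum_p v p * rais w p) *: F - wedge w (ctrv v F).
Proof.
rewrite /ctrv; under eq_bigr do rewrite up_wedge scalerBr scalerA.
rewrite sumrB -scaler_suml; congr (_ - _).
by rewrite linear_sum; apply: eq_bigr => p _; rewrite linearZ.
Qed.

(** Symmetry arguments end in x = - x or in 3 x = 0. *)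
Definition tfree := forall m (x : A), m.+1%:R * x = 0 -> x = 0.

Lemma tfree_form m F : tfree -> m.+1%:R *: F = 0 -> F = 0.
Proof.
move=> tf F0; apply/funext => s; apply: (tf m).
exact: (congr1 (fun H : form => H s) F0).
Qed.

Lemma eq_opp_form F : tfree -> F = - F -> F = 0.
Proof.
move=> tf FN; apply: (@tfree_form 1) => //.
by rewrite scaler_nat mulr2n {1}FN addNr.
Qed.

(** A skew pair of indices contracted with the symmetric inverse metric. *)
Lemma up_ctr_tr F : tfree -> altern F -> \sum_p up p (ctr p F) = 0.
Proof.
move=> tf aF; apply: eq_opp_form => //; rewrite /up.
rewrite {1}exchange_big -sumrN; apply: eq_bigr => p _; rewrite -sumrN; apply: eq_bigr => a _.
by rewrite ctrC // scalerN gi_sym.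
Qed.

Lemma euler_g k F : isform k F -> \sum_b wedge (g b) (up b F) = k%:R *: F.
Proof.
move=> iF; rewrite -(euler iF) /up.
under eq_bigr do rewrite linear_sum.
rewrite exchange_big /=; apply: eq_bigr => a _.
rewrite (_ : dl A a = \sum_b gi a b *: g b); last first.
  by apply/funext => c; rewrite cov_sum -gi_g.
rewrite wedgev_sum; apply: eq_bigr => b _.
by rewrite linearZ wedgevZ gi_sym.
Qed.

(** The contraction of g with its inverse gives n, and each of the k indices
    of F takes away 1. *)
Lemma up_g_sum k F : isform k F ->
  \sum_b up b (wedge (g b) F) = (n%:R - k%:R) *: F.
Proof.
move=> iF; rewrite (eq_bigr _ (fun b _ => up_wedge b (g b) F)) sumrB (euler_g iF).
rewrite scalerBl -scaler_suml; congr (_ *: _ - _).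
rewrite (eq_bigr (fun=> 1)) ?sumr_const ?card_ord // => b _.
by rewrite rais_g /dl eqxx.
Qed.

Lemma up_g_wedge c (N : 'I_n -> form) :
  \sum_b up b (wedge (g c) (N b)) = N c - wedge (g c) (\sum_b up b (N b)).
Proof.
rewrite (eq_bigr _ (fun b _ => up_wedge b (g c) (N b))) sumrB (linear_sum (wedge (g c))); congr (_ - _).
by rewrite -[RHS](sum_dl N); apply: eq_bigr => b _; rewrite rais_g.
Qed.

(** Averaging x over the rotations that leave G unchanged gives 0; in this way
    the first Bianchi identity annihilates contractions and exterior products.
    *)
Lemma cyc_sum0 (V : lmodType A) (x : 'I_n -> 'I_n -> 'I_n -> A)
    (G : 'I_n -> 'I_n -> 'I_n -> V) :
  (forall a b c, x a b c + x b c a + x c a b = 0) ->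
  (forall a b c, G a b c = G b c a) ->
  3%:R *: (\sum_a \sum_b \sum_c x a b c *: G a b c) = 0.
Proof.
move=> x0 GC; set S := \sum_a _.
have rot (f : 'I_n -> 'I_n -> 'I_n -> V) :
    \sum_a \sum_b \sum_c f a b c = \sum_a \sum_b \sum_c f b c a.
  transitivity (\sum_a \sum_c \sum_b f a b c); last by rewrite exchange_big.
  by apply: eq_bigr => a _; rewrite exchange_big.
have E1 : S = \sum_a \sum_b \sum_c x b c a *: G a b c.
  rewrite /S rot; do 3 apply: eq_bigr => ? _; congr (_ *: _); by rewrite -GC.
have E2 : S = \sum_a \sum_b \sum_c x c a b *: G a b c.
  rewrite /S rot rot; do 3 apply: eq_bigr => ? _; congr (_ *: _); by rewrite GC.
have -> : 3%:R *: S = S + S + S by rewrite scaler_nat !mulrS mulr0n addr0 addrA.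
rewrite {2}E1 {2}E2 /S.
rewrite -!big_split big1 // => a _; rewrite -!big_split big1 // => b _.
by rewrite -!big_split big1 // => c _; rewrite /= -!scalerDl x0 scale0r.
Qed.

(** The algebraic symmetries of a Weyl tensor. *)
Definition weyl_like (C : 'I_n -> 'I_n -> 'I_n -> covec) :=
  [/\ forall b c e a, C b c e a = - C c b e a,
      forall b c e a, C b c e a = - C b c a e,
      forall b c e a, C b c e a + C c e b a + C e b c a = 0 &
      forall c a, \sum_b \sum_e gi b e * C b c e a = 0].

(** A signed sum of four instances of the Bianchi identity. *)
Lemma curv_pair (C : 'I_n -> 'I_n -> 'I_n -> covec) a b c d : tfree ->
  (forall a b c d, C a b c d = - C b a c d) ->
  (forall a b c d, C a b c d = - C a b d c) ->
  (forall a b c d, C a b c d + C b c a d + C c a b d = 0) ->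
  C a b c d = C c d a b.
Proof.
move=> tf C12 C34 C123; apply/eqP; rewrite -subr_eq0; apply/eqP; apply: (tf 1).
have H1 := C123 a b c d; have H2 := C123 b c d a.
have H3 := C123 c d a b; have H4 := C123 d a b c.
rewrite (C34 b c d a) (C34 c d b a) in H2.
rewrite (C12 d a c b) (C34 a d c b) (C12 a c d b) (C34 c a d b) !opprK in H3.
rewrite (C12 d a b c) (C34 a b d c) (C12 b d a c) (C34 d b a c) opprK in H4.
transitivity ((C a b c d + C b c a d + C c a b d)
  - (C c d a b + C a d b c + C c a b d)
  - ((- C a d b c - C a b c d + C d b c a)
     - (- C b c a d - C c d a b + C d b c a))); first by ring.
by rewrite H1 H2 H3 H4; ring.
Qed.

Section Weyl.
Variable tf : tfree.
Variable C : 'I_n -> 'I_n -> 'I_n -> covec.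
Hypothesis CP : weyl_like C.

Lemma C12 b c e a : C b c e a = - C c b e a. Proof. by case: CP. Qed.
Lemma C34 b c e a : C b c e a = - C b c a e. Proof. by case: CP. Qed.
Lemma C123 b c e a : C b c e a + C c e b a + C e b c a = 0. Proof. by case: CP. Qed.
Lemma C_tr13 c a : \sum_b \sum_e gi b e * C b c e a = 0. Proof. by case: CP. Qed.

Lemma C_pair a b c d : C a b c d = C c d a b.
Proof. exact: (curv_pair a b c d tf C12 C34 C123). Qed.

Lemma C234 e a b c : C e a b c + C e b c a + C e c a b = 0.
Proof.
rewrite (C_pair e a) (C_pair e b) (C_pair e c) (C34 b) (C34 c) (C34 a b).
by rewrite -!opprD C123 oppr0.
Qed.

Lemma C_tr24 b e : \sum_c \sum_a gi c a * C b c e a = 0.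
Proof.
rewrite -[RHS](C_tr13 b e); apply: eq_bigr => c _; apply: eq_bigr => a _.
by rewrite C12 C34 opprK.
Qed.
Lemma C_tr14 c e : \sum_b \sum_a gi b a * C b c e a = 0.
Proof.
rewrite -[RHS]oppr0 -[in RHS](C_tr13 c e) -sumrN; apply: eq_bigr => b _.
by rewrite -sumrN; apply: eq_bigr => a _; rewrite C34 mulrN.
Qed.

(** The curvature endomorphism C_bc acting on F. *)
Definition D b c F : form := \sum_e wedge (C b c e) (up e F).

Lemma up_D c F : \sum_b up b (D b c F) =
  - \sum_b \sum_e wedge (C b c e) (up b (up e F)).
Proof.
under eq_bigr => b _ do rewrite /D linear_sum (eq_bigr _ (fun e _ => up_wedge b (C b c e) (up e F))) sumrB.
rewrite sumrB exchange_big /= big1 ?sub0r // => e _.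
by rewrite -scaler_suml /rais C_tr14 scale0r.
Qed.

(** The terms that contract C with itself are traces of C and vanish. In the
    rest, C meets a triple contraction of F, which is invariant under rotation
    of its three indices, so that the Bianchi identity applies. *)
Lemma up_up_D F : altern F -> \sum_c up c (\sum_b up b (D b c F)) = 0.
Proof.
move=> aF; under eq_bigr => c _ do rewrite up_D (linearN (up c)) (linear_sum (up c)).
rewrite sumrN -[RHS]oppr0; congr (- _).
under eq_bigr => c _. under eq_bigr => b _.
  rewrite (linear_sum (up c)) (eq_bigr _ (fun e _ => up_wedge c (C b c e) (up b (up e F)))) sumrB. over.
  rewrite sumrB. over.
rewrite sumrB; apply/eqP; rewrite subr_eq0; apply/eqP.
rewrite [LHS]exchange_big big1 => [|b _] /=; last first.
  rewrite exchange_big big1 //= => e _.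
  by rewrite -scaler_suml /rais C_tr24 scale0r.
apply/esym; apply: (@tfree_form 2) => //.
rewrite [X in _ *: X](_ : _ = \sum_a \sum_c \sum_b \sum_e C b c e a *: (wedge (dl A a) (up c (up b (up e F))) : form)).
  rewrite scaler_sumr big1 // => a _; apply: cyc_sum0 => [b c e|c b e].
    by rewrite -(C123 c b e a) addrAC.
  by rewrite (upC c b (altern_up e aF)) (upC c e aF) (linearN (up b)) opprK.
rewrite [RHS]exchange_big; apply: eq_bigr => c _.
rewrite [RHS]exchange_big; apply: eq_bigr => b _.
rewrite [RHS]exchange_big; apply: eq_bigr => e _.
exact: wedge_dl.
Qed.

(** Three indices of C are skewed, and the Bianchi identity applies. *)
Lemma wedge_wedge_D F :
  \sum_b \sum_c wedge (dl A b) (wedge (dl A c) (D b c F)) = 0.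
Proof.
apply: (@tfree_form 2) => //.
rewrite [X in _ *: X](_ : _ = \sum_e \sum_b \sum_c \sum_a C b c e a *:
   wedge (dl A b) (wedge (dl A c) (wedge (dl A a) (up e F)))).
  rewrite scaler_sumr big1 // => e _; apply: cyc_sum0 => [b c a|b c a].
    by rewrite (C_pair b) (C_pair c) (C_pair a) -(C234 e a b c); ring.
  by rewrite (wedgeC (dl A b) (dl A c)) (wedgeC (dl A b) (dl A a)) raddfN opprK.
rewrite [RHS]exchange_big; apply: eq_bigr => b _.
rewrite [RHS]exchange_big; apply: eq_bigr => c _.
rewrite /D (linear_sum (wedge (dl A c))) (linear_sum (wedge (dl A b))); apply: eq_bigr => e _.
rewrite wedge_dl (linear_sum (wedge (dl A c))) (linear_sum (wedge (dl A b))); apply: eq_bigr => a _.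
by rewrite !linearZ.
Qed.

(** E is the integrability condition of the conformal Killing equation
    (ckf_prolong): X and N are the derivatives of the exterior part and of the
    divergence part of nabla F, corrected by the Schouten tensor so that only
    the Weyl tensor is left. Wedging E with a basis covector, or contracting
    it with the inverse metric, solves it for X and N in terms of C and F, up
    to terms that the projection onto the conformal Killing part does not see.
    *)
Section Prolong.
Variables (l : nat) (F : form) (X N : 'I_n -> form).
Hypotheses (ln : (l < n)%N) (iF : isform l.+1 F).
Hypotheses (iX : forall b, isform l.+2 (X b)) (iN : forall b, isform l (N b)).
Hypothesis E : forall b c,
  ctr c (X b) - ctr b (X c) + wedge (g c) (N b) - wedge (g b) (N c) = - D b c F.

Lemma sum_dl_g G : \sum_c wedge (dl A c) (wedge (g c) G) = 0.
Proof.
apply: eq_opp_form => //; rewrite (eq_bigr (fun c => \sum_b g c b *: wedge (dl A c) (wedge (dl A b) G))).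
  rewrite {1}exchange_big -sumrN; apply: eq_bigr => c _; rewrite -sumrN.
  by apply: eq_bigr => b _; rewrite wedgeC scalerN g_sym.
move=> c _; rewrite (wedge_dl (g c)) (linear_sum (wedge (dl A c))).
by apply: eq_bigr => b _; rewrite linearZ.
Qed.

Let SX := \sum_c wedge (dl A c) (X c).
Let SN := \sum_c wedge (dl A c) (N c).

Lemma prolong_X0 b : l.+1%:R *: X b + ctr b SX + wedge (g b) SN =
  - \sum_c wedge (dl A c) (D b c F).
Proof.
rewrite -sumrN; under [RHS]eq_bigr => c _ do rewrite -wedgeNr -E !wedgeDr !wedgeNr.
rewrite !big_split !sumrN /= (euler (iX b)) (sum_wedge_ctr X) sum_dl_g addr0.
have -> : \sum_i wedge (dl A i) (wedge (g b) (N i)) = - wedge (g b) SN.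
  by rewrite raddf_sum -sumrN; apply: eq_bigr => c _; exact: wedgeC.
rewrite -[l.+2%:R]natr1 -/SX; move: SX (wedge (g b) SN) => x y; form_ring.
Qed.

(** Wedging prolong_X0 once more removes the other terms, by symmetry of g and
    by the Bianchi identity for C, and leaves a positive multiple of this sum.
    *)
Lemma sum_dl_X : SX = 0.
Proof.
have iS : isform l.+3 SX by apply: isform_sum => c; exact: isform_wedge.
have : \sum_b wedge (dl A b) (l.+1%:R *: X b + ctr b SX + wedge (g b) SN) = 0.
  rewrite (eq_bigr (fun b => - \sum_c wedge (dl A b) (wedge (dl A c) (D b c F)))).
    by rewrite sumrN wedge_wedge_D oppr0.
  by move=> b _; rewrite prolong_X0 raddfN raddf_sum.
under eq_bigr => b _ do rewrite !wedgeDr wedgeZ.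
rewrite !big_split /= sum_dl_g addr0 (euler iS) -scaler_sumr -/SX -scalerDl -natrD.
exact: tfree_form.
Qed.

Lemma prolong_X b : l.+1%:R *: X b =
  - wedge (g b) SN - \sum_c wedge (dl A c) (D b c F).
Proof.
by have := prolong_X0 b; rewrite sum_dl_X raddf0 addr0 addrC => /(canRL (addKr _)) ->.
Qed.

Let Y := \sum_b up b (X b).
Let dN := \sum_b up b (N b).

Lemma prolong_N0 c : (n%:R - l.+1%:R) *: N c =
  \sum_b up b (D b c F) - ctr c Y - wedge (g c) dN.
Proof.
have : \sum_b up b (ctr c (X b) - ctr b (X c) + wedge (g c) (N b) - wedge (g b) (N c)) =
    - \sum_b up b (D b c F).
  by rewrite -sumrN; apply: eq_bigr => b _; rewrite E raddfN.
under eq_bigr => b _ do rewrite !upD !upN.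
rewrite !big_split !sumrN /= up_ctr_tr ?subr0 //; last by case: (iX c).
rewrite up_g_wedge (up_g_sum (iN c)) -/dN.
rewrite (_ : \sum_b up b (ctr c (X b)) = - ctr c Y); last first.
  rewrite raddf_sum -sumrN; apply: eq_bigr => b _.
  by rewrite /= ctr_up ?opprK //; case: (iX b).
move=> H; rewrite -[\sum_b up b _]opprK -H -natr1.
by move: (ctr c Y) (wedge (g c) dN) => x y; form_ring.
Qed.

(** Contracting prolong_N0 once more removes the other terms and leaves a
    multiple of this contraction, nonzero because the degree l is less than n.
    *)
Lemma div_N : dN = 0.
Proof.
case: (l) (ln) iN (prolong_N0) => [|j] jn jN HN.
  rewrite /dN big1 // => b _; rewrite /up big1 // => a _.
  by rewrite (ctr_deg0 a (proj2 (jN b))) scaler0.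
have iS : isform j dN by apply: isform_sum => b; exact: (isform_up b (jN b)).
have : \sum_c up c ((n%:R - j.+2%:R) *: N c) =
   \sum_c up c (\sum_b up b (D b c F) - ctr c Y - wedge (g c) dN).
  by apply: eq_bigr => c _; rewrite HN.
have aF : altern F by case: iF.
under [RHS]eq_bigr => c _ do rewrite !upD !upN.
rewrite !big_split !sumrN /= up_up_D // up_ctr_tr //; last first.
  rewrite /Y; elim/big_rec: _ => [|b G _ aG]; first exact: altern0.
  rewrite -[up b _]scale1r; apply: alternP => //; apply: altern_up; by case: (iX b).
rewrite (up_g_sum iS) subr0 add0r; under eq_bigr do rewrite upZ.
rewrite -scaler_sumr -/dN => /eqP; rewrite -subr_eq0 opprK -scalerDl.
have -> : n%:R - j.+2%:R + (n%:R - j%:R) = ((n - j.+2) + (n - j.+1)).+1%:R :> A.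
  have jn' := ltnW jn; rewrite -addnS subnSK // natrD !natrB //; exact: ltnW.
by move=> /eqP; exact: tfree_form.
Qed.

Lemma prolong_N c : (n%:R - l.+1%:R) *: N c = \sum_b up b (D b c F) - ctr c Y.
Proof. by rewrite prolong_N0 div_N raddf0 subr0. Qed.

End Prolong.
End Weyl.
End Metric.

(** * The conformal Killing equation and the two brackets *)

Section Bilinear.
Variables (A : comPzRingType) (n : nat).
Local Notation form := (form A n).
Local Notation covec := (covec A n).
Implicit Types (F G w : form) (v : covec) (b c d p q : 'I_n) (s : seq 'I_n).
Variables (g gi : 'I_n -> covec).
Hypothesis gP : metric_pair g gi.
Local Notation up := (up gi).
Local Notation ctrv := (ctrv gi).

Definition cov F : covec := fun a => F [:: a].

Lemma covFD F G : cov (F + G) = cov F + cov G. Proof. by []. Qed.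

Lemma wedge2E v w p q : wedge v w [:: p; q] = v p * w [:: q] - v q * w [:: p].
Proof. by rewrite wedge_cons wedge_cons wedge_nil subr0. Qed.

(** Contraction of the first two indices of F with a 2-form w. *)
Definition ctr2 w F : form := \sum_p ctrv (cov (ctr p w)) (up p F).
(** Twice the exterior product of the 2-form w with F. *)
Definition wdg2 w F : form := \sum_y wedge (dl A y) (wedge (cov (ctr y w)) F).

Lemma ctr2E w F : ctr2 w F = \sum_p ctrv (cov (ctr p w)) (up p F). Proof. by []. Qed.

Lemma ctr2Dr w F G : ctr2 w (F + G) = ctr2 w F + ctr2 w G.
Proof. by rewrite -big_split; apply: eq_bigr => p _; rewrite upD ctrvDr. Qed.
Lemma wdg2Dr w F G : wdg2 w (F + G) = wdg2 w F + wdg2 w G.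
Proof. by rewrite -big_split; apply: eq_bigr => p _; rewrite !wedgeDr. Qed.

Lemma ctr2P a w w' F : ctr2 (a *: w + w') F = a *: ctr2 w F + ctr2 w' F.
Proof.
rewrite /ctr2 scaler_sumr -big_split /=; apply: eq_bigr => p _.
by rewrite -ctrvP.
Qed.
Lemma wdg2P a w w' F : wdg2 (a *: w + w') F = a *: wdg2 w F + wdg2 w' F.
Proof.
rewrite /wdg2 scaler_sumr -big_split /=; apply: eq_bigr => p _.
by rewrite -wedgeZ -wedgeDr -wedgevZ -wedgevD.
Qed.
Lemma ctr2D w w' F : ctr2 (w + w') F = ctr2 w F + ctr2 w' F.
Proof. by rewrite -{1}[w]scale1r ctr2P scale1r. Qed.
Lemma wdg2D w w' F : wdg2 (w + w') F = wdg2 w F + wdg2 w' F.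
Proof. by rewrite -{1}[w]scale1r wdg2P scale1r. Qed.
Lemma ctr20 F : ctr2 0 F = 0.
Proof. by apply: (addrI (ctr2 0 F)); rewrite addr0 -ctr2D addr0. Qed.
Lemma wdg20 F : wdg2 0 F = 0.
Proof. by apply: (addrI (wdg2 0 F)); rewrite addr0 -wdg2D addr0. Qed.
Lemma ctr2Z a w F : ctr2 (a *: w) F = a *: ctr2 w F.
Proof. by rewrite -{1}[a *: w]addr0 ctr2P ctr20 addr0. Qed.
Lemma wdg2Z a w F : wdg2 (a *: w) F = a *: wdg2 w F.
Proof. by rewrite -{1}[a *: w]addr0 wdg2P wdg20 addr0. Qed.
Lemma ctr2_sum (w : 'I_n -> form) F : ctr2 (\sum_c w c) F = \sum_c ctr2 (w c) F.
Proof.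
elim: (index_enum _) => [|c r IH]; first by rewrite !big_nil ctr20.
by rewrite !big_cons ctr2D IH.
Qed.
Lemma wdg2_sum (w : 'I_n -> form) F : wdg2 (\sum_c w c) F = \sum_c wdg2 (w c) F.
Proof.
elim: (index_enum _) => [|c r IH]; first by rewrite !big_nil wdg20.
by rewrite !big_cons wdg2D IH.
Qed.

Lemma cov_ctr_wedge p v w : cov (ctr p (wedge v w)) = v p *: cov w - w [:: p] *: v.
Proof.
apply/funext => q; rewrite /cov /ctr !wedge_cons wedge_nil.
by rewrite subr0 covD covN !covZ [w _ * _]mulrC.
Qed.

Lemma ctr2_wedge v w F : altern F ->
  ctr2 (wedge v w) F = 2%:R *: ctrv (cov w) (ctrv v F).
Proof.
move=> aF; transitivity (ctrv (cov w) (ctrv v F) - ctrv v (ctrv (cov w) F)).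
  rewrite (ctrvE gi v F) (ctrvE gi (cov w) F) (linear_sum (ctrv (cov w))) (linear_sum (ctrv v)) -sumrB /=.
  apply: eq_bigr => p _.
  by rewrite cov_ctr_wedge -scaleNr ctrvD !ctrvZ !ctrvZr scaleNr.
by rewrite (ctrvC gi v) // opprK scaler_nat.
Qed.

Lemma wdg2_wedge v w F :
  wdg2 (wedge v w) F = 2%:R *: wedge v (wedge (cov w) F).
Proof.
transitivity (wedge v (wedge (cov w) F) - wedge (cov w) (wedge v F)).
  rewrite (wedge_dl v (wedge (cov w) F)) (wedge_dl (cov w) (wedge v F)) -sumrB; apply: eq_bigr => p _.
  by rewrite cov_ctr_wedge wedgevD wedgevN !wedgevZ wedgeBr !wedgeZ.
by rewrite (wedgeC (cov w)) // opprK scaler_nat.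
Qed.

Lemma ctrv_dl c F : ctrv (dl A c) F = up c F.
Proof. exact: sum_dlr. Qed.

Lemma ctr2_ctr w c F : altern F -> ctr2 w (ctr c F) = ctr c (ctr2 w F).
Proof.
move=> aF; rewrite /ctr2 (linear_sum (ctr c)); apply: eq_bigr => p _ /=.
rewrite ctr_ctrv; last exact: altern_up.
by rewrite ctr_up // ctrvNr opprK.
Qed.

Lemma skew2 w p q : altern w -> w [:: p; q] = - w [:: q; p].
Proof. by move=> aw; apply: (aw [::]). Qed.

Lemma ctrv_wedge_g v c F : ctrv v (wedge (g c) F) = v c *: F - wedge (g c) (ctrv v F).
Proof.
rewrite ctrv_wedge; congr (_ *: _ - _).
under eq_bigr do rewrite (rais_g gP) mulrC.
exact: (sum_dl (v : 'I_n -> A^o)).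
Qed.

(** Either of the two indices of w may contract with g, with equal results,
    whence the factor 2. *)
Lemma ctr2_wedge_g w c F : altern w ->
  ctr2 w (wedge (g c) F) = wedge (g c) (ctr2 w F) + 2%:R *: ctrv (cov (ctr c w)) F.
Proof.
move=> aw; rewrite /ctr2.
under eq_bigr => p _ do rewrite up_wedge (rais_g gP) ctrvDr ctrvNr ctrvZr ctrv_wedge_g opprB.
rewrite big_split /= (sum_dl (fun p => ctrv (cov (ctr p w)) F)) sumrB.
rewrite (_ : \sum_i _ *: _ = - ctrv (cov (ctr c w)) F); last first.
  rewrite -sumrN; apply: eq_bigr => p _.
  by rewrite /cov /ctr (skew2 _ _ aw) scaleNr.
by rewrite opprK (linear_sum (wedge (g c))) /= addrCA scaler_nat.
Qed.

Lemma wdg2_ctr w c F : altern w ->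
  wdg2 w (ctr c F) = ctr c (wdg2 w F) - 2%:R *: wedge (cov (ctr c w)) F.
Proof.
move=> aw; rewrite /wdg2 (linear_sum (ctr c)) /=.
under [in RHS]eq_bigr => y _ do
  rewrite ctr_wedge ctr_wedge wedgeBr opprB wedgeZ /dl.
rewrite big_split /= -/(dl A c).
rewrite (sum_dl (fun y => wedge (cov (ctr y w)) F)) sumrB.
have -> : \sum_y cov (ctr y w) c *: wedge (fun b => (b == y)%:R) F =
   - wedge (cov (ctr c w)) F.
  rewrite (wedge_dl (cov _)) -sumrN; apply: eq_bigr => y _.
  by rewrite /cov /ctr (skew2 _ _ aw) scaleNr.
form_ring.
Qed.

Lemma wdg2_g w c F : wdg2 w (wedge (g c) F) = wedge (g c) (wdg2 w F).
Proof.
rewrite /wdg2 (linear_sum (wedge (g c))); apply: eq_bigr => y _ /=.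
by rewrite (wedgeC (cov _)) wedgeNr wedgeC opprK.
Qed.

Lemma isform_ctr2 k w F : isform k F -> isform k.-2 (ctr2 w F).
Proof.
by move=> iF; apply: isform_sum => p; apply: isform_ctrv; exact: isform_up.
Qed.

Lemma isform_wdg2 k w F : isform k F -> isform k.+2 (wdg2 w F).
Proof.
by move=> iF; apply: isform_sum => p; apply: isform_wedge; exact: isform_wedge.
Qed.

End Bilinear.

Section Connection.
Variables (A : comPzRingType) (n : nat).
Local Notation form := (form A n).
Local Notation covec := (covec A n).
Implicit Types (F G w : form) (v : covec) (a b c e p q : 'I_n) (s : seq 'I_n) (x y : A).
Variable (d : 'I_n -> A -> A).

Definition derivations := [/\ forall c x y, d c (x + y) = d c x + d c y,
  forall c x y, d c (x * y) = d c x * y + x * d c y &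
  forall a b x, d a (d b x) = d b (d a x)].
Hypothesis dP : derivations.

Lemma dD c x y : d c (x + y) = d c x + d c y. Proof. by case: dP. Qed.
Lemma dM c x y : d c (x * y) = d c x * y + x * d c y. Proof. by case: dP. Qed.
Lemma dC a b x : d a (d b x) = d b (d a x). Proof. by case: dP. Qed.
Lemma d0 c : d c 0 = 0.
Proof. by apply: (addrI (d c 0)); rewrite addr0 -dD addr0. Qed.
Lemma dN c x : d c (- x) = - d c x.
Proof. by apply: (addrI (d c x)); rewrite -dD !subrr d0. Qed.
Lemma dB c x y : d c (x - y) = d c x - d c y. Proof. by rewrite dD dN. Qed.
Lemma d1 c : d c 1 = 0.
Proof. by apply: (addrI (d c 1)); rewrite addr0 -{3}[1]mulr1 dM mulr1 mul1r. Qed.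
Lemma dnat c m : d c m%:R = 0.
Proof. by elim: m => [|m IH]; rewrite ?d0 // -natr1 dD IH d1 addr0. Qed.
Lemma d_sum c (J : Type) (r : seq J) (P : pred J) (f : J -> A) :
  d c (\sum_(j <- r | P j) f j) = \sum_(j <- r | P j) d c (f j).
Proof. by elim/big_rec2: _ => [|j x y _ <-]; rewrite ?d0 ?dD. Qed.

Definition dform c F : form := fun s => d c (F s).
Definition dcov c v : covec := fun b => d c (v b).

Lemma d_wedge c v F : dform c (wedge v F) = wedge (dcov c v) F + wedge v (dform c F).
Proof.
apply/funext => s; rewrite formE /dform; elim: s F => [|b s IH] F.
  by rewrite !wedge_nil d0 addr0.
by rewrite !wedge_cons dB dM IH /dcov; ring.
Qed.

Lemma d_der c (M : 'I_n -> covec) F :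
  dform c (der M F) = der (fun e => dcov c (M e)) F + der M (dform c F).
Proof.
apply/funext => s; rewrite formE /dform; elim: s F => [|b s IH] F.
  by rewrite !der_nil d0 addr0.
rewrite !der_cons dD IH d_sum addrACA; congr (_ + _).
by rewrite -big_split; apply: eq_bigr => e _; rewrite dM.
Qed.

(** Gam c e b is the Christoffel symbol with upper index e and lower indices
    c, b. *)
Variable Gam : 'I_n -> 'I_n -> covec.

Definition nab c F : form := dform c F - der (Gam c) F.
Definition nabv c v : covec := fun b => d c (v b) - \sum_e Gam c e b * v e.

Lemma cov_nab c F : cov (nab c F) = nabv c (cov F).
Proof. by apply/funext => b; rewrite /cov /nab !formE der_cons der_nil addr0. Qed.

Lemma nabD c F G : nab c (F + G) = nab c F + nab c G.
Proof. by rewrite /nab derDr; apply/funext => s; rewrite !formE /dform formD dD; ring. Qed.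
Lemma nabZ c x F : nab c (x *: F) = d c x *: F + x *: nab c F.
Proof.
by rewrite /nab derZr; apply/funext => s; rewrite !formE /dform formZ dM; ring.
Qed.
Lemma nabN c F : nab c (- F) = - nab c F.
Proof. by rewrite -scaleN1r nabZ dN d1 oppr0 scale0r add0r scaleN1r. Qed.
Lemma nab0 c : nab c 0 = 0.
Proof. by rewrite -[in LHS](scale0r 0) nabZ !(scale0r, scaler0) addr0. Qed.
Lemma nab_nat c m F : nab c (m%:R *: F) = m%:R *: nab c F.
Proof. by rewrite nabZ dnat scale0r add0r. Qed.
Lemma nab_sum c (J : finType) (f : J -> form) :
  nab c (\sum_j f j) = \sum_j nab c (f j).
Proof. by elim/big_rec2: _ => [|j x y _ <-]; rewrite ?nab0 ?nabD. Qed.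

Lemma nab_ctr c p F : nab c (ctr p F) = ctr p (nab c F) + \sum_e Gam c e p *: ctr e F.
Proof.
rewrite /nab raddfB /= ctr_der.
have -> : ctr p (dform c F) = dform c (ctr p F) by [].
by move: (\sum_d _) => S; form_ring.
Qed.

Lemma nab_wedge c v F : nab c (wedge v F) = wedge (nabv c v) F + wedge v (nab c F).
Proof.
rewrite /nab d_wedge der_wedge wedgeBr.
have -> : nabv c v = dcov c v - (fun b => \sum_e Gam c e b * v e) by [].
by rewrite wedgevD wedgevN; form_ring.
Qed.

Lemma altern_nab c F : altern F -> altern (nab c F).
Proof.
move=> aF; rewrite /nab addrC -scaleN1r; apply: alternP.
  rewrite der_wedgeE //; elim/big_rec: _ => [|e G _ aG]; first exact: altern0.
  rewrite -[wedge _ _]scale1r; apply: alternP => //.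
  by apply: altern_wedge; exact: altern_ctr.
by move=> s1 b e s2; rewrite /dform aF dN.
Qed.

Lemma isform_nab k c F : isform k F -> isform k (nab c F).
Proof.
move=> iF; have [aF dF] := iF; split; first exact: altern_nab.
rewrite /nab der_wedgeE //; case: k iF dF => [|k] iF dF s sk.
  rewrite !formE /dform dF // d0 big1 ?subr0 // => e _.
  by rewrite (ctr_deg0 e dF) linear0.
rewrite !formE /dform dF // d0 big1 ?subr0 // => e _.
by have [_ ->] := isform_wedge (Gam c e) (isform_ctr e iF).
Qed.

Definition Riem a b c : covec := fun e => d a (Gam b c e) - d b (Gam a c e)
  + \sum_f (Gam a c f * Gam b f e - Gam b c f * Gam a f e).

(** The Ricci identity. Since b is held fixed in nab b F, torsion does not
    enter. *)
Lemma nab_comm a b F : nab a (nab b F) - nab b (nab a F) = - der (Riem a b) F.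
Proof.
have E p q : nab p (nab q F) = dform p (dform q F) - der (Gam p) (dform q F)
    - der (Gam q) (dform p F) - der (fun e => dcov p (Gam q e)) F + der (Gam p) (der (Gam q) F).
  rewrite /nab derDr derNr.
  have -> : dform p (dform q F - der (Gam q) F) = dform p (dform q F) - dform p (der (Gam q) F).
    by apply/funext => s; rewrite !formE /dform dB.
  by rewrite d_der; form_ring.
rewrite !E.
have -> : dform a (dform b F) = dform b (dform a F) by apply/funext => s; exact: dC.
have -> : der (Riem a b) F = der (fun e => dcov a (Gam b e)) F
    - der (fun e => dcov b (Gam a e)) F - (der (Gam a) (der (Gam b) F) - der (Gam b) (der (Gam a) F)).
  rewrite der_comm -[- der _ F]scaleN1r -[- der _ F]scaleN1r -!derZ -!derD; congr (der _ F).
  apply/funext => c; apply/funext => e; rewrite /Riem /dcov !mulN1r; congr (_ + _).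
  by rewrite -sumrN; apply: eq_bigr => f _; ring.
by form_ring.
Qed.

Variables (g gi : 'I_n -> covec).
Hypothesis gP : metric_pair g gi.
Hypothesis GamC : forall a b c, Gam a c b = Gam b c a.
Hypothesis g_compat : forall c a b,
  d c (g a b) = \sum_e (Gam c e a * g e b + Gam c e b * g a e).
Local Notation up := (up gi).
Local Notation ctrv := (ctrv gi).
Local Notation ctr2 := (ctr2 gi).

Lemma nabv_g c b : nabv c (g b) = \sum_e Gam c e b *: g e.
Proof.
apply/funext => a; rewrite /nabv g_compat big_split cov_sum /= addrK.
by apply: eq_bigr => e _; rewrite covZ.
Qed.

(** Differentiate the product of g and its inverse. *)
Lemma d_gi c p q : d c (gi p q) = - \sum_e (Gam c p e * gi e q + Gam c q e * gi p e).
Proof.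
apply/eqP; rewrite -subr_eq0 opprK; apply/eqP.
pose X q := d c (gi p q) + \sum_e (Gam c p e * gi e q + Gam c q e * gi p e).
rewrite -/(X q).
have Xg b : \sum_r X r * g r b = 0.
  have : d c (\sum_r gi p r * g r b) = 0 by rewrite (gi_g gP) /dl dnat.
  rewrite d_sum; under eq_bigr => r _ do rewrite dM g_compat.
  rewrite big_split /= => H; rewrite -[RHS]H /X.
  under eq_bigr do rewrite mulrDl; rewrite big_split /=; congr (_ + _).
  under eq_bigr => r _ do rewrite big_split mulrDl /=.
  under [RHS]eq_bigr => r _ do rewrite big_split mulrDr /=.
  rewrite !big_split /= addrC; congr (_ + _).
    under eq_bigr do rewrite mulr_suml; under [RHS]eq_bigr do rewrite mulr_sumr.
    rewrite exchange_big; apply: eq_bigr => r _; apply: eq_bigr => e _; ring.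
  under eq_bigr do rewrite mulr_suml; under [RHS]eq_bigr do rewrite mulr_sumr.
  rewrite exchange_big /= [RHS]exchange_big /=.
  transitivity (\sum_e Gam c p e * dl A e b).
    by apply: eq_bigr => e _; rewrite -(gi_g gP) mulr_sumr; apply: eq_bigr => r _; rewrite mulrA.
  transitivity (\sum_e Gam c e b * dl A p e).
    rewrite [RHS](eq_bigr (fun e => dl A p e * Gam c e b)) => [|e _]; last by rewrite mulrC.
    rewrite (sum_dlr (fun e => Gam c e b : A^o)).
    under eq_bigr do rewrite mulrC.
    exact: (sum_dl (fun e => Gam c p e : A^o) b).
  by apply: eq_bigr => e _; rewrite -(gi_g gP) mulr_sumr; apply: eq_bigr => r _; ring.
transitivity (\sum_b (\sum_r X r * g r b) * gi b q); last first.
  by rewrite big1 // => b _; rewrite Xg mul0r.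
under eq_bigr do rewrite mulr_suml; rewrite exchange_big /=.
rewrite -[LHS](sum_dlr (X : 'I_n -> A^o)); apply: eq_bigr => r _.
by rewrite -[LHS]/(dl A q r * X r) -(g_gi gP) mulr_suml; apply: eq_bigr => b _; ring.
Qed.

(** Raising an index is parallel because the metric is; the sum accounts for
    the fixed index p. *)
Lemma nab_up c p F : nab c (up p F) = up p (nab c F) - \sum_e Gam c p e *: up e F.
Proof.
rewrite !upE nab_sum.
under eq_bigr => a _ do rewrite nabZ nab_ctr scalerDr d_gi.
rewrite !big_split /= addrCA; congr (_ + _).
under eq_bigr => a _ do rewrite big_split scaleNr scalerDl /= opprD.
rewrite !big_split /= !sumrN.
rewrite -addrA (_ : _ + \sum_i gi p i *: _ = 0) ?addr0.
  congr (- _); under [RHS]eq_bigr do rewrite scaler_sumr.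
  rewrite [RHS]exchange_big; apply: eq_bigr => a _; rewrite scaler_suml.
  by apply: eq_bigr => e _; rewrite scalerA.
rewrite addrC; apply/eqP; rewrite subr_eq0; apply/eqP.
under eq_bigr do rewrite scaler_sumr.
rewrite exchange_big; apply: eq_bigr => a _; rewrite scaler_suml.
by apply: eq_bigr => e _; rewrite scalerA mulrC.
Qed.

Lemma nab_ctrv c v F : nab c (ctrv v F) = ctrv (nabv c v) F + ctrv v (nab c F).
Proof.
rewrite !ctrvE nab_sum.
under eq_bigr => p _ do rewrite nabZ nab_up scalerDr.
rewrite !big_split /= addrCA addrC; congr (_ + _).
under [RHS]eq_bigr do rewrite /nabv scalerBl.
rewrite sumrB; congr (_ + _); rewrite -sumrN.
under eq_bigr do rewrite scalerN scaler_sumr -sumrN.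
rewrite exchange_big; apply: eq_bigr => p _; rewrite scaler_suml -sumrN.
by apply: eq_bigr => e _; rewrite scalerA mulrC.
Qed.

Lemma cov_sumF (J : finType) (f : J -> form) : cov (\sum_j f j) = \sum_j cov (f j).
Proof. by apply/funext => a; rewrite /cov cov_sum form_sum. Qed.

Lemma nabv_ctr c p w : nabv c (cov (ctr p w)) =
  cov (ctr p (nab c w)) + \sum_e Gam c e p *: cov (ctr e w).
Proof. by rewrite -cov_nab nab_ctr covFD cov_sumF. Qed.

Lemma nab_ctr2 c w F : nab c (ctr2 w F) = ctr2 (nab c w) F + ctr2 w (nab c F).
Proof.
rewrite !ctr2E nab_sum.
under eq_bigr => p _ do rewrite nab_ctrv nabv_ctr nab_up ctrvD ctrvDr.
rewrite !big_split /= addrACA [X in _ + X = _](_ : _ = 0) ?addr0 //.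
rewrite (_ : \sum_i _ = \sum_p \sum_e Gam c e p *: ctrv (cov (ctr e w)) (up p F)); last first.
  by apply: eq_bigr => p _; rewrite ctrv_suml; apply: eq_bigr => e _; rewrite ctrvZ.
rewrite exchange_big -big_split big1 //= => p _.
rewrite ctrvNr (linear_sum (ctrv _)) /=; apply/eqP; rewrite subr_eq0; apply/eqP.
by apply: eq_bigr => e _; rewrite ctrvZr.
Qed.

Lemma nab_wdg2 c w F : nab c (wdg2 w F) = wdg2 (nab c w) F + wdg2 w (nab c F).
Proof.
rewrite /wdg2 nab_sum.
under eq_bigr => p _ do rewrite !nab_wedge nabv_ctr wedgevD 2!wedgeDr.
rewrite !big_split /= -addrA addrCA; congr (_ + _).
rewrite addrA [X in X + _ = _](_ : _ = 0) ?add0r //.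
rewrite addrC (_ : \sum_i _ = \sum_p \sum_e Gam c e p *: wedge (dl A p) (wedge (cov (ctr e w)) F)); last first.
  apply: eq_bigr => p _; rewrite wedgev_sum (linear_sum (wedge _)) /=.
  by apply: eq_bigr => e _; rewrite wedgevZ wedgeZ.
rewrite exchange_big -big_split big1 //= => p _.
rewrite (wedge_dl (nabv c _)) -big_split big1 //= => e _.
rewrite -scalerDl /nabv /dl dnat sub0r.
rewrite (bigD1 p) //= eqxx mulr1 big1 ?addr0 ?subrr ?scale0r // => f fp.
by rewrite (negbTE fp) mulr0.
Qed.

Lemma Riem12 a b c e : Riem a b c e = - Riem b a c e.
Proof.
rewrite /Riem opprD opprB; congr (_ + _).
by rewrite -sumrN; apply: eq_bigr => f _; ring.
Qed.

Lemma nabv_comm a b v f : nabv a (nabv b v) f - nabv b (nabv a v) f =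
  - \sum_e Riem a b e f * v e.
Proof.
pose F : form := fun s => if s is e :: _ then v e else 0.
have -> : v = cov F by [].
rewrite -!cov_nab; have := congr1 (fun H : form => H [:: f]) (nab_comm a b F).
by rewrite !formE der_cons der_nil addr0.
Qed.

Lemma nabv_sum a (J : finType) (x : J -> A) (v : J -> covec) f :
  nabv a (\sum_h x h *: v h) f = \sum_h (d a (x h) * v h f + x h * nabv a (v h) f).
Proof.
rewrite /nabv cov_sum d_sum; under [X in _ - X]eq_bigr do rewrite cov_sum mulr_sumr.
rewrite exchange_big -sumrB; apply: eq_bigr => h _; rewrite covZ dM mulrBr addrA; congr (_ - _).
by rewrite mulr_sumr; apply: eq_bigr => e _; rewrite covZ; ring.
Qed.

Lemma nabv_nabv_g a b c f : nabv a (nabv b (g c)) f =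
  \sum_e d a (Gam b e c) * g e f + \sum_e \sum_h Gam b h c * Gam a e h * g e f.
Proof.
rewrite nabv_g nabv_sum big_split /=; congr (_ + _).
rewrite exchange_big; apply: eq_bigr => e _.
rewrite nabv_g cov_sum mulr_sumr; apply: eq_bigr => h _.
by rewrite covZ mulrA.
Qed.

Definition Rlow a b c : covec := fun e => \sum_f g c f * Riem a b f e.

Lemma Rlow12 a b c e : Rlow a b c e = - Rlow b a c e.
Proof. by rewrite /Rlow -sumrN; apply: eq_bigr => f _; rewrite Riem12 mulrN. Qed.

(** The Ricci identity for g itself, which is parallel. *)
Lemma Rlow34 a b c f : Rlow a b c f = - Rlow a b f c.
Proof.
have := nabv_comm a b (g c) f; rewrite !nabv_nabv_g => H.
have -> : Rlow a b c f = \sum_e Riem a b e f * g c e.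
  by apply: eq_bigr => e _; rewrite mulrC.
rewrite -[LHS]opprK -H; congr (- _).
rewrite opprD addrACA -sumrB -sumrB -big_split; apply: eq_bigr => e _ /=.
rewrite /Riem (g_sym gP f e) -sumrB mulrDr; congr (_ + _); first by ring.
by rewrite mulr_sumr; apply: eq_bigr => h _; ring.
Qed.

(** The first Bianchi identity, from the symmetry of Gam. *)
Lemma Riem124 a b c e : Riem a b c e + Riem b e c a + Riem e a c b = 0.
Proof.
rewrite /Riem (GamC e a c) (GamC e b c) (GamC b a c).
transitivity (\sum_f (Gam a c f * Gam b f e - Gam b c f * Gam a f e
   + (Gam b c f * Gam e f a - Gam e c f * Gam b f a)
   + (Gam e c f * Gam a f b - Gam a c f * Gam e f b))).
  by rewrite !big_split /=; ring.
by rewrite big1 // => f _; rewrite (GamC e a f) (GamC e b f) (GamC b a f); ring.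
Qed.

Lemma Rlow123 a b e c : Rlow a b e c + Rlow b e a c + Rlow e a b c = 0.
Proof.
rewrite (Rlow34 a b) (Rlow34 b e) (Rlow34 e a) -!opprD -!big_split.
by rewrite big1 ?oppr0 // => f _; rewrite /= -!mulrDr Riem124 mulr0.
Qed.

Variable tf : tfree A.

Lemma Rlow_pair a b c e : Rlow a b c e = Rlow c e a b.
Proof. exact: (curv_pair _ _ _ _ tf Rlow12 Rlow34 Rlow123). Qed.

Definition Ric b e := \sum_a Riem a b a e.
Definition Scal := \sum_b \sum_e gi b e * Ric b e.

Lemma Rlow_tr b e : \sum_a \sum_c gi a c * Rlow a b c e = Ric b e.
Proof.
apply: eq_bigr => a _; rewrite -[RHS](sum_dlr (fun f => Riem a b f e : A^o)).
under eq_bigr do rewrite mulr_sumr.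
rewrite exchange_big; apply: eq_bigr => f _ /=.
rewrite -[RHS]/(dl A a f * _) -(gi_g gP) mulr_suml.
by apply: eq_bigr => c _; rewrite mulrA.
Qed.

Lemma Ric_sym b e : Ric b e = Ric e b.
Proof.
rewrite -!Rlow_tr [RHS]exchange_big; apply: eq_bigr => a _; apply: eq_bigr => c _.
by rewrite Rlow_pair (gi_sym gP).
Qed.

Variables (i1 i2 : A).
Hypothesis i1P : 2%:R * (n%:R - 1) * i1 = 1.
Hypothesis i2P : (n%:R - 2%:R) * i2 = 1.

Definition Psch b : covec := fun e => i2 * (Ric b e - Scal * i1 * g b e).

Lemma Psch_sym b e : Psch b e = Psch e b.
Proof. by rewrite /Psch Ric_sym (g_sym gP). Qed.

Definition Weyl a b c : covec := fun e =>
  Rlow a b c e - (g c a * Psch b e - g c b * Psch a e)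
  - (g e b * Psch a c - g e a * Psch b c).

(** The Schouten terms have the symmetries of a curvature, and the constants
    i1 and i2 are those for which the trace cancels. *)
Lemma weyl_likeP : weyl_like gi Weyl.
Proof.
split=> [b c e a|b c e a|b c e a|b e].
- by rewrite /Weyl Rlow12; ring.
- by rewrite /Weyl Rlow34; ring.
- rewrite -[RHS](Rlow123 b c e a) /Weyl (Psch_sym e b) (Psch_sym e c) (Psch_sym c b).
  by rewrite (g_sym gP e b) (g_sym gP e c) (g_sym gP c b); ring.
have tg : \sum_a \sum_c gi a c * g c a = n%:R.
  rewrite (eq_bigr (fun=> 1)) ?sumr_const ?card_ord // => a _.
  by rewrite (gi_g gP) /dl eqxx.
have tg1 (x : covec) h : \sum_a \sum_c gi a c * g c h * x a = x h.
  rewrite -[RHS](sum_dl (x : 'I_n -> A^o)); apply: eq_bigr => a _.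
  by rewrite -mulr_suml (gi_g gP) /dl eq_sym.
have tP : \sum_a \sum_c gi a c * Psch a c = Scal * i1.
  transitivity (i2 * (Scal - Scal * i1 * n%:R)); last first.
    transitivity (i2 * (Scal * (2%:R * (n%:R - 1) * i1) - Scal * i1 * n%:R)); first by rewrite i1P mulr1.
    transitivity ((n%:R - 2%:R) * i2 * (Scal * i1)); first by ring.
    by rewrite i2P mul1r.
  rewrite -tg /Psch; move: (Scal * i1) => z.
  rewrite /Scal mulr_sumr -sumrB mulr_sumr; apply: eq_bigr => a _.
  rewrite mulr_sumr -sumrB mulr_sumr; apply: eq_bigr => c _; rewrite (g_sym gP a c); ring.
rewrite (eq_bigr (fun a => \sum_c (gi a c * Rlow a b c e - gi a c * g c a * Psch b e
   + gi a c * g c b * Psch a e - gi a c * Psch a c * g e b + gi c a * g a e * Psch b c))).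
  under eq_bigr => a _ do rewrite !(big_split, sumrN) /=.
  rewrite !(big_split, sumrN) /= Rlow_tr tg1.
  have -> : \sum_i \sum_i0 gi i i0 * g i0 i * Psch b e = n%:R * Psch b e.
    by rewrite -tg mulr_suml; apply: eq_bigr => a _; rewrite mulr_suml.
  have -> : \sum_i \sum_i0 gi i i0 * Psch i i0 * g e b = Scal * i1 * g e b.
    by rewrite -tP mulr_suml; apply: eq_bigr => a _; rewrite mulr_suml.
  rewrite [X in _ + X](_ : _ = Psch b e); last by rewrite exchange_big tg1.
  rewrite (g_sym gP e b).
  transitivity (Ric b e - Scal * i1 * g b e - (n%:R - 2%:R) * Psch b e); first by ring.
  by rewrite /Psch [_ * (i2 * _)]mulrA i2P; ring.
move=> a _; apply: eq_bigr => c _.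
by rewrite /Weyl (gi_sym gP c a) (g_sym gP a e); ring.
Qed.

(** The conformal Killing equation: the derivative of F consists of an
    exterior part mu and a trace part rho. *)
Definition ckf l F mu rho := [/\ isform l.+1 F, isform l.+2 mu, isform l rho &
  forall c, nab c F = ctr c mu + wedge (g c) rho].

Local Notation D := (D gi Weyl).

(** The decomposition of the curvature into its Weyl and Schouten parts. *)
Lemma der_Riem b c F : altern F -> der (Riem b c) F = D b c F
  + wedge (Psch c) (ctr b F) - wedge (Psch b) (ctr c F)
  + wedge (g c) (ctrv (Psch b) F) - wedge (g b) (ctrv (Psch c) F).
Proof.
move=> aF; rewrite der_wedgeE //.
transitivity (\sum_e wedge (Rlow b c e) (up e F)).
  under eq_bigr => f _ do rewrite -(g_up gP f F) (linear_sum (wedge _)) /=.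
  rewrite exchange_big; apply: eq_bigr => e _ /=.
  have -> : Rlow b c e = \sum_f g f e *: Riem b c f.
    by apply/funext => h; rewrite cov_sum; apply: eq_bigr => f _; rewrite covZ (g_sym gP e).
  by rewrite wedgev_sum; apply: eq_bigr => f _; rewrite wedgevZ wedgeZ.
have E e : Rlow b c e = Weyl b c e + g b e *: Psch c - g c e *: Psch b
    + Psch b e *: g c - Psch c e *: g b.
  apply/funext => h; rewrite /Weyl !(covD, covN, covZ).
  by rewrite (g_sym gP h c) (g_sym gP h b) (g_sym gP e b) (g_sym gP e c); ring.
have lin (w0 v1 v2 v3 v4 : covec) (x1 x2 x3 x4 : A) G :
    wedge (w0 + x1 *: v1 - x2 *: v2 + x3 *: v3 - x4 *: v4) G =
    wedge w0 G + wedge v1 (x1 *: G) - wedge v2 (x2 *: G) + wedge v3 (x3 *: G)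
    - wedge v4 (x4 *: G).
  by rewrite !(wedgevD, wedgevN) !wedgevZ !wedgeZ.
under eq_bigr => e _ do rewrite E lin.
rewrite !(big_split, sumrN) /= -(g_up gP b) -(g_up gP c).
by rewrite !(linear_sum (wedge _)).
Qed.

Section Ckf.
Variables (l : nat) (F mu rho : form).
Hypothesis cF : ckf l F mu rho.

(** The Schouten terms in prX and prN absorb the Schouten part of the
    curvature in ckf_prolong. *)
Definition prX b := nab b mu + wedge (Psch b) F.
Definition prN b := nab b rho + ctrv (Psch b) F.

Lemma isform_prX b : isform l.+2 (prX b).
Proof.
case: cF => iF im ir _; apply: isformD; first exact: isform_nab.
exact: isform_wedge.
Qed.
Lemma isform_prN b : isform l (prN b).
Proof.
case: cF => iF im ir _; apply: isformD; first exact: isform_nab.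
exact: (isform_ctrv gi _ iF).
Qed.

(** The commutator of second derivatives of F, computed once from the equation
    and once from the Ricci identity. *)
Lemma ckf_prolong b c : ctr c (prX b) - ctr b (prX c) + wedge (g c) (prN b)
  - wedge (g b) (prN c) = - D b c F.
Proof.
case: cF => [[aF _] [am _] [ar _] HF].
have E p q : nab p (nab q F) = ctr q (nab p mu) + wedge (g q) (nab p rho)
    + \sum_e Gam p e q *: (ctr e mu + wedge (g e) rho).
  rewrite HF nabD nab_ctr nab_wedge nabv_g wedgev_sum.
  under [in RHS]eq_bigr do rewrite scalerDr; rewrite big_split /=.
  under [X in _ + (X + _)]eq_bigr do rewrite wedgevZ.
  by move: (\sum_e _) (\sum_e _) => x y; form_ring.
have := nab_comm b c F; rewrite !E der_Riem // => H.
have GE : \sum_e Gam b e c *: (ctr e mu + wedge (g e) rho) =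
          \sum_e Gam c e b *: (ctr e mu + wedge (g e) rho).
  by apply: eq_bigr => e _; rewrite GamC.
rewrite GE in H; move: H; move: (\sum_e _) => S H.
rewrite -[D b c F](addrK (wedge (Psch c) (ctr b F))).
rewrite /prX /prN (wedgeDr _ (nab b rho)) (wedgeDr _ (nab c rho)).
rewrite (ctrD _ (nab b mu)) (ctrD _ (nab c mu)) (ctr_wedge c) (ctr_wedge b) (Psch_sym c b).
move/(congr1 (fun G => G - (wedge (Psch b) (ctr c F) - wedge (Psch c) (ctr b F)
  - wedge (g c) (ctrv (Psch b) F) + wedge (g b) (ctrv (Psch c) F)))): H => H.
rewrite [RHS](_ : _ = (- (D b c F + wedge (Psch c) (ctr b F) - wedge (Psch b) (ctr c F) +
       wedge (g c) (ctrv (Psch b) F) - wedge (g b) (ctrv (Psch c) F)))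
   - (wedge (Psch b) (ctr c F) - wedge (Psch c) (ctr b F)
  - wedge (g c) (ctrv (Psch b) F) + wedge (g b) (ctrv (Psch c) F))); last by form_ring.
by rewrite -H; form_ring.
Qed.

End Ckf.

Section Bracket.
Variables (l : nat) (sigma mu' nu F mu rho : form).
Hypotheses (ln : (l < n)%N) (cs : ckf 0 sigma mu' nu) (cF : ckf l F mu rho).

Let aF : altern F. Proof. by case: cF => -[]. Qed.
Let am : altern mu. Proof. by case: cF => _ []. Qed.
Let ar : altern rho. Proof. by case: cF => _ _ []. Qed.
Let am' : altern mu'. Proof. by case: cs => _ []. Qed.

Lemma cov_wedge v G : cov (wedge v G) = G [::] *: v.
Proof. by apply/funext => a; rewrite /cov wedge_cons wedge_nil subr0 covZ mulrC. Qed.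

Lemma nabv_sigma c : nabv c (cov sigma) = cov (ctr c mu') + nu [::] *: g c.
Proof. by case: cs => _ _ _ H; rewrite -cov_nab H covFD cov_wedge. Qed.

Lemma prX_sigma c : prX sigma mu' c =
  - wedge (g c) (\sum_d wedge (dl A d) (prN sigma nu d)) - \sum_d wedge (dl A d) (D c d sigma).
Proof.
rewrite -(prolong_X gP tf weyl_likeP (isform_prX cs) (ckf_prolong cs)).
by rewrite scale1r.
Qed.

Let xi := cov (\sum_d wedge (dl A d) (prN sigma nu d)).

(** By overA_killing, this is the first bracket of conformal Killing forms up
    to a constant factor. *)
Definition over0 := ctr2 mu' F - 2%:R *: ctrv (cov sigma) rho.
Definition W_over c : form :=
  - (2%:R * (n%:R - l.+1%:R)) *: (\sum_d ctrv (cov (D c d sigma)) (up d F))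
  - 2%:R *: ctrv (cov sigma) (\sum_b up b (D b c F)).

(** In the Leibniz rule, the derivative of mu' is given by prX of sigma and
    that of rho by prN of F; prolong_X and prolong_N express these by the Weyl
    tensor. The Schouten terms of the two factors cancel, and what is left is
    an exterior part and a trace part. *)
Lemma nab_over0 : exists om th, [/\ altern om, altern th & forall c,
  (n%:R - l.+1%:R) *: nab c over0 = W_over c + ctr c om + wedge (g c) th].
Proof.
set K : A := n%:R - l.+1%:R; pose Y := \sum_b up b (prX F mu b).
(* om and th collect the terms of the Leibniz rule that begin with ctr c or
   with wedge (g c). *)
exists (2%:R * K *: ctrv xi F + (- 2%:R *: ctrv (cov sigma) Y +
   (K *: ctr2 mu' mu + - (2%:R * K * nu [::]) *: rho))), (K *: ctr2 mu' rho).
have iX := isform_prX cF; have iN := isform_prN cF; case: (cF) => iF im ir HF.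
have aY : altern Y by apply: (proj1 (isform_sum _ (fun b => isform_up gi b (iX b)))).
split.
- apply: alternP; first exact: altern_ctrv.
  apply: alternP; first exact: altern_ctrv.
  apply: alternP; first by case: (isform_ctr2 gi mu' im).
  by rewrite -[_ *: rho]addr0; apply: alternP => //; exact: altern0.
- by case: (isformZ K (isform_ctr2 gi mu' ir)).
move=> c; rewrite /over0 nabD nabN nab_nat nab_ctr2 nab_ctrv nabv_sigma.
have -> : nab c mu' = prX sigma mu' c - wedge (Psch c) sigma by rewrite addrK.
have -> : nab c rho = prN F rho c - ctrv (Psch c) F by rewrite addrK.
have HN := prolong_N gP tf weyl_likeP ln iF iX iN (ckf_prolong cF) c; rewrite -/Y -/K in HN.
rewrite HF prX_sigma; move: HN; move: (prN F rho c) (Psch c) => Nc Pc HN.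
rewrite -!scaleN1r !ctr2D !ctr2Z ctr2_sum !ctr2_wedge // ctr2Dr ctr2_ctr //.
rewrite (eq_bigr _ (fun d _ => ctr2_wedge gi (dl A d) (D c d sigma) aF)).
rewrite ctr2_wedge_g // ctrvD ctrvZ ctrvDr ctrvZr (ctrv_g gP) -/xi.
have -> : \sum_d 2%:R *: ctrv (cov (D c d sigma)) (ctrv (dl A d) F) =
   2%:R *: \sum_d ctrv (cov (D c d sigma)) (up d F).
  by rewrite scaler_sumr; apply: eq_bigr => d' _; rewrite ctrv_dl.
rewrite /W_over; have -> : \sum_b up b (D b c F) = K *: Nc + ctr c Y.
  by rewrite HN subrK.
rewrite ctrvDr ctrvZr !(ctrD c, ctrZ _ c) !ctr_ctrv // (wedgeZ K) -/K (ctrv_g gP).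
by move: (\sum_d _) => S; form_ring.
Qed.

(** By underA_killing, this is the second bracket of conformal Killing forms
    up to a constant factor. *)
Definition under0 := 2%:R *: wedge (cov sigma) mu + wdg2 mu' F.
Definition W_under c : form :=
  - 2%:R *: wedge (cov sigma) (\sum_d wedge (dl A d) (D c d F))
  - (2%:R * l.+1%:R) *: \sum_d wedge (dl A d) (wedge (cov (D c d sigma)) F).

(** As for over0, but with prX of both factors. *)
Lemma nab_under0 : exists om th, [/\ altern om, altern th & forall c,
  l.+1%:R *: nab c under0 = W_under c + ctr c om + wedge (g c) th].
Proof.
set k : A := l.+1%:R.
pose SN := \sum_d wedge (dl A d) (prN F rho d).
have iX := isform_prX cF; have iN := isform_prN cF; case: (cF) => iF im ir HF.
have aSN : altern SN by apply: (proj1 (isform_sum _ (fun b => isform_wedge _ (iN b)))).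
exists (k *: wdg2 mu' mu), (2%:R *: wedge (cov sigma) SN + (- (2%:R * k) *: wedge xi F +
   (2%:R * k * nu [::] *: mu + k *: wdg2 mu' rho))).
split.
- by case: (isformZ k (isform_wdg2 mu' im)).
- apply: alternP; first exact: altern_wedge.
  apply: alternP; first exact: altern_wedge.
  by apply: alternP => //; case: (isformZ k (isform_wdg2 mu' ir)).
move=> c; rewrite /under0 nabD nab_nat nab_wedge nab_wdg2 nabv_sigma.
have -> : nab c mu' = prX sigma mu' c - wedge (Psch c) sigma by rewrite addrK.
have -> : nab c mu = prX F mu c - wedge (Psch c) F by rewrite addrK.
have HX := prolong_X gP tf weyl_likeP iX (ckf_prolong cF) c; rewrite -/SN -/k in HX.
rewrite HF prX_sigma /W_under -/k; move: HX; move: (prX F mu c) (Psch c) => Xc Pc HX.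
have -> : \sum_d wedge (dl A d) (D c d F) = - (k *: Xc) - wedge (g c) SN.
  by rewrite HX opprB opprK addrK.
rewrite -!scaleN1r !wdg2D !wdg2Z wdg2_sum !wdg2_wedge wdg2Dr wdg2_ctr //.
rewrite (eq_bigr _ (fun d _ => wdg2_wedge (dl A d) (D c d sigma) F)) wdg2_g -/xi.
rewrite -scaler_sumr.
rewrite wedgevD wedgevZ !(wedgeDr (cov sigma), wedgeDr (g c), wedgeZ).
rewrite (wedgeC (cov sigma) (g c)) (wedgeC (cov sigma) Pc) (ctrZ k c).
by move: (\sum_(i < n) _) => S; form_ring.
Qed.

(** The Bianchi identity together with the skewness of f. *)
Lemma swapC (V : lmodType A) (f : 'I_n -> 'I_n -> V) c a :
  (forall p q, f p q = - f q p) ->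
  2%:R *: (\sum_p \sum_q Weyl c p a q *: f p q) = \sum_p \sum_q Weyl c a p q *: f p q.
Proof.
move=> fN; rewrite scaler_nat mulr2n.
have {2}-> : \sum_p \sum_q Weyl c p a q *: f p q = \sum_p \sum_q (- Weyl c q a p) *: f p q.
  rewrite exchange_big; apply: eq_bigr => p _; apply: eq_bigr => q _.
  by rewrite fN scalerN scaleNr.
rewrite -big_split; apply: eq_bigr => p _; rewrite -big_split; apply: eq_bigr => q _ /=.
rewrite -scalerDl; congr (_ *: _).
have H := C234 tf weyl_likeP c p a q; rewrite (C34 weyl_likeP c q p a) in H.
have := C234 tf weyl_likeP c a p q.
rewrite (C34 weyl_likeP c p q a) => /eqP; rewrite addrAC subr_eq0 => /eqP <-.
by rewrite addrK.
Qed.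

Local Notation sg e := (up e sigma [::]).

Lemma cov_D b c : cov (D b c sigma) = \sum_e sg e *: Weyl b c e.
Proof. by rewrite cov_sumF; apply: eq_bigr => e _; rewrite cov_wedge. Qed.

Lemma wedge_swapC c (V : 'I_n -> 'I_n -> form) : (forall p q, V p q = - V q p) ->
  2%:R *: (\sum_p \sum_q wedge (fun a => Weyl c p a q) (V p q)) =
  \sum_p \sum_q wedge (fun a => Weyl c a p q) (V p q).
Proof.
move=> VN; have E (Cc : 'I_n -> 'I_n -> covec) : \sum_p \sum_q wedge (Cc p q) (V p q) =
    \sum_a \sum_p \sum_q Cc p q a *: wedge (dl A a) (V p q).
  rewrite [RHS]exchange_big; apply: eq_bigr => p _.
  rewrite [RHS]exchange_big; apply: eq_bigr => q _; exact: wedge_dl.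
rewrite !E scaler_sumr; apply: eq_bigr => a _; apply: swapC => p q.
by rewrite VN wedgeNr.
Qed.

Definition weyl_over0 c : form := (n%:R - l.+1%:R + 1) *:
    \sum_r sg r *: \sum_p \sum_q Weyl r c p q *: up q (up p F)
  + \sum_p \sum_q wedge (fun b => Weyl c b p q) (ctrv (cov sigma) (up q (up p F))).

(** The prolongation contracts C over indices in crossed positions; swapC
    brings them into the last two positions, with a factor 2. *)
Lemma W_overE c : W_over c = weyl_over0 c.
Proof.
have upA p q : up q (up p F) = - up p (up q F) by exact: upC.
have T1 : 2%:R *: (\sum_d ctrv (cov (D c d sigma)) (up d F)) =
    - \sum_r sg r *: \sum_p \sum_q Weyl r c p q *: up q (up p F).
  under eq_bigr do rewrite cov_D ctrv_suml.
  rewrite exchange_big scaler_sumr -sumrN; apply: eq_bigr => e _ /=.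
  under eq_bigr do rewrite ctrvZ.
  rewrite -scaler_sumr scalerA mulrC -scalerA swapC // -scalerN; congr (_ *: _).
  rewrite -sumrN; apply: eq_bigr => p _; rewrite -sumrN; apply: eq_bigr => q _.
  by rewrite (C12 weyl_likeP c e) scaleNr.
have T2 : 2%:R *: (\sum_b \sum_e (\sum_q sg q * Weyl b c e q) *: up b (up e F)) =
    \sum_r sg r *: \sum_p \sum_q Weyl r c p q *: up q (up p F).
  transitivity (\sum_r sg r *: (2%:R *: \sum_b \sum_e Weyl c b r e *: up b (up e F))).
    under [RHS]eq_bigr do rewrite scalerA mulrC -scalerA.
    rewrite -scaler_sumr; congr (_ *: _).
    under [RHS]eq_bigr do rewrite scaler_sumr.
    rewrite [RHS]exchange_big; apply: eq_bigr => b _.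
    under [RHS]eq_bigr do rewrite scaler_sumr.
    rewrite [RHS]exchange_big; apply: eq_bigr => e _ /=.
    rewrite scaler_suml; apply: eq_bigr => r _.
    by rewrite scalerA (C12 weyl_likeP b c) (C34 weyl_likeP c b e r) opprK.
  apply: eq_bigr => r _; rewrite swapC //; congr (_ *: _).
  apply: eq_bigr => p _; apply: eq_bigr => q _.
  by rewrite upA (C12 weyl_likeP c r) scalerN scaleNr opprK.
have T3 : 2%:R *: (\sum_b \sum_e wedge (Weyl b c e) (ctrv (cov sigma) (up b (up e F)))) =
    - \sum_p \sum_q wedge (fun b => Weyl c b p q) (ctrv (cov sigma) (up q (up p F))).
  transitivity (2%:R *: (\sum_b \sum_e wedge (fun a => Weyl c b a e) (ctrv (cov sigma) (up b (up e F))))).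
    congr (_ *: _); apply: eq_bigr => b _; apply: eq_bigr => e _.
    congr (wedge _ _); apply/funext => a.
    by rewrite (C12 weyl_likeP b c) (C34 weyl_likeP c b e a) opprK.
  rewrite wedge_swapC; last by move=> p q; rewrite upA ctrvNr.
  rewrite -sumrN; apply: eq_bigr => p _; rewrite -sumrN; apply: eq_bigr => q _.
  by rewrite (upA p q) ctrvNr wedgeNr opprK.
rewrite /W_over /weyl_over0 (up_D weyl_likeP) ctrvNr (linear_sum (ctrv _)) /=.
under [X in _ - _ *: (- X)]eq_bigr => b _.
  rewrite (linear_sum (ctrv _)) /=.
  under eq_bigr => e _.
    rewrite ctrv_wedge (_ : \sum_p _ = \sum_q sg q * Weyl b c e q); last first.
      rewrite /rais; under eq_bigr do rewrite mulr_sumr.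
      rewrite exchange_big; apply: eq_bigr => q _ /=.
      rewrite upE form_sum mulr_suml; apply: eq_bigr => p _.
      by rewrite formZ /ctr /cov (gi_sym gP q p); ring.
    over.
  rewrite sumrB. over.
rewrite sumrB scalerN opprK scalerBr T2 T3 mulrC scaleNr -scalerA T1 opprK.
by move: (\sum_r _) (\sum_p _) => x y; form_ring.
Qed.

Definition weyl_under0 c : form :=
  - 2%:R *: wedge (cov sigma) (\sum_d wedge (dl A d) (D c d F))
  + l.+1%:R *: \sum_e sg e *: \sum_d wedge (dl A d) (wedge (Weyl e c d) F).

Lemma W_underE c : W_under c = weyl_under0 c.
Proof.
rewrite /W_under /weyl_under0; congr (_ + _).
have -> : \sum_d wedge (dl A d) (wedge (cov (D c d sigma)) F) =
   \sum_e sg e *: \sum_d \sum_a Weyl c d e a *: wedge (dl A d) (wedge (dl A a) F).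
  under eq_bigr do rewrite cov_D wedgev_sum (linear_sum (wedge _)) /=.
  rewrite exchange_big; apply: eq_bigr => e _; rewrite scaler_sumr; apply: eq_bigr => d' _ /=.
  rewrite wedgevZ wedgeZ (wedge_dl (Weyl _ _ _)) (linear_sum (wedge _)) /=; congr (_ *: _).
  by apply: eq_bigr => a _; rewrite wedgeZ.
rewrite mulrC -scalerA -scalerN; congr (_ *: _).
rewrite scaler_sumr -sumrN; apply: eq_bigr => e _.
rewrite scalerA mulrC -scalerA swapC; last by move=> p q; rewrite wedgeC.
rewrite -scalerN -sumrN; congr (_ *: _); apply: eq_bigr => d' _.
rewrite (wedge_dl (Weyl _ _ _)) (linear_sum (wedge _)) -sumrN /=; apply: eq_bigr => a _.
by rewrite wedgeZ (C12 weyl_likeP e) scaleNr.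
Qed.

End Bracket.

End Connection.

(** * Alternation and the trace-free projection *)

Section Skew.
Variables (R : realType) (n : nat).
Local Notation form := (form R n).
Local Notation covec := (covec R n).
Implicit Types (F G T : form) (v : covec) (b c d : 'I_n) (s : seq 'I_n).

Lemma wedge_ext m v F G s : (forall t, size t = m -> F t = G t) ->
  size s = m.+1 -> wedge v F s = wedge v G s.
Proof.
elim: s m F G => [//|b s IH] m F G FG /= [sm].
rewrite !wedge_cons FG //; congr (_ - _).
case: s sm IH => [|c s] sm IH; first by rewrite !wedge_nil.
case: m sm FG => [//|m] sm FG.
by apply: (IH m) => // t tm; apply: FG; rewrite /= tm.
Qed.

Lemma mapI_size (x : 'I_0 -> 'I_n) : [seq x t | t <- enum 'I_0] = [::].
Proof. by apply: size0nil; rewrite size_map size_enum_ord. Qed.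

Lemma mapI_cons m (x : 'I_m.+1 -> 'I_n) : [seq x t | t <- enum 'I_m.+1] =
  x ord0 :: [seq x (lift ord0 t) | t <- enum 'I_m].
Proof. by rewrite enum_ordSl /= -map_comp. Qed.

Lemma lift0_0 m (j : 'I_m.+1) : lift (lift ord0 j) (ord0 : 'I_m.+1) = ord0.
Proof. exact: val_inj. Qed.
Lemma lift_lift m (j : 'I_m.+1) (t : 'I_m) :
  lift (lift ord0 j) (lift ord0 t) = lift ord0 (lift j t).
Proof. by apply: val_inj; rewrite /= /bump !leq0n !add1n ltnS addnS. Qed.

Lemma sum_dl_wedge m (G : 'I_n -> form) (x : 'I_m.+1 -> 'I_n) :
  \sum_d wedge (dl R d) (G d) [seq x t | t <- enum 'I_m.+1] =
  \sum_(j < m.+1) (-1) ^+ j * G (x j) [seq x (lift j t) | t <- enum 'I_m].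
Proof.
elim: m G x => [|m IH] G x; rewrite mapI_cons; under eq_bigr do rewrite wedge_cons.
  rewrite sumrB (sum_dl (fun d => G d _ : R^o)) big_ord1 mul1r !mapI_size.
  by rewrite big1 ?subr0 // => d _; rewrite wedge_nil.
rewrite sumrB (sum_dl (fun d => G d _ : R^o)) IH [RHS]big_ord_recl expr0 mul1r; congr (_ + _).
rewrite -sumrN; apply: eq_bigr => j _.
rewrite lift0 exprS mulN1r mulNr; congr (- (_ * G _ _)).
rewrite mapI_cons lift0_0; congr (_ :: _).
by apply: eq_map => t; rewrite lift_lift.
Qed.

Definition altf m T (x : 'I_m -> 'I_n) : R :=
  (m`!%:R)^-1 * \sum_(s : 'S_m) (-1) ^+ s * T [seq x (s t) | t <- enum 'I_m].

Lemma mapI m s : size s = m -> exists x : 'I_m -> 'I_n, s = [seq x t | t <- enum 'I_m].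
Proof.
move=> <-; exists (tnth (in_tuple s)).
by rewrite -{1}[s]/(val (in_tuple s)) {1}(tuple_map_ord (in_tuple s)) /=.
Qed.

Lemma altE m T (x : 'I_m -> 'I_n) : alt T [seq x t | t <- enum 'I_m] = altf T x.
Proof.
set s := [seq _ | _ <- _]; have sm : size s = m by rewrite size_map size_enum_ord.
rewrite /alt; have tn (e : size s = m) t : tnth (in_tuple s) t = x (cast_ord e t).
  rewrite (tnth_nth (x (cast_ord e t))) /= (nth_map (cast_ord e t)) ?size_enum_ord -?e //.
  by congr x; apply: val_inj; rewrite /= nth_enum_ord // -e.
move: (tnth _) tn; move: (size s) sm => k km; subst k => y yx.
have {yx}-> : y = x by apply/funext => t; rewrite (yx erefl) cast_ord_id.
by [].
Qed.

(** Permutations are sorted by the position that they move to the front. This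
    turns sums over permutations into the recursion that defines the exterior
    product. *)
Lemma alt_rec m T s : size s = m.+1 ->
  alt T s = m.+1%:R^-1 * \sum_d wedge (dl R d) (alt (ctr d T)) s.
Proof.
move=> /mapI[x ->]; rewrite altE sum_dl_wedge /altf.
have bij_lp : bijective (fun p : 'I_m.+1 * 'S_m => lift_perm ord0 p.1 p.2).
  apply: inj_card_bij; last by rewrite card_prod !card_Sn card_ord factS.
  move=> [j s1] [j' s2] /= e.
  have ej : j = j' by move/(congr1 (fun q : 'S_m.+1 => q ord0)): e; rewrite !lift_perm_id.
  subst j'; congr (_, _); apply/permP => t.
  move/(congr1 (fun q : 'S_m.+1 => q (lift ord0 t))): e; rewrite !lift_perm_lift.
  exact: lift_inj.
rewrite (reindex _ (onW_bij _ bij_lp)) /=.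
rewrite -(pair_bigA _ (fun j p => (-1) ^+ lift_perm ord0 j p *
  T [seq x (lift_perm ord0 j p t) | t <- enum 'I_m.+1])) /=.
rewrite factS natrM invfM -mulrA mulr_sumr; congr (_ * _); apply: eq_bigr => j _.
rewrite altE /altf mulrCA; congr (_ * _); rewrite mulr_sumr; apply: eq_bigr => s1 _.
rewrite odd_lift_perm /= signr_addb signr_odd -mulrA mapI_cons lift_perm_id; congr (_ * (_ * T (_ :: _))).
by apply: eq_map => t; rewrite lift_perm_lift.
Qed.

Lemma alt_ext m T T' s : (forall t, size t = m -> T t = T' t) -> size s = m ->
  alt T s = alt T' s.
Proof.
move=> TT sm; rewrite /alt; congr (_ * _); apply: eq_bigr => p _; congr (_ * _).
by apply: TT; rewrite size_map size_enum_ord.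
Qed.

Lemma alt_nil T : alt T [::] = T [::].
Proof.
rewrite -(mapI_size (fun t : 'I_0 => False_rect 'I_n (notF (ltn_ord t)))) altE /altf.
rewrite mapI_size fact0 invr1 mul1r (big_pred1 (1%g : {perm 'I_0})).
  by rewrite odd_perm1 mul1r mapI_size.
by move=> q; apply/esym/eqP/permP => -[].
Qed.

Lemma alt_perm m T (x : 'I_m -> 'I_n) (p : 'S_m) :
  alt T [seq x (p t) | t <- enum 'I_m] = (-1) ^+ p * alt T [seq x t | t <- enum 'I_m].
Proof.
rewrite (altE T (fun t => x (p t))) altE /altf mulrCA; congr (_ * _).
rewrite [in RHS](reindex_inj (mulIg p)) mulr_sumr; apply: eq_bigr => q _ /=.
rewrite mulrA odd_permM signr_addb mulrCA -signr_addb addbb mulr1; congr (_ * T _).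
by apply: eq_map => t; rewrite permM.
Qed.

Lemma altP_lin (x : R) F G s : alt (x *: F + G) s = x * alt F s + alt G s.
Proof.
rewrite /alt mulrCA -mulrDr; congr (_ * _); rewrite mulr_sumr -big_split.
by apply: eq_bigr => p _; rewrite formD formZ /= mulrDr mulrCA.
Qed.

Lemma alt_sum (J : finType) (f : J -> form) s :
  alt (\sum_j f j : form) s = \sum_j alt (f j) s.
Proof.
rewrite /alt -mulr_sumr exchange_big; congr (_ * _); apply: eq_bigr => p _ /=.
by rewrite form_sum mulr_sumr.
Qed.

Definition trunc m F : form := fun s => if size s == m then F s else 0.

Lemma trunc_size m F s : size s = m -> trunc m F s = F s.
Proof. by rewrite /trunc => ->; rewrite eqxx. Qed.

Lemma isform_trunc m F : altern F -> isform m (trunc m F).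
Proof.
move=> aF; split; last by move=> t /negbTE tm; rewrite /trunc tm.
by move=> s1 b c s2; rewrite /trunc !size_cat /= aF; case: ifP => _ //; rewrite oppr0.
Qed.

Lemma alt_id m F s : altern F -> size s = m -> alt F s = F s.
Proof.
elim: m F s => [|m IH] F s aF sm; first by rewrite (size0nil sm) alt_nil.
rewrite (alt_rec _ sm) -[RHS](mulKf (x := m.+1%:R)) ?pnatr_eq0 //; congr (_ * _).
have := congr1 (fun H : form => H s) (euler (isform_trunc m.+1 aF)).
rewrite formE formZ trunc_size // => <-; apply: eq_bigr => d _.
apply: (wedge_ext (m := m)) => // t tm; rewrite IH //; last exact: altern_ctr.
by rewrite /ctr trunc_size //= tm.
Qed.

Fixpoint swapat j s : seq 'I_n := match j, s with
  | 0, b :: c :: t => c :: b :: t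
  | j'.+1, b :: t => b :: swapat j' t
  | _, _ => s end.

Lemma swapatE s1 b c s2 : swapat (size s1) (s1 ++ b :: c :: s2) = s1 ++ c :: b :: s2.
Proof. by elim: s1 => //= a s1 ->. Qed.

(** By alt_rec, twice in front and by induction further back, from the
    anticommutation of exterior products. *)
Lemma alt_swap j T s : (j.+1 < size s)%N -> alt (fun t => T (swapat j t)) s = - alt T s.
Proof.
move sm : (size s) => m; case: m sm => [//|m] sm.
elim: j T m s sm => [|j IH] T m s sm jm; rewrite !(alt_rec _ sm) -mulrN; congr (_ * _).
  case: m sm jm => [//|m] sm _.
  have E T' : \sum_d wedge (dl R d) (alt (ctr d T')) s = m.+1%:R^-1 *
      \sum_d \sum_e wedge (dl R d) (wedge (dl R e) (alt (ctr e (ctr d T')))) s.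
    rewrite mulr_sumr; apply: eq_bigr => d _.
    transitivity (wedge (dl R d) (m.+1%:R^-1 *: \sum_e wedge (dl R e) (alt (ctr e (ctr d T')))) s).
      by apply: (wedge_ext (m := m.+1)) => // t tm; rewrite (alt_rec _ tm) formZ form_sum.
    by rewrite wedgeZ formZ (linear_sum (wedge _)) form_sum.
  rewrite !E -mulrN; congr (_ * _); rewrite exchange_big -sumrN; apply: eq_bigr => d _ /=.
  rewrite -sumrN; apply: eq_bigr => e _.
  by rewrite wedgeC formN; congr (- wedge _ (wedge _ _) s).
rewrite -sumrN; apply: eq_bigr => d _; rewrite -formN -wedgeNr.
case: m sm jm => [//|m] sm jm.
by apply: (wedge_ext (m := m.+1)) => // t tm; rewrite formN; apply: (IH (ctr d T) m).
Qed.

Lemma altern_alt T : altern (alt T : form).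
Proof.
have H m : forall T', altern (trunc m (alt T')).
  elim: m => [|m IH] T' s1 b c s2; first by rewrite /trunc !size_cat /= !addnS oppr0.
  rewrite /trunc !size_cat /=; case: eqP => [sm|_]; last by rewrite oppr0.
  have E t : size t = m.+1 -> alt T' t =
      (m.+1%:R^-1 *: \sum_d wedge (dl R d) (trunc m (alt (ctr d T')))) t.
    move=> tm; rewrite (alt_rec _ tm) formZ form_sum; congr (_ * _); apply: eq_bigr => d _.
    by apply: (wedge_ext (m := m)) => // u um; rewrite trunc_size.
  rewrite !E ?size_cat //.
  have -> // : altern (m.+1%:R^-1 *: \sum_d wedge (dl R d) (trunc m (alt (ctr d T')))).
  rewrite -[_ *: _]addr0; apply: alternP; last exact: altern0.
  elim/big_rec: _ => [|d G _ aG]; first exact: altern0.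
  by rewrite -[wedge _ _]scale1r; apply: alternP => //; apply: altern_wedge; exact: IH.
move=> s1 b c s2; have := H (size (s1 ++ b :: c :: s2)) T s1 b c s2.
by rewrite !trunc_size // !size_cat.
Qed.

Definition ins j b s := take j s ++ b :: drop j s.

Lemma alt_ins j T s m : size s = m.+1 -> (j <= m)%N ->
  alt (fun t => if t is b :: t' then T (ins j b t') else 0) s = (-1) ^+ j * alt T s.
Proof.
move=> sm; elim: j T => [|j IH] T jm.
  by rewrite mul1r; apply: (alt_ext _ sm) => -[|b t] // _; rewrite /ins take0 drop0.
rewrite exprS mulN1r mulNr -mulrN -(alt_swap (j := j)); last by rewrite sm ltnS.
rewrite -IH; last exact: ltnW.
apply: (alt_ext _ sm) => -[|b t] //= [tm]; congr T.
rewrite /ins; have jt : (j < size t)%N by rewrite tm.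
rewrite (take_nth b jt) (drop_nth b jt) -cats1 -catA /=.
by have := swapatE (take j t) b (nth b t j) (drop j.+1 t); rewrite size_takel ?(ltnW jt).
Qed.

Lemma alt_rot1 T s m : size s = m.+1 ->
  alt (fun t => T (rot 1 t)) s = (-1) ^+ m * alt T s.
Proof.
move=> sm; rewrite -(alt_ins T sm (leqnn m)); apply: (alt_ext _ sm) => -[|b t] //= [tm].
by congr T; rewrite /ins -tm take_size drop_size rot1_cons cats1.
Qed.

(** Moving two indices past all others is an even permutation. *)
Lemma alt_rot2 k T s : size s = k.+2 -> alt (fun t => T (rot k t)) s = alt T s.
Proof.
move=> sk; have E T' : alt (fun t => T' (rot 2 t)) s = alt T' s.
  have := alt_rot1 (fun t => T' (rot 1 t)) sk.
  rewrite (alt_rot1 T' sk) mulrA -expr2 sqrr_sign mul1r => <-.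
  by apply: (alt_ext _ sk) => t tk; rewrite -rotD // tk.
rewrite -E; apply: (alt_ext _ sk) => t tk; congr T.
by rewrite -rotD ?tk ?addn2 // rot_oversize ?tk.
Qed.

Lemma alt_cov v F s m : size s = m.+1 -> altern F ->
  alt (fun t => if t is b :: t' then v b * F t' else 0) s = m.+1%:R^-1 * wedge v F s.
Proof.
move=> sm aF; rewrite (alt_rec _ sm); congr (_ * _).
rewrite wedge_dl form_sum; apply: eq_bigr => d _; rewrite -wedgeZ.
apply: (wedge_ext (m := m)) => // t tm; exact: (alt_id (alternZ _ aF) tm).
Qed.

Definition skew k F := forall (p : 'S_k) (a : k.-tuple 'I_n),
  F [tuple tnth a (p t) | t < k] = (-1) ^+ p * F a.

Lemma skew_alt k F (a : k.-tuple 'I_n) : skew k F -> alt F a = F a.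
Proof.
move=> sF; rewrite {1}(tuple_map_ord a) /= altE /altf.
rewrite (eq_bigr (fun=> F a)) ?sumr_const ?cardsT ?card_Sn.
  by rewrite -[F a *+ _]mulr_natl mulKf // pnatr_eq0 -lt0n fact_gt0.
move=> p _; have /= -> := sF p a.
by rewrite mulrA -expr2 sqrr_sign mul1r.
Qed.

(** A tensor that is skew equals its own alternation. *)
Lemma skew_altern k F : skew k F -> altern (trunc k F).
Proof.
move=> sF; have -> : trunc k F = trunc k (alt F).
  apply/funext => s; rewrite /trunc; case: eqP => // sk; subst k.
  by rewrite (skew_alt (in_tuple s)).
by case: (isform_trunc k (altern_alt F)).
Qed.

Lemma altern_skew k F : altern F -> skew k F.
Proof.
move=> aF p a.
rewrite -(alt_id aF (size_tuple a)) -(alt_id aF (size_tuple [tuple tnth a (p t) | t < k])).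
rewrite [in RHS](tuple_map_ord a) /=; exact: (alt_perm F (tnth a) p).
Qed.

Lemma skew_ext k F G : (forall a : k.-tuple 'I_n, F a = G a) -> skew k F -> skew k G.
Proof. by move=> FG sF p a; rewrite -!FG. Qed.

End Skew.

Section Projection.
Variables (R : realType) (n : nat) (M : manifold R n) (g : field M).
Variables (i : chart M) (x : 'rV[R]_n).
Local Notation form := (form R n).
Implicit Types (b c d : 'I_n) (s : seq 'I_n) (om th : form).
Let gg : 'I_n -> covec R n := fun a b => g i x [:: a; b].
Let gi : 'I_n -> covec R n := ginv g i x.
Hypothesis gP : metric_pair gg gi.

Lemma tfreeR : tfree R.
Proof. by move=> m y /eqP; rewrite mulf_eq0 pnatr_eq0 => /eqP. Qed.

(** The sum of an exterior part and a trace part; these are the expressions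
    that the projection annihilates (proj0_pure, pure_proj0). *)
Definition pure m (f : 'I_n -> form) := exists om th, [/\ altern om, altern th &
  forall c s, size s = m -> f c s = ctr c om s + wedge (gg c) th s].

Let hd (f : 'I_n -> form) : form := fun s => if s is d :: s' then f d s' else 0.
Let tr (f : 'I_n -> form) : form :=
  fun s => \sum_p raise g i x (fun q => f q (p :: s)) p.

Let hw (v : covec R n) F : form := fun s => if s is b :: s' then v b * F s' else 0.

Let proj0_def f c s : proj0 g i x f c s = f c s - alt (hd f) (c :: s) -
  (size s)%:R / (n%:R - (size s)%:R + 1) *
  alt (hw (gg c) (tr f)) s.
Proof. by []. Qed.

Let trE f : tr f = \sum_p up gi p (f p).
Proof.
apply/funext => s; rewrite form_sum /tr /raise exchange_big; apply: eq_bigr => p _.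
rewrite upE form_sum; apply: eq_bigr => q _.
by rewrite formZ /ctr; congr (_ * _); exact: (gi_sym gP).
Qed.

(** On forms, the alternation in the first correction term is the exterior
    product with the basis covectors, and in the second the exterior product
    with g. *)
Lemma proj0E m (f : 'I_n -> form) c s : (forall c, altern (f c)) -> size s = m.+1 ->
  proj0 g i x f c s = f c s - m.+2%:R^-1 * ctr c (\sum_d wedge (dl R d) (f d)) s
    - (n%:R - m.+1%:R + 1)^-1 * wedge (gg c) (\sum_p up gi p (f p)) s.
Proof.
move=> af sm; rewrite proj0_def sm trE.
have au : altern (\sum_p up gi p (f p)) by apply: altern_sum => p; exact: altern_up.
rewrite (alt_cov (gg c) sm au).
rewrite (alt_rec (m := m.+1)) ?form_sum /= ?sm //; congr (_ - _ * _ - _).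
  rewrite /ctr form_sum; apply: eq_bigr => d _; apply: (wedge_ext (m := m.+1)) => //=.
    by move=> u um; apply: (alt_id _ um); exact: af.
  by rewrite sm.
by rewrite mulrA [m.+1%:R / _ / _]mulrAC divff ?mul1r // pnatr_eq0.
Qed.

Lemma proj0_lin (a : R) (f h : 'I_n -> form) c s :
  proj0 g i x (fun c => a *: f c + h c) c s = a * proj0 g i x f c s + proj0 g i x h c s.
Proof.
rewrite !proj0_def formD formZ.
have -> : hd (fun c => a *: f c + h c) = a *: hd f + hd h.
  by apply/funext => -[|b u]; rewrite !formE //= mulr0 addr0.
have -> : hw (gg c) (tr (fun c => a *: f c + h c)) = a *: hw (gg c) (tr f) + hw (gg c) (tr h).
  apply/funext => -[|b u]; rewrite !formE /= ?mulr0 ?addr0 // mulrCA -mulrDr; congr (_ * _).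
  rewrite /tr mulr_sumr -big_split; apply: eq_bigr => p _.
  rewrite /raise mulr_sumr -big_split; apply: eq_bigr => q _.
  by rewrite formD formZ /= mulrDr mulrCA.
rewrite !altP_lin.
move: (alt _ (c :: s)) (alt _ (c :: s)) (alt _ s) (alt _ s) => y1 y2 y3 y4; ring.
Qed.

Lemma proj0_ext m (f h : 'I_n -> form) : (forall c s, size s = m.+1 -> f c s = h c s) ->
  forall c s, size s = m.+1 -> proj0 g i x f c s = proj0 g i x h c s.
Proof.
move=> fh c s sm; rewrite !proj0_def sm fh //; congr (_ - _ - _ * _).
  by apply: (alt_ext (m := m.+2)) => /=; rewrite ?sm // => -[|d u] //= [um]; rewrite fh.
apply: (alt_ext (m := m.+1)) => // -[|b u] //= [um]; congr (_ * _).
by apply: eq_bigr => p _; apply: eq_bigr => q _; rewrite fh //= um.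
Qed.

(** The exterior derivative of a pure f determines its exterior part, its
    divergence determines its trace part, with the constants by which the two
    correction terms of the projection divide. *)
Lemma proj0_pure m f : (m.+1 <= n)%N -> pure m.+1 f ->
  forall c s, size s = m.+1 -> proj0 g i x f c s = 0.
Proof.
move=> mn [om [th [ao ath fE]]].
have io := isform_trunc m.+2 ao; have it := isform_trunc m ath.
pose om' := trunc m.+2 om; pose th' := trunc m th.
pose h c := ctr c om' + wedge (gg c) th'.
have fh c s : size s = m.+1 -> f c s = h c s.
  move=> sm; rewrite fE // /h formD /om' /ctr trunc_size ?sm //; last by rewrite /= sm.
  congr (_ + _); apply: (wedge_ext (m := m)) => // u um.
  by rewrite /th' trunc_size.
move=> c s sm; rewrite (proj0_ext fh) // (proj0E c _ sm); last first.
  move=> d; apply: alternD; first by case: (isform_ctr d io).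
  by case: (isform_wedge (gg d) it).
have -> : \sum_d wedge (dl R d) (h d) = m.+2%:R *: om'.
  under eq_bigr do rewrite wedgeDr.
  by rewrite big_split (euler io) /= (sum_dl_g gP tfreeR) addr0.
have -> : \sum_p up gi p (h p) = (n%:R - m%:R) *: th'.
  under eq_bigr do rewrite upD.
  by rewrite big_split /= (up_ctr_tr gP tfreeR) ?(up_g_sum gP it) ?add0r //; case: io.
rewrite ctrZ wedgeZ /h formD !formZ !mulrA.
have -> : n%:R - m.+1%:R + 1 = n%:R - m%:R :> R by rewrite -natr1; ring.
have nm : n%:R - m%:R != 0 :> R by rewrite subr_eq0 eqr_nat neq_ltn mn orbT.
rewrite (mulVf nm) mulVf ?pnatr_eq0 // !mul1r.
by move: (ctr c om' s) (wedge _ _ s) => y z; ring.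
Qed.

Lemma pure_proj0 m f : (forall c, altern (f c)) ->
  (forall c s, size s = m.+1 -> proj0 g i x f c s = 0) -> forall c s, size s = m.+1 ->
  f c s = ctr c (m.+2%:R^-1 *: \sum_d wedge (dl R d) (f d)) s +
   wedge (gg c) ((n%:R - m.+1%:R + 1)^-1 *: \sum_p up gi p (f p)) s.
Proof.
move=> af pf c s sm; have := pf c s sm; rewrite (proj0E c af sm) ctrZ wedgeZ !formZ.
by move=> /eqP; rewrite -addrA -opprD subr_eq0 => /eqP.
Qed.

End Projection.

(** * Smooth functions of several variables *)

Section MeanValue.
Variables (R : realType) (n : nat).
Local Notation V := 'rV[R]_n.
Implicit Types (f : V -> R) (x y z v : V) (a b c : 'I_n).
Local Notation ed a := (delta_mx 0 a : V).

Lemma rV_norm_le v (r : R) : 0 <= r -> (forall a, `|v 0 a| <= r) -> `|v| <= r.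
Proof.
move=> r0 vr; rewrite [`|v|]mx_normrE; apply/bigmax_leP; split=> // -[i j] _ /=.
by rewrite (ord1 i).
Qed.

Lemma rV_norm_ge v a : `|v 0 a| <= `|v|.
Proof. by rewrite [leRHS]mx_normrE; apply: (le_bigmax _ _ (0, a)). Qed.

Lemma norm_ed a (t : R) : `|t *: ed a| <= `|t|.
Proof.
apply: rV_norm_le => // b; rewrite !mxE /=.
by case: (b == a); rewrite ?mulr1 // mulr0 normr0.
Qed.

Lemma derivable_line f y a (s : R) : derivable f (y + s *: ed a) (ed a) ->
  is_derive s 1 (fun t : R => f (y + t *: ed a)) (pd a f (y + s *: ed a)).
Proof.
move=> df.
have E : (fun h : R => h^-1 *: (((fun t : R => f (y + t *: ed a)) \o shift s) (h *: 1) -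
      f (y + s *: ed a))) =
   (fun h => h^-1 *: ((f \o shift (y + s *: ed a)) (h *: ed a) - f (y + s *: ed a))).
  apply/funext => h /=; congr (_ *: (f _ - _)).
  by rewrite [h *: 1]mulr1 scalerDl addrCA addrC -addrA addrC.
by apply: DeriveDef; rewrite /derivable /pd /derive E.
Qed.

Lemma mvt_line f y a (T : R) :
  (forall s : R, `|s| <= `|T| -> derivable f (y + s *: ed a) (ed a)) ->
  exists2 s : R, `|s| <= `|T| & f (y + T *: ed a) - f y = T * pd a f (y + s *: ed a).
Proof.
move=> df; pose h (t : R) := f (y + t *: ed a); pose dh t := pd a f (y + t *: ed a).
have dhP (t : R) : `|t| <= `|T| -> is_derive t 1 h (dh t) by move=> /df; exact: derivable_line.
have hc (p q : R) : (forall t : R, t \in `[p, q] -> `|t| <= `|T|) ->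
    {within `[p, q], continuous h}.
  by move=> pq; apply: derivable_within_continuous => t /pq /dhP [].
have -> : f y = h 0 by rewrite /h scale0r addr0.
rewrite -/(h T); have [T0|T0] := leP 0 T.
  have H0 (t : R) : t \in `[0, T] -> `|t| <= `|T|.
    by rewrite in_itv /= => /andP[t0 tT]; rewrite !ger0_norm.
  have D0 t : t \in `]0, T[ -> is_derive t 1 h (dh t).
    by move=> tT; apply: dhP; apply: H0; apply: subset_itv_oo_cc tT.
  have [s sT ->] := MVT_segment T0 D0 (hc _ _ H0).
  by exists s; [exact: H0|rewrite subr0 mulrC].
have H (t : R) : t \in `[T, 0] -> `|t| <= `|T|.
  by rewrite in_itv /= => /andP[tT t0]; rewrite !ler0_norm ?lerN2 // ltW.
have D t : t \in `]T, 0[ -> is_derive t 1 h (dh t).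
  by move=> tT; apply: dhP; apply: H; apply: subset_itv_oo_cc tT.
have [s sT E] := MVT_segment (ltW T0) D (hc _ _ H).
by exists s; [exact: H|rewrite -opprB E sub0r mulrN opprK mulrC].
Qed.

(** Change the coordinates one at a time. *)
Lemma mvt_multi f y (r : R) (w : V) :
  (forall a z, `|z - y| < r -> derivable f z (ed a)) -> `|w| < r ->
  exists2 xi : 'I_n -> V, (forall a, `|xi a - y| <= `|w|) &
    f (y + w) - f y = \sum_a w 0 a * pd a f (xi a).
Proof.
(* cut k keeps the first k coordinates of the increment w. *)
move=> df wr; pose cut k : V := \row_a (if (a < k)%N then w 0 a else 0).
have step a : exists z : V, `|z - y| <= `|w| /\
    f (y + cut a.+1) - f (y + cut a) = w 0 a * pd a f z.
  have E : y + cut a.+1 = (y + cut a) + w 0 a *: ed a.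
    rewrite -addrA; congr (_ + _); apply/rowP => b; rewrite !mxE ltnS leq_eqVlt /=.
    have [->|ba] := eqVneq b a; first by rewrite eqxx ltnn /= mulr1 add0r.
    by rewrite -[nat_of_ord b == _]/(b == a) (negbTE ba) /= mulr0 addr0.
  have B (s : R) : `|s| <= `|w 0 a| -> `|y + cut a + s *: ed a - y| <= `|w|.
    move=> sw; rewrite -(addrA y) (addrC y) addrK; apply: rV_norm_le => // b; rewrite !mxE /=.
    have [->|ba] := eqVneq b a.
      by rewrite ltnn add0r mulr1; apply: le_trans sw _; exact: rV_norm_ge.
    rewrite mulr0 addr0; case: ifP => _; last by rewrite normr0.
    exact: rV_norm_ge.
  have [|s sw fE] := @mvt_line f (y + cut a) a (w 0 a).
    by move=> s /B sw; apply: df; exact: le_lt_trans sw wr.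
  by exists (y + cut a + s *: ed a); split; [exact: B|rewrite E].
have [xi xiP] := choice step.
exists xi => [a|]; first by case: (xiP a).
transitivity (\sum_(a < n) (f (y + cut a.+1) - f (y + cut a))).
  rewrite -(big_mkord xpredT (fun k => f (y + cut k.+1) - f (y + cut k))).
  rewrite telescope_sumr //; congr (f _ - f _).
    by congr (_ + _); apply/rowP => a; rewrite mxE ltn_ord.
  by rewrite -[LHS]addr0; congr (_ + _); apply/rowP => a; rewrite !mxE.
by apply: eq_bigr => a _; case: (xiP a).
Qed.

Lemma derive_shiftE f y w v : derivable f (y + w) v ->
  is_derive y v (fun z => f (z + w)) ('D_v f (y + w)).
Proof.
move=> df.
have E : (fun h : R => h^-1 *: (((fun z : V => f (z + w)) \o shift y) (h *: v) - f (y + w))) =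
   (fun h => h^-1 *: ((f \o shift (y + w)) (h *: v) - f (y + w))).
  by apply/funext => h /=; rewrite addrA.
by apply: DeriveDef; rewrite /derivable /derive E.
Qed.

(** The mean value theorem in the direction of b for the increment of f in the
    direction of a, then in the direction of a for the derivative. *)
Lemma mixed_difference f x a b (h : R) : 0 < h ->
  (forall z, `|z - x| <= 2 * h -> derivable f z (ed b) /\ derivable (pd b f) z (ed a)) ->
  exists2 z, `|z - x| <= 2 * h &
    f (x + h *: ed b + h *: ed a) - f (x + h *: ed b) - (f (x + h *: ed a) - f x)
    = h * (h * pd a (pd b f) z).
Proof.
move=> h0 df; pose G y := f (y + h *: ed a) - f y.
have B (s t : R) : `|s| <= h -> `|t| <= h -> `|x + s *: ed b + t *: ed a - x| <= 2 * h.
  move=> sh th; rewrite -(addrA x) (addrC x) addrK (le_trans (ler_normD _ _)) //.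
  by rewrite mulr_natl mulr2n lerD // (le_trans (norm_ed _ _)).
have hh : `|h| = h by rewrite ger0_norm // ltW.
have hh' : `|h| <= h by rewrite hh.
have DG (s : R) : `|s| <= h -> is_derive (x + s *: ed b) (ed b) G
    (pd b f (x + s *: ed b + h *: ed a) - pd b f (x + s *: ed b)).
  move=> sh; have [d1 _] := df _ (B s h sh hh').
  have [|d2 _] := df (x + s *: ed b).
    by have := B s 0 sh; rewrite scale0r addr0; apply; rewrite normr0 ltW.
  have [e1 e2] := derive_shiftE d1.
  apply: DeriveDef; first exact: derivableB.
  by rewrite deriveB // e2.
have [s sh GE] : exists2 s : R, `|s| <= `|h| &
    G (x + h *: ed b) - G x = h * pd b G (x + s *: ed b).
  by apply: mvt_line => s; rewrite hh => /DG [].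
rewrite hh in sh; have [_ dG] := DG s sh; rewrite /pd dG -/(pd b f _) in GE.
have [t th tE] : exists2 t : R, `|t| <= `|h| &
    pd b f (x + s *: ed b + h *: ed a) - pd b f (x + s *: ed b) =
    h * pd a (pd b f) (x + s *: ed b + t *: ed a).
  by apply: mvt_line => t; rewrite hh => th; case: (df _ (B s t sh th)).
rewrite hh in th; exists (x + s *: ed b + t *: ed a); first exact: B.
by rewrite -tE -GE.
Qed.

Lemma nbhs_norm (P : set V) x : nbhs x P -> exists2 r : R, 0 < r & forall z, `|z - x| < r -> P z.
Proof.
move=> /nbhs_ballP [r r0 rP]; exists r => // z zr; apply: rP.
by rewrite -ball_normE /ball_ /= distrC.
Qed.

Lemma dist_half (p q1 q2 e : R) : `|q1 - p| < e / 2 -> `|q2 - p| < e / 2 ->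
  `|q1 - q2| <= e.
Proof.
rewrite !ltr_norml ler_norml => /andP[a1 a2] /andP[b1 b2].
by apply/andP; split; lra.
Qed.

(** Both mixed derivatives approximate the same second difference. *)
Lemma schwarz f x a b (r : R) : 0 < r ->
  (forall z c, `|z - x| < r -> derivable f z (ed c)) ->
  (forall z c c', `|z - x| < r -> derivable (pd c f) z (ed c')) ->
  (forall c c', {for x, continuous (pd c (pd c' f))}) ->
  pd a (pd b f) x = pd b (pd a f) x.
Proof.
move=> r0 d1 d2 c2; apply/eqP; rewrite -subr_eq0 -normr_eq0; apply/eqP.
apply/le_anti; rewrite normr_ge0 andbT; apply/ler_addgt0Pr => e e0; rewrite add0r.
have e2 : 0 < e / 2 by rewrite divr_gt0.
have H c c' : exists2 r' : R, 0 < r' & forall z, `|z - x| < r' ->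
    `|pd c (pd c' f) x - pd c (pd c' f) z| < e / 2.
  apply: nbhs_norm; have /cvgrPdist_lt := c2 c c'; exact.
have [r1 r10 H1] := H a b; have [r2 r20 H2] := H b a.
pose m := Num.min r (Num.min r1 r2); pose h := m / 3.
have m0 : 0 < m by rewrite !lt_min r0 r10.
have h0 : 0 < h by rewrite divr_gt0.
have hm z : `|z - x| <= 2 * h -> `|z - x| < m.
  by move=> /le_lt_trans; apply; rewrite /h; lra.
clearbody h.
have dd c z : `|z - x| <= 2 * h -> forall c', derivable f z (ed c) /\ derivable (pd c f) z (ed c').
  by move=> /hm; rewrite lt_min => /andP[zr _] c'; split; [exact: d1|exact: d2].
have [z1 /hm z1h E1] := @mixed_difference f x a b h h0 (fun z zh => dd b z zh a).
have [z2 /hm z2h E2] := @mixed_difference f x b a h h0 (fun z zh => dd a z zh b).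
have E : pd a (pd b f) z1 = pd b (pd a f) z2.
  have hn : h != 0 by rewrite gt_eqF.
  move: E1 E2; rewrite (addrAC x (h *: ed a)).
  move: (pd a (pd b f) z1) (pd b (pd a f) z2) => p1 p2.
  move: (f (x + h *: ed b + h *: ed a)) (f (x + h *: ed b)) (f (x + h *: ed a)) (f x).
  move=> y1 y2 y3 y4 E1 E2; have E0 : y1 - y2 - (y3 - y4) = y1 - y3 - (y2 - y4) by ring.
  by apply: (mulfI hn); apply: (mulfI hn); rewrite -E1 -E2.
move: z1h z2h; rewrite !lt_min => /and3P[_ z1r _] /and3P[_ _ z2r].
move: (H1 _ z1r) (H2 _ z2r) E.
move: (pd a (pd b f) z1) (pd b (pd a f) z2) (pd a (pd b f) x) (pd b (pd a f) x).
by move=> p1 p2 q1 q2 l1 l2 E; rewrite E in l1; exact: (dist_half l1 l2).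
Qed.

(** By mvt_multi, the increment of f is a combination of partial derivatives
    at points near phi x, which converge by continuity. *)
Lemma chain_rule f (phi : V -> V) x v (r : R) : 0 < r ->
  (forall a z, `|z - phi x| < r -> derivable f z (ed a)) ->
  (forall a, {for phi x, continuous (pd a f)}) ->
  (forall b, derivable (fun y => phi y 0 b) x v) ->
  is_derive x v (f \o phi) (\sum_b 'D_v (fun y => phi y 0 b) x * pd b f (phi x)).
Proof.
move=> r0 df cf dphi.
have dP : derivable phi x v.
  by apply/derivable_mxP => i j; rewrite (ord1 i).
have cw : (fun h : R => phi (h *: v + x)) @ 0 --> phi x.
  have /derivable1P /derivable1_diffP /differentiable_continuous := dP.
  by rewrite /continuous_at /prop_for /= scale0r add0r.
pose w (h : R) := phi (h *: v + x) - phi x.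
have wr : forall e : R, 0 < e -> \forall h \near (0 : R), `|w h| < e.
  move=> e e0; have /cvgrPdist_lt /(_ e e0) := cw.
  by apply: filterS => h; rewrite distrC.
have step (h : R) : exists y : 'I_n -> V, `|w h| < r ->
    (forall a, `|y a - phi x| <= `|w h|) /\
    f (phi x + w h) - f (phi x) = \sum_a w h 0 a * pd a f (y a).
  have [whr|_] := boolP (`|w h| < r); last by exists (fun=> 0).
  by have [y y1 y2] := mvt_multi df whr; exists y.
have [xi xiP] := choice step.
have L : (fun h : R => h^-1 *: ((f \o phi \o shift x) (h *: v) - (f \o phi) x)) @ 0^' -->
    \sum_b 'D_v (fun y => phi y 0 b) x * pd b f (phi x).
  apply: (@cvg_trans _ ((fun h => \sum_b (h^-1 *: (w h 0 b)) * pd b f (xi h b)) @ 0^')).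
    apply: near_eq_cvg; apply: cvg_within; near=> h.
    have whr : `|w h| < r by near: h; exact: wr.
    have [_] := xiP h whr.
    have -> : phi x + w h = phi (h *: v + x) by rewrite /w addrC subrK.
    move=> E; rewrite /= E scaler_sumr; apply: eq_bigr => b _.
    by rewrite scalerAl.
  apply: cvg_big => [|b _]; first exact: add_continuous.
  apply: cvgM.
    rewrite (_ : (fun h => _) = (fun h => h^-1 *: (((fun y => phi y 0 b) \o shift x) (h *: v)
      - phi x 0 b))); first exact: dphi.
    by apply/funext => h; rewrite /w !mxE.
  apply: (@cvg_comp _ _ _ (fun h => xi h b) (pd b f) _ (nbhs (phi x))); last exact: cf.
  apply: cvg_within_filter; apply/cvgrPdist_lt => e e0; near=> h.
  have whr : `|w h| < r by near: h; exact: wr.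
  have [H _] := xiP h whr; rewrite distrC; apply: le_lt_trans (H b) _.
  by near: h; exact: wr.
by apply: DeriveDef; [apply/cvg_ex; exists (\sum_b 'D_v (fun y => phi y 0 b) x * pd b f (phi x))|exact: cvg_lim].
Unshelve. all: by end_near. Qed.

End MeanValue.

Section Smooth.
Variables (R : realType) (n : nat) (U : set 'rV[R]_n).
Hypothesis oU : open U.
Local Notation V := 'rV[R]_n.
Implicit Types (f g : V -> R) (x : V) (a b : 'I_n) (k : nat).
Local Notation ed a := (delta_mx 0 a : V).

Lemma near_U x : U x -> \forall y \near x, U y.
Proof. by move=> Ux; apply: open_nbhs_nbhs; split. Qed.

Lemma near_eqU f g x : (forall y, U y -> f y = g y) -> U x -> {near x, f =1 g}.
Proof. by move=> fg /near_U; apply: filterS. Qed.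

Lemma pd_ext f g a x : (forall y, U y -> f y = g y) -> U x -> pd a f x = pd a g x.
Proof. by move=> fg Ux; apply: near_eq_derive; exact: near_eqU. Qed.

Lemma Ck_ext k f g : (forall y, U y -> f y = g y) -> Ck k U f -> Ck k U g.
Proof.
elim: k f g => [|k IH] f g fg [cf H]; split.
- move=> x Ux; rewrite /prop_for /continuous_at -(fg _ Ux).
  exact: cvg_trans (near_eq_cvg (near_eqU fg Ux)) (cf x Ux).
- by [].
- move=> x Ux; rewrite /prop_for /continuous_at -(fg _ Ux).
  exact: cvg_trans (near_eq_cvg (near_eqU fg Ux)) (cf x Ux).
- move=> a; have [df pf] := H a; split=> [x Ux|].
    exact: near_eq_derivable (near_eqU fg Ux) (df x Ux).
  by apply: IH pf => y Uy; exact: pd_ext.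
Qed.

Lemma CkS k f : Ck k.+1 U f -> Ck k U f.
Proof.
elim: k f => [|k IH] f [cf H]; split=> // a; have [df pf] := H a.
by split=> //; exact: IH.
Qed.

Lemma pd_cst (r : R) a : pd a (fun _ : V => r) = fun=> 0.
Proof. by apply/funext => x; exact: derive_cst. Qed.

Lemma Ck_cst k (r : R) : Ck k U (fun=> r).
Proof.
have H (r' : R) x : {for x, continuous (fun _ : V => r')} by exact: cst_continuous.
elim: k r => [|k IH] r; split=> //.
move=> a; split=> [x _|]; first exact: derivable_cst.
by rewrite pd_cst; exact: IH.
Qed.

Lemma CkD k f g : Ck k U f -> Ck k U g -> Ck k U (fun x => f x + g x).
Proof.
elim: k f g => [|k IH] f g [cf Hf] [cg Hg]; split=> //; try
  (by move=> x Ux; apply: continuousD; [exact: cf|exact: cg]).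
move=> a; have [df pf] := Hf a; have [dg pg] := Hg a; split=> [x Ux|].
  by apply: derivableD; [exact: df|exact: dg].
apply: (@Ck_ext k (fun x => pd a f x + pd a g x)) => [x Ux|]; last exact: IH.
by rewrite [RHS]/pd deriveD //; [exact: df|exact: dg].
Qed.

Lemma CkM k f g : Ck k U f -> Ck k U g -> Ck k U (fun x => f x * g x).
Proof.
elim: k f g => [|k IH] f g Cf Cg; have [cf Hf] := Cf; have [cg Hg] := Cg; split=> //; try
  (by move=> x Ux; apply: continuousM; [exact: cf|exact: cg]).
move=> a; have [df pf] := Hf a; have [dg pg] := Hg a; split=> [x Ux|].
  by apply: derivableM; [exact: df|exact: dg].
apply: (@Ck_ext k (fun x => f x * pd a g x + g x * pd a f x)) => [x Ux|].
  by rewrite [RHS]/pd deriveM //; [exact: df|exact: dg].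
by apply: CkD; apply: IH => //; exact: CkS.
Qed.

(** By induction on k, since the derivative of an inverse involves the inverse
    itself, one order lower. *)
Lemma CkV k f : (forall x, U x -> f x != 0) -> Ck k U f -> Ck k U (fun x => (f x)^-1).
Proof.
elim: k f => [|k IH] f f0 Cf; have [cf Hf] := Cf; split=> //; try
  (by move=> x Ux; apply: continuousV; [exact: f0|exact: cf]).
move=> a; have [df pf] := Hf a; split=> [x Ux|].
  by apply: derivableV; [exact: f0|exact: df].
apply: (@Ck_ext k (fun x => (-1 * ((f x)^-1 * (f x)^-1)) * pd a f x)) => [x Ux|].
  rewrite [RHS]/pd deriveV ?f0 //; last exact: df.
  by rewrite mulN1r -expr2 exprVn.
have CV : Ck k U (fun x => (f x)^-1) by apply: IH => //; exact: CkS.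
by apply: CkM => //; apply: CkM; [exact: Ck_cst|exact: CkM].
Qed.

Lemma smooth_ext f g : (forall y, U y -> f y = g y) -> smooth_on U f -> smooth_on U g.
Proof. by move=> fg sf k; exact: Ck_ext (sf k). Qed.
Lemma smooth_cst (r : R) : smooth_on U (fun=> r).
Proof. by move=> k; exact: Ck_cst. Qed.
Lemma smoothD f g : smooth_on U f -> smooth_on U g -> smooth_on U (fun x => f x + g x).
Proof. by move=> sf sg k; apply: CkD. Qed.
Lemma smoothM f g : smooth_on U f -> smooth_on U g -> smooth_on U (fun x => f x * g x).
Proof. by move=> sf sg k; apply: CkM. Qed.
Lemma smoothV f : (forall x, U x -> f x != 0) -> smooth_on U f ->
  smooth_on U (fun x => (f x)^-1).
Proof. by move=> f0 sf k; apply: CkV. Qed.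
Lemma smoothN f : smooth_on U f -> smooth_on U (fun x => - f x).
Proof.
move=> sf; apply: (@smooth_ext (fun x => (-1) * f x)) => [x _|]; first by rewrite mulN1r.
by apply: smoothM => //; exact: smooth_cst.
Qed.
Lemma smooth_sum (J : Type) (r : seq J) (P : pred J) (F : J -> V -> R) :
  (forall j, smooth_on U (F j)) -> smooth_on U (fun x => \sum_(j <- r | P j) F j x).
Proof.
move=> sF; elim: r => [|j r IH].
  by apply: smooth_ext (smooth_cst 0) => x _; rewrite big_nil.
case Pj : (P j); last by apply: smooth_ext IH => x _; rewrite big_cons Pj.
by apply: smooth_ext (smoothD (sF j) IH) => x _; rewrite big_cons Pj.
Qed.
Lemma smooth_prod (J : Type) (r : seq J) (P : pred J) (F : J -> V -> R) :
  (forall j, smooth_on U (F j)) -> smooth_on U (fun x => \prod_(j <- r | P j) F j x).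
Proof.
move=> sF; elim: r => [|j r IH].
  by apply: smooth_ext (smooth_cst 1) => x _; rewrite big_nil.
case Pj : (P j); last by apply: smooth_ext IH => x _; rewrite big_cons Pj.
by apply: smooth_ext (smoothM (sF j) IH) => x _; rewrite big_cons Pj.
Qed.
Lemma smooth_pd f a : smooth_on U f -> smooth_on U (pd a f).
Proof. by move=> sf k; have [_ /(_ a) []] := sf k.+1. Qed.
Lemma smooth_derivable f a x : smooth_on U f -> U x -> derivable f x (ed a).
Proof. by move=> sf Ux; have [_ /(_ a) [H _]] := sf 1%N; exact: H. Qed.
Lemma smooth_cont f x : smooth_on U f -> U x -> {for x, continuous f}.
Proof. by move=> sf Ux; have [H _] := sf 0%N; exact: H. Qed.

Lemma pdD f g a x : smooth_on U f -> smooth_on U g -> U x ->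
  pd a (fun y => f y + g y) x = pd a f x + pd a g x.
Proof. by move=> sf sg Ux; rewrite /pd deriveD //; exact: smooth_derivable. Qed.
Lemma pdM f g a x : smooth_on U f -> smooth_on U g -> U x ->
  pd a (fun y => f y * g y) x = pd a f x * g x + f x * pd a g x.
Proof.
move=> sf sg Ux; rewrite {1}/pd deriveM; try exact: smooth_derivable.
by rewrite addrC /GRing.scale /= mulrC.
Qed.

Lemma ball_U x : U x -> exists2 r : R, 0 < r & forall z, `|z - x| < r -> U z.
Proof. by move=> /near_U /nbhs_norm. Qed.

Lemma pdC f a b x : smooth_on U f -> U x -> pd a (pd b f) x = pd b (pd a f) x.
Proof.
move=> sf Ux; have [r r0 rU] := ball_U Ux; apply: (@schwarz R n f x a b r r0).
- by move=> z c /rU; exact: smooth_derivable.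
- by move=> z c c' /rU; apply: smooth_derivable; exact: smooth_pd.
- by move=> c c'; apply: smooth_cont => //; do 2 apply: smooth_pd.
Qed.

End Smooth.

Lemma pd_comp (R : realType) n (U W : set 'rV[R]_n) f (phi : 'rV[R]_n -> 'rV[R]_n) x c :
  open W -> smooth_on W f -> W (phi x) -> open U -> U x ->
  (forall b, smooth_on U (fun y => phi y 0 b)) ->
  is_derive x (delta_mx 0 c) (f \o phi)
   (\sum_b pd c (fun y => phi y 0 b) x * pd b f (phi x)).
Proof.
move=> oW sf Wp oU Ux sphi; have [r r0 rW] := ball_U oW Wp.
apply: (@chain_rule R n f phi x (delta_mx 0 c) r r0) => [a z /rW|a|b].
- exact: smooth_derivable.
- by apply: (smooth_cont _ Wp); exact: smooth_pd.
- exact: smooth_derivable.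
Qed.

(** * The brackets and obstructions in terms of forms *)

Lemma altern_rcons (A : comPzRingType) n (F : form A n) p s : altern F ->
  F (s ++ [:: p]) = (-1) ^+ size s * F (p :: s).
Proof.
elim: s F => [|b s IH] F aF; first by rewrite mul1r.
rewrite [F _](_ : _ = ctr b F (s ++ [:: p])) // IH; last exact: altern_ctr.
by rewrite /ctr (aF [::] b p s) exprS mulN1r mulNr mulrN.
Qed.

(** Moving two indices past all others is an even permutation. *)
Lemma altern_last2 (A : comPzRingType) n (F : form A n) p q s : altern F ->
  F (s ++ [:: p; q]) = F (p :: q :: s).
Proof.
move=> aF; rewrite (catA s [:: p] [:: q]) altern_rcons // size_cat addn1.
by rewrite -cat_cons altern_rcons // mulrA -expr2 sqrr_sign mul1r.
Qed.

Section Pointwise.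
Variables (R : realType) (n : nat) (M : manifold R n) (g : field M).
Variables (i : chart M) (x : 'rV[R]_n).
Local Notation form := (form R n).
Local Notation covec := (covec R n).
Implicit Types (b c d p q : 'I_n) (s : seq 'I_n) (F : form).
Let gg : 'I_n -> covec := fun a b => g i x [:: a; b].
Let gi : 'I_n -> covec := ginv g i x.
Hypothesis gP : metric_pair gg gi.
Local Notation up := (up gi).
Local Notation ctrv := (ctrv gi).

Lemma rais_swap (f h : covec) : \sum_p rais gi f p * h p = \sum_p f p * rais gi h p.
Proof.
rewrite /rais; under eq_bigr do rewrite mulr_suml.
rewrite exchange_big; apply: eq_bigr => p _; rewrite mulr_sumr.
by apply: eq_bigr => q _; rewrite (gi_sym gP q p); ring.
Qed.

Lemma sum_rais_ctr (v : covec) F s : \sum_p rais gi v p * F (p :: s) = ctrv v F s.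
Proof.
rewrite (rais_swap v (fun p => F (p :: s))) ctrvE form_sum; apply: eq_bigr => p _.
by rewrite formZ upE form_sum.
Qed.

(** Contraction of a 2-tensor with the first two indices of a form, and
    alternated product with a form. *)
Definition ctrS (S : 'I_n -> covec) F : form := \sum_p ctrv (S p) (up p F).
Definition wdgS (S : 'I_n -> covec) F : form := \sum_y wedge (dl R y) (wedge (S y) F).

Lemma ctr2_raised (S : 'I_n -> covec) F s :
  \sum_p \sum_q rais gi (fun p' => rais gi (S p') q) p * F (p :: q :: s) = ctrS S F s.
Proof.
rewrite exchange_big.
under eq_bigr => q _ do rewrite (rais_swap (fun p' => rais gi (S p') q) (fun p => F (p :: q :: s))).
rewrite exchange_big /ctrS form_sum; apply: eq_bigr => p _ /=.
rewrite -sum_rais_ctr; apply: eq_bigr => q _; congr (_ * _).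
by rewrite upE form_sum; apply: eq_bigr => a _.
Qed.

Variables (k : nat) (sigma tau : field M -> field M).
Variables (F : form) (T : 'I_n -> form) (S : 'I_n -> covec).
Hypothesis aF : altern F.
Hypothesis aT : forall c, altern (T c).
Hypothesis tauF : forall s, size s = k -> tau g i x s = F s.
Hypothesis nabT : forall c s, size s = k -> nabla g (tau g) i x c s = T c s.
Hypothesis nabS : forall c a, nabla g (sigma g) i x c [:: a] = S c a.
Let sg : covec := fun a => sigma g i x [:: a].

(** The pair p q moves to the front without a sign; the divergence comes from
    contracting the other index of the pair, whence the sign. *)
Lemma tau_overE s : (size s).+2 = k -> tau_over k sigma tau g i x s =
  (- 2%:R *: ctrv sg (\sum_q up q (T q)) + (n%:R - k%:R + 1) *: ctrS S F) s.
Proof.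
move=> sk; have sz p q : size (s ++ [:: p; q]) = k by rewrite size_cat addn2.
rewrite /tau_over formD !formZ mulNr -mulrN; congr (2 * _ + _ * _).
  rewrite (_ : - _ = ctrv sg (- \sum_q up q (T q)) s); last by rewrite ctrvNr formN.
  rewrite -sum_rais_ctr; apply: eq_bigr => p _; rewrite formN form_sum -sumrN.
  rewrite -mulr_sumr; congr (_ * _).
  transitivity (\sum_q \sum_r gi q r * T r (p :: q :: s)).
    apply: eq_bigr => q _; apply: eq_bigr => r _.
    by rewrite nabT // altern_last2.
  rewrite exchange_big; apply: eq_bigr => r _ /=.
  rewrite upE form_sum -sumrN; apply: eq_bigr => q _.
  by rewrite formZ /ctr (aT r [::] q p s) mulrN opprK (gi_sym gP).
rewrite -(ctr2_raised S F s); apply: eq_bigr => p _; apply: eq_bigr => q _.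
rewrite tauF // altern_last2 //; congr (_ * _).
by apply: eq_bigr => p' _; congr (_ * _); apply: eq_bigr => q' _; rewrite nabS.
Qed.

(** The two last indices are moved to the front and expanded there by alt_rec,
    which gives the normalising constants. *)
Lemma tau_underE s : size s = k.+2 -> tau_under k sigma tau g i x s =
  (k.+2%:R^-1 * k.+1%:R^-1) * (2%:R *: wedge sg (\sum_z wedge (dl R z) (T z))
    + k.+1%:R *: wdgS S F) s.
Proof.
move=> sk; rewrite /tau_under.
pose T' : form := fun u => if u is y :: z :: a then
  2%:R * (sg y * T z a) + k.+1%:R * (S y z * F a) else 0.
transitivity (alt (fun t => T' (rot k t)) s).
  apply: (alt_ext _ sk) => t tk; rewrite /rot.
  have := size_drop k t; rewrite tk subSn // subSnn.
  case: (drop k t) => [|y [|z []]] //= _; rewrite nabT ?tauF ?nabS //.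
    by rewrite size_takel // tk leqW.
  by rewrite size_takel // tk leqW.
rewrite alt_rot2 // (alt_rec T' sk) -mulrA; congr (_ * _).
have E y : forall t, size t = k.+1 -> alt (ctr y T') t = (k.+1%:R^-1 *:
   \sum_z wedge (dl R z) ((2%:R * sg y) *: T z + (k.+1%:R * S y z) *: F)) t.
  move=> t tk; rewrite (alt_rec (ctr y T') tk) formZ form_sum; congr (_ * _).
  apply: eq_bigr => z _; apply: (wedge_ext (m := k)) => // u uk.
  rewrite -(alt_id (F := (2%:R * sg y) *: T z + (k.+1%:R * S y z) *: F) _ uk).
    apply: (alt_ext _ uk) => w _; rewrite /ctr /T' formD !formZ.
    by rewrite !mulrA.
  by apply: alternD; apply: alternZ.
under eq_bigr => y _ do rewrite (wedge_ext _ (E y) sk) wedgeZ formZ.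
rewrite -mulr_sumr; congr (_ * _).
pose H : form := \sum_y wedge (dl R y) (\sum_z wedge (dl R z) ((2%:R * sg y) *: T z +
  (k.+1%:R * S y z) *: F)).
transitivity (H s); first by rewrite /H form_sum.
congr ((_ : form) s); rewrite /H.
under eq_bigr => y _.
  under eq_bigr => z _ do rewrite wedgeDr !wedgeZ -!scalerA.
  rewrite big_split -!scaler_sumr /= wedgeDr !wedgeZ. over.
rewrite big_split -scaler_sumr /=; congr (_ *: _ + _).
  by rewrite (wedge_dl sg).
by rewrite /wdgS -scaler_sumr; congr (_ *: _); apply: eq_bigr => y _; rewrite (wedge_dl (S y)).
Qed.

Variable C : 'I_n -> 'I_n -> 'I_n -> covec.
Hypothesis weylC : forall a b c d, weyl g i x a b c d = C a b c d.
Hypothesis C34 : forall a b c d, C a b c d = - C a b d c.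

Definition weyl_overP c : form := (n%:R - k%:R + 1) *:
    \sum_r rais gi sg r *: \sum_p \sum_q C r c p q *: up q (up p F)
  + \sum_p \sum_q wedge (fun b => C c b p q) (ctrv sg (up q (up p F))).

Lemma rais2_swap (h : 'I_n -> covec) (f : 'I_n -> 'I_n -> R) :
  \sum_p \sum_q rais gi (fun p' => rais gi (h p') q) p * f p q =
  \sum_p \sum_q h p q * \sum_q' gi q q' * \sum_p' gi p p' * f p' q'.
Proof.
transitivity (\sum_q \sum_p rais gi (h p) q * \sum_p' gi p p' * f p' q).
  by rewrite exchange_big; apply: eq_bigr => q _; exact: rais_swap.
rewrite exchange_big; apply: eq_bigr => p _.
exact: (rais_swap (h p) (fun q => \sum_p' gi p p' * f p' q)).
Qed.

Lemma ctr2_raisedE (h : 'I_n -> covec) G s :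
  \sum_p \sum_q rais gi (fun p' => rais gi (h p') q) p * G (p :: q :: s) =
  \sum_p \sum_q h p q * up q (up p G) s.
Proof.
rewrite rais2_swap; apply: eq_bigr => p _; apply: eq_bigr => q _; congr (_ * _).
rewrite upE form_sum; apply: eq_bigr => q' _; rewrite formZ /ctr; congr (_ * _).
by rewrite upE form_sum; apply: eq_bigr => p' _; rewrite formZ.
Qed.

Lemma weyl_overE m c s : size s = m.+1 -> k = m.+3 ->
  weyl_over k sigma tau g i x c s = weyl_overP c s.
Proof.
move=> sm km; rewrite /weyl_over.
pose A1 : form := \sum_r rais gi sg r *: \sum_p \sum_q C r c p q *: up q (up p F).
pose B p q : form := ctrv sg (up q (up p F)).
have aU p q : altern (up q (up p F)) by do 2! apply: altern_up.
have aB p q : altern (B p q) by apply: altern_ctrv; exact: aU.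
pose T2 : form := \sum_p \sum_q (fun u => if u is b :: u' then C c b p q * B p q u' else 0 : R).
transitivity (alt ((n%:R - k%:R + 1) *: A1 + (k%:R - 2%:R) *: T2 : form) s).
  apply: (alt_ext _ sm) => t tm; have tk : (size t).+2 = k by rewrite tm km.
  rewrite formD !formZ; congr (_ * _ + _ * _).
    transitivity (\sum_p \sum_q \sum_r
      (rais gi (fun r' => rais gi (fun p' => rais gi (C r' c p') q) p) r * sg r) * F (p :: q :: t)).
      apply: eq_bigr => p _; apply: eq_bigr => q _; apply: eq_bigr => r _.
      rewrite tauF ?size_cat ?addn2 // altern_last2 // mulrAC; congr (_ * _ * _).
      apply: eq_bigr => r' _; congr (_ * _); apply: eq_bigr => p' _; congr (_ * _).
      by apply: eq_bigr => q' _; rewrite weylC.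
    rewrite /A1 form_sum.
    transitivity (\sum_r rais gi sg r * \sum_p \sum_q C r c p q * up q (up p F) t); last first.
      apply: eq_bigr => r _; rewrite formZ form_sum; congr (_ * _); apply: eq_bigr => p _.
      by rewrite form_sum.
    under [RHS]eq_bigr => r _ do rewrite -(ctr2_raisedE (C r c)).
    rewrite (eq_bigr (fun p => \sum_q \sum_r rais gi sg r * (rais gi (fun p' => rais gi (C r c p') q) p * F (p :: q :: t)))).
      under eq_bigr do rewrite exchange_big.
      rewrite exchange_big; apply: eq_bigr => r _; rewrite mulr_sumr; apply: eq_bigr => p _.
      by rewrite mulr_sumr.
    move=> p _; apply: eq_bigr => q _; rewrite -mulr_suml rais_swap mulr_suml.
    by apply: eq_bigr => r _; rewrite mulrA [_ * rais gi sg r]mulrC.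
  case: t tm tk => [//|b t] [tm] tk; rewrite /T2 form_sum.
  under [RHS]eq_bigr do rewrite form_sum.
  transitivity (\sum_p \sum_q rais gi (fun p' => rais gi (C c b p') q) p * ctrv sg (ctr q (ctr p F)) t).
    apply: eq_bigr => p _; apply: eq_bigr => q _; rewrite -sum_rais_ctr mulr_sumr.
    apply: eq_bigr => r _; rewrite tauF; last by rewrite /= size_cat addn2 tm km.
    rewrite -mulrA [F _ * _]mulrC; congr (_ * (_ * _)).
      by apply: eq_bigr => p' _; congr (_ * _); apply: eq_bigr => q' _; rewrite weylC.
    by rewrite -[F _]/(ctr p F (t ++ [:: q; r])) altern_last2 //; exact: altern_ctr.
  rewrite (rais2_swap (C c b) (fun p q => ctrv sg (ctr q (ctr p F)) t)).
  apply: eq_bigr => p _; apply: eq_bigr => q _; congr (_ * _).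
  rewrite /B upE (linear_sum (ctrv sg)) form_sum; apply: eq_bigr => q' _ /=.
  rewrite ctrvZr formZ upE (linear_sum (ctr q')) (linear_sum (ctrv sg)) form_sum; congr (_ * _).
  by apply: eq_bigr => p' _ /=; rewrite ctrZ ctrvZr formZ.
rewrite -[_ *: T2]addr0 !altP_lin [X in _ + (_ + X)](_ : _ = 0); last first.
  by rewrite (alt_id _ sm) //; exact: altern0.
rewrite addr0 /weyl_overP formD formZ; congr (_ + _).
  congr (_ * _); apply: (alt_id _ sm); apply: altern_sum => r; apply: alternZ.
  by do 2! (apply: altern_sum => ?); apply: alternZ; exact: aU.
rewrite /T2 alt_sum form_sum mulr_sumr; apply: eq_bigr => p _.
rewrite alt_sum form_sum mulr_sumr; apply: eq_bigr => q _.
rewrite (alt_cov (fun b => C c b p q) sm (aB p q)) mulrA.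
by rewrite km -natrB // subSS subn1 /= divff ?mul1r // pnatr_eq0.
Qed.

Definition weyl_underP c : form :=
  - 2%:R *: wedge sg (\sum_y wedge (dl R y) (\sum_p wedge (C c y p) (up p F)))
  + k%:R *: \sum_e rais gi sg e *: \sum_y wedge (dl R y) (wedge (C e c y) F).

Lemma weyl_underE m c s : size s = m.+3 -> k = m.+1 ->
  weyl_under k sigma tau g i x c s =
  - (k.+2%:R^-1 * (k.+1%:R^-1 * k%:R^-1)) * weyl_underP c s.
Proof.
move=> sm km; have sk : size s = k.+2 by rewrite sm km.
rewrite /weyl_under.
pose T1 : form := fun u => if u is y :: z :: b :: a then
  \sum_p C c y b p * up p F a * sg z else 0.
pose T2 : form := fun u => if u is y :: z :: a then
  \sum_p C p c y z * rais gi sg p * F a else 0.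
transitivity (alt (fun t => (2%:R *: T1 + - 1 *: T2) (rot k t)) s).
  apply: (alt_ext _ sk) => t tk; rewrite /rot formD !formZ mulN1r.
  have := size_drop k t; rewrite tk subSn // subSnn.
  have : size (take k t) = k by rewrite size_takel // tk leqW.
  case: (drop k t) => [|y [|z []]] //= tk1 _.
  case: (take k t) tk1 => [|b a] /=; first by rewrite km.
  move=> ak; congr (2 * _ - _).
    transitivity (\sum_p rais gi (C c y b) p * (F (p :: a) * sg z)).
      apply: eq_bigr => p _; rewrite tauF //= mulrA; congr (_ * _ * _).
      by apply: eq_bigr => p' _; rewrite weylC.
    rewrite rais_swap; apply: eq_bigr => p _.
    rewrite -mulrA upE form_sum mulr_suml; congr (_ * _); apply: eq_bigr => q _.
    by rewrite formZ /ctr mulrA.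
  transitivity (\sum_p rais gi (fun p' => C p' c y z) p * (F (b :: a) * sg p)).
    apply: eq_bigr => p _; rewrite tauF //= mulrA; congr (_ * _ * _).
    by apply: eq_bigr => p' _; rewrite weylC.
  rewrite rais_swap; apply: eq_bigr => p _; rewrite -mulrA; congr (_ * _).
  by rewrite /rais mulr_suml; apply: eq_bigr => q _; rewrite mulrA mulrAC.
rewrite (alt_rot2 (2%:R *: T1 + - 1 *: T2) sk) -[_ *: T2]addr0 !altP_lin.
rewrite [X in _ + (_ + X)](_ : _ = 0); last by rewrite (alt_id _ sk) //; exact: altern0.
have L (T' : form) (G : 'I_n -> 'I_n -> form) (r : R) :
    (forall y z t, size t = k -> alt (ctr z (ctr y T')) t = r * G y z t) ->
    alt T' s = k.+2%:R^-1 * (k.+1%:R^-1 * r) *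
      (\sum_y wedge (dl R y) (\sum_z wedge (dl R z) (G y z))) s.
  move=> TG; rewrite (alt_rec T' sk) -mulrA; congr (_ * _); rewrite form_sum mulr_sumr.
  apply: eq_bigr => y _.
  transitivity (wedge (dl R y) ((k.+1%:R^-1 * r) *: \sum_z wedge (dl R z) (G y z)) s); last first.
    by rewrite wedgeZ formZ.
  apply: (wedge_ext (m := k.+1)) => // t tk; rewrite (alt_rec (ctr y T') tk) formZ form_sum -mulrA; congr (_ * _).
  rewrite mulr_sumr; apply: eq_bigr => z _; rewrite -formZ -wedgeZ.
  by apply: (wedge_ext (m := k)) => // u uk; rewrite TG // formZ.
pose G1 y z : form := sg z *: \sum_p wedge (fun b => C c y b p) (up p F).
pose G2 y z : form := (\sum_p C p c y z * rais gi sg p) *: F.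
rewrite (L T1 G1 k%:R^-1); last first.
  move=> y z t tk; rewrite km in tk *.
  transitivity (alt (\sum_p (fun u => if u is b :: a then (sg z * C c y b p) * up p F a else 0) : form) t).
    apply: (alt_ext _ tk) => -[|b a] //= _; rewrite form_sum; apply: eq_bigr => p _.
    by rewrite mulrC mulrA.
  rewrite alt_sum /G1 formZ form_sum !mulr_sumr; apply: eq_bigr => p _.
  rewrite (alt_cov (fun b => sg z * C c y b p) tk); last exact: altern_up.
  congr (_ * _); rewrite -formZ -wedgevZ; congr (wedge _ _ t).
rewrite (L T2 G2 1); last first.
  move=> y z t tk; rewrite mul1r -(alt_id (F := G2 y z) _ tk); last exact: alternZ.
  by apply: (alt_ext _ tk) => u _; rewrite /ctr /T2 /G2 formZ mulr_suml.
have -> : \sum_y wedge (dl R y) (\sum_z wedge (dl R z) (G1 y z)) =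
    wedge sg (\sum_y wedge (dl R y) (\sum_p wedge (C c y p) (up p F))).
  rewrite (linear_sum (wedge sg)); apply: eq_bigr => y _ /=.
  rewrite wedgeC -wedgeNr; congr (wedge _ _).
  rewrite (wedge_dl sg) -sumrN; apply: eq_bigr => z _.
  rewrite /G1 wedgeZ -scalerN -wedgeNr -sumrN; congr (_ *: wedge _ _).
  apply: eq_bigr => p _; rewrite -wedgevN; congr (wedge _ _); apply/funext => b.
  by rewrite covN C34.
have -> : \sum_y wedge (dl R y) (\sum_z wedge (dl R z) (G2 y z)) =
    \sum_e rais gi sg e *: \sum_y wedge (dl R y) (wedge (C e c y) F).
  under [RHS]eq_bigr do rewrite scaler_sumr.
  rewrite [RHS]exchange_big; apply: eq_bigr => y _ /=.
  under [RHS]eq_bigr do rewrite -wedgeZ.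
  rewrite -(linear_sum (wedge (dl R y))) /=; congr (wedge _ _).
  under [RHS]eq_bigr do rewrite wedge_dl scaler_sumr.
  rewrite [RHS]exchange_big; apply: eq_bigr => z _ /=.
  by rewrite /G2 wedgeZ scaler_suml; apply: eq_bigr => e _; rewrite scalerA mulrC.
rewrite /weyl_underP formD !formZ addr0.
have kn : (k%:R : R) != 0 by rewrite km pnatr_eq0.
move: (wedge sg _ s) ((\sum_e _) s) => z1 z2.
by move: (k.+2%:R^-1 : R) (k.+1%:R^-1 : R) => r1 r2; field.
Qed.

End Pointwise.

(** * The ring of smooth functions on an open set *)

(** The openness proof is bundled so that the ring structure on smooth
    functions can be inferred from the domain. *)
Record opens (R : realType) (n : nat) := Opens {
  oset :> set 'rV[R]_n; osetP : open oset }.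
Definition in_opens (R : realType) (n : nat) (U : opens R n) (x : 'rV[R]_n) : Prop :=
  oset U x.
Coercion in_opens : opens >-> Funclass.

(** Functions vanish outside U, so that equality on U is equality. *)
Record smf (R : realType) (n : nat) (U : opens R n) := Smf {
  sfun :> 'rV[R]_n -> R;
  smfP : smooth_on U sfun /\ forall x, ~ U x -> sfun x = 0 }.

HB.instance Definition _ (R : realType) n (U : opens R n) := gen_eqMixin (smf U).
HB.instance Definition _ (R : realType) n (U : opens R n) := gen_choiceMixin (smf U).

Section SmoothRing.
Variables (R : realType) (n : nat) (U : opens R n).
Implicit Types (f g h : smf U) (x : 'rV[R]_n) (a b : 'I_n).

Lemma smf_ext f g : (forall x, U x -> f x = g x) -> f = g.
Proof.
case: f g => f [sf f0] [g [sg g0]] /= fg.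
have E : f = g.
  by apply/funext => x; have [/fg//|Ux] := pselect (U x); rewrite f0 // g0.
by move: sf f0; rewrite E => sf f0; congr Smf; exact: Prop_irrelevance.
Qed.

Definition cutoff (f : 'rV[R]_n -> R) x := if `[< U x >] then f x else 0.

Lemma cutoffE (f : 'rV[R]_n -> R) x : U x -> cutoff f x = f x.
Proof. by move=> Ux; rewrite /cutoff asboolT. Qed.

Lemma cutoffP (f : 'rV[R]_n -> R) : smooth_on U f ->
  smooth_on U (cutoff f) /\ forall x, ~ U x -> cutoff f x = 0.
Proof.
move=> sf; split; last by move=> x Ux; rewrite /cutoff asboolF.
by apply: smooth_ext sf => [|y Uy]; [exact: osetP|rewrite cutoffE].
Qed.

Definition mk (f : 'rV[R]_n -> R) (sf : smooth_on U f) : smf U := Smf (cutoffP sf).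

Lemma mkE (f : 'rV[R]_n -> R) (sf : smooth_on U f) x : U x -> mk sf x = f x.
Proof. exact: cutoffE. Qed.

Lemma smooth_smf f : smooth_on U f. Proof. by case: (smfP f). Qed.

Definition smf_cst (r : R) : smf U := mk (smooth_cst U r).
Definition smf_add f g := mk (smoothD (@osetP _ _ U) (smooth_smf f) (smooth_smf g)).
Definition smf_opp f := mk (smoothN (@osetP _ _ U) (smooth_smf f)).
Definition smf_mul f g := mk (smoothM (@osetP _ _ U) (smooth_smf f) (smooth_smf g)).

Let addA : associative smf_add.
Proof. by move=> f g h; apply: smf_ext => x Ux; rewrite !mkE // addrA. Qed.
Let addC : commutative smf_add.
Proof. by move=> f g; apply: smf_ext => x Ux; rewrite !mkE // addrC. Qed.
Let add0 : left_id (smf_cst 0) smf_add.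
Proof. by move=> f; apply: smf_ext => x Ux; rewrite !mkE // add0r. Qed.
Let addN : left_inverse (smf_cst 0) smf_opp smf_add.
Proof. by move=> f; apply: smf_ext => x Ux; rewrite !mkE // addNr. Qed.
Let mulA : associative smf_mul.
Proof. by move=> f g h; apply: smf_ext => x Ux; rewrite !mkE // mulrA. Qed.
Let mulC : commutative smf_mul.
Proof. by move=> f g; apply: smf_ext => x Ux; rewrite !mkE // mulrC. Qed.
Let mul1 : left_id (smf_cst 1) smf_mul.
Proof. by move=> f; apply: smf_ext => x Ux; rewrite !mkE // mul1r. Qed.
Let mulD : left_distributive smf_mul smf_add.
Proof. by move=> f g h; apply: smf_ext => x Ux; rewrite !mkE // mulrDl. Qed.

HB.instance Definition _ := GRing.isZmodule.Build (smf U) addA addC add0 addN.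
HB.instance Definition _ := GRing.Zmodule_isComPzRing.Build (smf U) mulA mulC mul1 mulD.

Definition ev x (Ux : U x) f : R := f x.
Section Ev.
Variables (x : 'rV[R]_n) (Ux : U x).
Lemma ev_additive : zmod_morphism (ev Ux).
Proof. by move=> f g; rewrite /ev mkE // mkE. Qed.
Lemma ev_monoid : monoid_morphism (ev Ux).
Proof. by split=> [|f g]; rewrite /ev mkE. Qed.
HB.instance Definition _ := GRing.isZmodMorphism.Build (smf U) R (ev Ux) ev_additive.
HB.instance Definition _ := GRing.isMonoidMorphism.Build (smf U) R (ev Ux) ev_monoid.
Lemma ev_cst r : ev Ux (smf_cst r) = r. Proof. exact: mkE. Qed.
End Ev.

Lemma ev_ext f g : (forall x (Ux : U x), ev Ux f = ev Ux g) -> f = g.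
Proof. by move=> fg; apply: smf_ext => x Ux; exact: (fg x Ux). Qed.

Definition Dsm a f : smf U := mk (smooth_pd a (smooth_smf f)).

Lemma ev_D x (Ux : U x) a f : ev Ux (Dsm a f) = pd a f x. Proof. exact: mkE. Qed.

Lemma ev_Dmk x (Ux : U x) a (f : 'rV[R]_n -> R) (sf : smooth_on U f) :
  ev Ux (Dsm a (mk sf)) = pd a f x.
Proof.
by rewrite ev_D; apply: (pd_ext (@osetP _ _ U)) => // y Uy; rewrite mkE.
Qed.

Lemma evD x (Ux : U x) f g : ev Ux (f + g) = ev Ux f + ev Ux g.
Proof. exact: mkE. Qed.
Lemma evM x (Ux : U x) f g : ev Ux (f * g) = ev Ux f * ev Ux g.
Proof. exact: mkE. Qed.

Lemma evN x (Ux : U x) f : ev Ux (- f) = - ev Ux f.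
Proof. exact: mkE. Qed.
Lemma evB x (Ux : U x) f g : ev Ux (f - g) = ev Ux f - ev Ux g.
Proof. by rewrite evD evN. Qed.
Lemma ev_sum x (Ux : U x) (J : finType) (F : J -> smf U) :
  ev Ux (\sum_j F j) = \sum_j ev Ux (F j).
Proof. exact: rmorph_sum. Qed.

Lemma Dsm_derivations : derivations Dsm.
Proof.
have oU := @osetP _ _ U.
split.
- move=> c f g; apply: ev_ext => x Ux; rewrite evD !ev_D -(pdD c (smooth_smf f) (smooth_smf g) Ux).
  by apply: (pd_ext oU) => // y Uy; rewrite [LHS]mkE.
- move=> c f g; apply: ev_ext => x Ux; rewrite evD !evM !ev_D /ev -(pdM c (smooth_smf f) (smooth_smf g) Ux).
  by apply: (pd_ext oU) => // y Uy; rewrite [LHS]mkE.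
move=> a b f; apply: ev_ext => x Ux; rewrite !(ev_Dmk Ux).
by apply: (pdC oU) => //; exact: smooth_smf.
Qed.

Lemma smf_tfree : tfree (smf U).
Proof.
move=> m f mf; apply: ev_ext => x Ux; apply: (mulfI (x := m.+1%:R)); first by rewrite pnatr_eq0.
by rewrite -{1}(rmorph_nat (ev Ux)) -rmorphM mf !rmorph0 mulr0.
Qed.

End SmoothRing.
Arguments ev {R n U x} Ux f : simpl never.

Section MapForm.
Variables (A B : comPzRingType) (n : nat) (phi : {rmorphism A -> B}).
Implicit Types (F : form A n) (v : covec A n) (s : seq 'I_n).

(** A ring morphism, such as evaluation at a point, applied to the components
    of a form. *)
Definition mapf F : form B n := fun s => phi (F s).
Definition mapc v : covec B n := fun a => phi (v a).

Lemma mapf_ctr b F : mapf (ctr b F) = ctr b (mapf F). Proof. by []. Qed.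
Lemma mapfD F G : mapf (F + G) = mapf F + mapf G.
Proof. by apply/funext => s; exact: rmorphD. Qed.
Lemma mapfZ a F : mapf (a *: F) = phi a *: mapf F.
Proof. by apply/funext => s; exact: rmorphM. Qed.
Lemma mapf_sum (J : finType) (f : J -> form A n) :
  mapf (\sum_j f j) = \sum_j mapf (f j).
Proof.
by apply/funext => s; rewrite /mapf !form_sum rmorph_sum.
Qed.
Lemma mapf_wedge v F : mapf (wedge v F) = wedge (mapc v) (mapf F).
Proof.
apply/funext => s; elim: s F => [|b s IH] F; first by rewrite /mapf !wedge_nil rmorph0.
by rewrite /mapf !wedge_cons rmorphB rmorphM -IH.
Qed.
Lemma mapc_dl c : mapc (dl A c) = dl B c.
Proof. by apply/funext => b; rewrite /mapc /dl rmorph_nat. Qed.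

Variable gi : 'I_n -> covec A n.
Local Notation gi' := (fun a => mapc (gi a)).
Lemma mapf_up p F : mapf (up gi p F) = up gi' p (mapf F).
Proof. by rewrite !upE mapf_sum; apply: eq_bigr => a _; rewrite mapfZ mapf_ctr. Qed.
Lemma mapf_ctrv v F : mapf (ctrv gi v F) = ctrv gi' (mapc v) (mapf F).
Proof. by rewrite !ctrvE mapf_sum; apply: eq_bigr => a _; rewrite mapfZ mapf_up. Qed.
Lemma altern_mapf F : altern F -> altern (mapf F).
Proof. by move=> aF s1 b c s2; rewrite /mapf aF rmorphN. Qed.
End MapForm.

(** The form in which the correction terms of a covariant derivative are
    written out. *)
Lemma der_set_nth (A : comPzRingType) n (M : 'I_n -> covec A n) (F : form A n) s :
  der M F s = \sum_(t < size s) \sum_d M d (tnth (in_tuple s) t) * F (set_nth d s t d).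
Proof.
elim: s F => [|b s IH] F; first by rewrite der_nil big_ord0.
rewrite der_cons big_ord_recl IH; congr (_ + _); apply: eq_bigr => t _.
apply: eq_bigr => d _; rewrite /ctr; congr (M d _ * _).
by rewrite !(tnth_nth b).
Qed.

(** * Metrics in a chart *)

Lemma smooth_det (R : realType) n (U : set 'rV[R]_n) m (f : 'rV[R]_n -> 'M[R]_m) : open U ->
  (forall a b, smooth_on U (fun x => f x a b)) -> smooth_on U (fun x => \det (f x)).
Proof.
move=> oU sf; apply: smooth_sum => // s; apply: smoothM => //; first exact: smooth_cst.
by apply: smooth_prod.
Qed.

Lemma smooth_invmx (R : realType) n (U : set 'rV[R]_n) m (f : 'rV[R]_n -> 'M[R]_m) a b :
  open U -> (forall x, U x -> f x \in unitmx) ->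
  (forall a b, smooth_on U (fun x => f x a b)) -> smooth_on U (fun x => invmx (f x) a b).
Proof.
move=> oU uf sf.
apply: (@smooth_ext _ _ U oU (fun x => (\det (f x))^-1 * cofactor (f x) b a)) => [x Ux|].
  by rewrite /invmx uf // !mxE.
apply: smoothM => //; first by apply: smoothV; [| |exact: smooth_det] => // x /uf; rewrite unitmxE unitfE.
apply: smoothM => //; first exact: smooth_cst.
apply: smooth_det => // c d; apply: smooth_ext (sf (lift b c) (lift a d)) => // x _.
by rewrite !mxE.
Qed.

Section MetricFacts.
Variables (R : realType) (n : nat) (M : manifold R n) (sgn : nat) (g : field M).
Hypothesis mg : is_metric sgn g.
Variable i : chart M.

Lemma metric_smooth a b : smooth_on (chart_img i) (fun x => g i x [:: a; b]).
Proof. by have [[H _] _] := mg; exact: (H i [tuple a; b]). Qed.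

(** A diagonal matrix of signs is symmetric and invertible, and both
    properties are invariant under congruence. *)
Lemma metric_gram x : chart_img i x -> gram g i x \in unitmx /\ (gram g i x)^T = gram g i x.
Proof.
have [_ H] := mg => /H [P uP E].
have uD : diag_mx (\row_a (if (a < sgn)%N then 1 else -1)) \in @unitmx R n.
  rewrite unitmxE det_diag unitfE; apply/prodf_neq0 => a _; rewrite mxE.
  by case: ifP => _; rewrite ?oppr_eq0 oner_eq0.
split; first by move: uD; rewrite -E !unitmx_mul uP unitmx_tr uP andbT.
have uPT : P^T \in unitmx by rewrite unitmx_tr.
have E2 : P^T *m gram g i x *m P = P^T *m (gram g i x)^T *m P.
  transitivity (P^T *m gram g i x *m P)^T; first by rewrite E tr_diag_mx.
  by rewrite !trmx_mul trmxK mulmxA.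
have := congr1 (fun X => invmx P^T *m (X *m invmx P)) E2.
by rewrite !(mulmxK uP) !(mulKmx uPT).
Qed.

Lemma metric_sym x a b : chart_img i x -> g i x [:: a; b] = g i x [:: b; a].
Proof. by move=> /metric_gram [_ /matrixP /(_ b a)]; rewrite !mxE. Qed.

Lemma metric_pairR x : chart_img i x ->
  metric_pair (fun a b => g i x [:: a; b]) (ginv g i x : 'I_n -> covec R n).
Proof.
move=> ix; have [ug sg] := metric_gram ix; split.
- by move=> a b; exact: metric_sym.
- by move=> a b; rewrite /ginv -{2}sg -trmx_inv mxE.
move=> a b; rewrite /dl eq_sym.
have /matrixP /(_ a b) := mulVmx ug; rewrite !mxE => <-.
by apply: eq_bigr => c _; rewrite mxE.
Qed.

Lemma ginv_smooth a b : smooth_on (chart_img i) (fun x => ginv g i x a b).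
Proof.
apply: smooth_invmx; [exact: chart_img_open|by move=> x /metric_gram []|].
move=> c d; apply: smooth_ext (metric_smooth c d); first exact: chart_img_open.
by move=> x _; rewrite mxE.
Qed.

Lemma christoffel_smooth c a b : smooth_on (chart_img i) (fun x => christoffel g i x c a b).
Proof.
have oU : open (chart_img i) by exact: chart_img_open.
apply: smoothM => //; first exact: smooth_cst.
apply: smooth_sum => // d; apply: smoothM => //; first exact: ginv_smooth.
apply: smoothD => //; last by apply: smoothN => //; apply: smooth_pd; exact: metric_smooth.
by apply: smoothD => //; apply: smooth_pd; exact: metric_smooth.
Qed.

Lemma christoffelC x c a b : chart_img i x -> christoffel g i x c a b = christoffel g i x c b a.
Proof.
move=> ix; congr (_ * _); apply: eq_bigr => d _; congr (_ * _).
congr (_ - _); first exact: addrC.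
apply: (pd_ext (@chart_img_open _ _ M i)) ix => y iy; exact: metric_sym.
Qed.

(** The Koszul formula with the index lowered. *)
Lemma christoffel_low x c a b : chart_img i x ->
  \sum_e g i x [:: c; e] * christoffel g i x e a b = 2^-1 *
    (pd a (fun y => g i y [:: b; c]) x + pd b (fun y => g i y [:: a; c]) x
     - pd c (fun y => g i y [:: a; b]) x).
Proof.
move=> ix; have gP := metric_pairR ix.
have H (f : 'I_n -> R) : \sum_e g i x [:: c; e] * (2^-1 * \sum_d ginv g i x e d * f d) = 2^-1 * f c.
  transitivity (2^-1 * \sum_d (\sum_e g i x [:: c; e] * ginv g i x e d) * f d).
    rewrite mulr_sumr; under [RHS]eq_bigr do rewrite mulr_suml mulr_sumr.
    rewrite exchange_big; apply: eq_bigr => e _; rewrite mulrCA !mulr_sumr.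
    by apply: eq_bigr => d _; rewrite !mulrA.
  congr (_ * _); rewrite -[RHS](sum_dl (f : 'I_n -> R^o) c); apply: eq_bigr => d _.
  by rewrite (g_gi gP c d) /dl eq_sym.
exact: H.
Qed.

Lemma christoffel_compat x c a b : chart_img i x -> pd c (fun y => g i y [:: a; b]) x =
  \sum_e (christoffel g i x e c a * g i x [:: e; b] + christoffel g i x e c b * g i x [:: a; e]).
Proof.
move=> ix; rewrite big_split /=.
have -> : \sum_e christoffel g i x e c a * g i x [:: e; b] = \sum_e g i x [:: b; e] * christoffel g i x e c a.
  by apply: eq_bigr => e _; rewrite mulrC (metric_sym b).
have -> : \sum_e christoffel g i x e c b * g i x [:: a; e] = \sum_e g i x [:: a; e] * christoffel g i x e c b.
  by apply: eq_bigr => e _; rewrite mulrC.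
rewrite !christoffel_low //.
have sy d e f : pd d (fun y => g i y [:: e; f]) x = pd d (fun y => g i y [:: f; e]) x.
  by apply: (pd_ext (@chart_img_open _ _ M i)) ix => y iy; exact: metric_sym.
rewrite (sy c b a) (sy b c a) (sy a c b); by field.
Qed.
End MetricFacts.

Section Bridge.
Variables (R : realType) (n : nat) (M : manifold R n) (i : chart M).

Definition chart_opens : opens R n := Opens (@chart_img_open _ _ M i).
Local Notation W := chart_opens.
Local Notation A := (smf W).
Local Notation Dd := (@Dsm R n W).

Lemma lift_subproof (f : 'rV[R]_n -> R) : exists h : A,
  smooth_on W f -> forall x, W x -> h x = f x.
Proof.
have [sf|nsf] := pselect (smooth_on W f); last by exists 0.
by exists (mk sf) => _ x Wx; rewrite mkE.
Qed.
(** The total version of mk, with a default value for functions that are not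
    smooth. *)
Definition lift f : A := sval (cid (lift_subproof f)).
Lemma ev_lift x (Wx : W x) (f : 'rV[R]_n -> R) : smooth_on W f -> ev Wx (lift f) = f x.
Proof. by move=> sf; rewrite /ev /lift; case: cid => h /= ->. Qed.

Lemma ev_Dlift x (Wx : W x) a (f : 'rV[R]_n -> R) : smooth_on W f ->
  ev Wx (Dd a (lift f)) = pd a f x.
Proof.
move=> sf; rewrite ev_D; apply: (pd_ext (@osetP _ _ W)) => // y Wy.
exact: (ev_lift Wy sf).
Qed.

Variables (sgn : nat) (g : field M).
Hypothesis mg : is_metric sgn g.

Definition gA : 'I_n -> covec A n := fun a b => lift (fun x => g i x [:: a; b]).
Definition giA : 'I_n -> covec A n := fun a b => lift (fun x => ginv g i x a b).
Definition GamA : 'I_n -> 'I_n -> covec A n := fun c e b =>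
  lift (fun x => christoffel g i x e c b).

Lemma ev_gA x (Wx : W x) a b : ev Wx (gA a b) = g i x [:: a; b].
Proof. by rewrite ev_lift //; exact: (metric_smooth mg). Qed.
Lemma ev_giA x (Wx : W x) a b : ev Wx (giA a b) = ginv g i x a b.
Proof. by rewrite ev_lift //; exact: (ginv_smooth mg). Qed.
Lemma ev_GamA x (Wx : W x) c e b : ev Wx (GamA c e b) = christoffel g i x e c b.
Proof. by rewrite ev_lift //; exact: (christoffel_smooth mg). Qed.
Lemma ev_DgA x (Wx : W x) c a b : ev Wx (Dd c (gA a b)) = pd c (fun y => g i y [:: a; b]) x.
Proof. by rewrite ev_Dlift //; exact: (metric_smooth mg). Qed.
Lemma ev_DGamA x (Wx : W x) d c e b :
  ev Wx (Dd d (GamA c e b)) = pd d (fun y => christoffel g i y e c b) x.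
Proof. by rewrite ev_Dlift //; exact: (christoffel_smooth mg). Qed.

Lemma metric_pairA : metric_pair gA giA.
Proof.
split=> a b; apply: ev_ext => x Wx.
- by rewrite !ev_gA; exact: (metric_sym mg).
- by rewrite !ev_giA; exact: (gi_sym (metric_pairR mg Wx)).
rewrite ev_sum /dl rmorph_nat; apply: etrans (gi_g (metric_pairR mg Wx) a b).
by apply: eq_bigr => c _; rewrite evM ev_giA ev_gA.
Qed.

Lemma GamA_C a b c : GamA a c b = GamA b c a.
Proof. by apply: ev_ext => x Wx; rewrite !ev_GamA; exact: (christoffelC mg). Qed.

Lemma gA_compat c a b :
  Dd c (gA a b) = \sum_e (GamA c e a * gA e b + GamA c e b * gA a e).
Proof.
apply: ev_ext => x Wx; rewrite ev_DgA (christoffel_compat mg _ _ _ Wx) ev_sum.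
by apply: eq_bigr => e _; rewrite evD !evM !ev_GamA !ev_gA.
Qed.

Definition repr k (F : form A n) (G : field M) :=
  forall x (Wx : W x) s, size s = k -> ev Wx (F s) = G i x s.

Definition formA k (G : field M) : form A n :=
  fun s => if size s == k then lift (fun x => G i x s) else 0.

Lemma altern_ev (F : form A n) : (forall x (Wx : W x), altern (mapf (ev Wx) F)) -> altern F.
Proof. by move=> aF s1 b c s2; apply: ev_ext => x Wx; rewrite evN; exact: aF. Qed.

Lemma formA_repr k G : is_form k G -> repr k (formA k G) G.
Proof.
move=> [[sG _] aG] x Wx s sk; rewrite /formA sk eqxx ev_lift //.
by subst k; exact: (sG i (in_tuple s)).
Qed.

Lemma formA_isform k G : is_form k G -> isform k (formA k G).
Proof.
move=> fG; split; last by move=> s /negbTE sk; rewrite /formA sk.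
apply: altern_ev => x Wx.
have -> : mapf (ev Wx) (formA k G) = trunc k (G i x).
  apply/funext => s; rewrite /mapf /trunc; have [sk|sk] := eqVneq (size s) k.
    exact: formA_repr.
  by rewrite /formA (negbTE sk) rmorph0.
by apply: skew_altern; have [_] := fG; apply.
Qed.
Local Notation nabA := (nab Dd GamA).

Lemma pd_repr k F G : repr k F G -> forall x (Wx : W x) c s, size s = k ->
  ev Wx (Dd c (F s)) = pd c (fun y => G i y s) x.
Proof.
move=> FG x Wx c s sk; rewrite ev_D; apply: (pd_ext (@osetP _ _ W)) => // y Wy.
exact: FG sk.
Qed.

Lemma ev_nab k F G : repr k F G -> forall x (Wx : W x) c s, size s = k ->
  ev Wx (nabA c F s) = nabla g G i x c s.
Proof.
move=> FG x Wx c s sk; rewrite /nab formD formN evB (pd_repr FG) //; congr (_ - _).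
rewrite der_set_nth ev_sum; apply: eq_bigr => t _; rewrite ev_sum; apply: eq_bigr => d _.
rewrite evM ev_GamA (FG _ Wx) // size_set_nth -sk.
by apply/maxn_idPr; exact: ltn_ord.
Qed.

Lemma ev_Riem x (Wx : W x) a b c e : ev Wx (Riem Dd GamA a b c e) = riemann g i x a b c e.
Proof.
rewrite /Riem evD evB !ev_DGamA ev_sum; congr (_ + _).
by apply: eq_bigr => f _; rewrite evB !evM !ev_GamA.
Qed.

Lemma ev_Rlow x (Wx : W x) a b c e : ev Wx (Rlow Dd GamA gA a b c e) = riemann_low g i x a b c e.
Proof. by rewrite /Rlow ev_sum; apply: eq_bigr => f _; rewrite evM ev_gA ev_Riem. Qed.

Lemma ev_Ric x (Wx : W x) b e : ev Wx (Ric Dd GamA b e) = ricci g i x b e.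
Proof. by rewrite /Ric ev_sum; apply: eq_bigr => f _; rewrite ev_Riem. Qed.

Lemma ev_Scal x (Wx : W x) : ev Wx (Scal Dd GamA giA) = scalar_curv g i x.
Proof.
rewrite /Scal ev_sum; apply: eq_bigr => b _; rewrite ev_sum; apply: eq_bigr => e _.
by rewrite evM ev_giA ev_Ric.
Qed.

Definition cA (r : R) : A := smf_cst W r.
Definition i1 : A := cA (2 * (n%:R - 1))^-1.
Definition i2 : A := cA (n%:R - 2)^-1.

Lemma ev_natr x (Wx : W x) m : ev Wx m%:R = m%:R.
Proof. exact: rmorph_nat. Qed.

Lemma ev1 x (Wx : W x) : ev Wx 1 = 1.
Proof. exact: rmorph1. Qed.

Lemma i1P : (3 <= n)%N -> 2%:R * (n%:R - 1) * i1 = 1.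
Proof.
move=> n3; apply: ev_ext => x Wx; rewrite !evM evB !ev_natr !ev1 ev_cst divff //.
by rewrite mulf_neq0 ?pnatr_eq0 // subr_eq0 -[1]/(1%:R) eqr_nat; case: (n) n3 => [|[]].
Qed.

Lemma i2P : (3 <= n)%N -> (n%:R - 2%:R) * i2 = 1.
Proof.
move=> n3; apply: ev_ext => x Wx; rewrite evM evB !ev_natr ev1 ev_cst divff //.
by rewrite subr_eq0 eqr_nat; case: (n) n3 => [|[|[]]].
Qed.

Lemma ev_Weyl x (Wx : W x) a b c e :
  ev Wx (Weyl Dd GamA gA giA i1 i2 a b c e) = weyl g i x a b c e.
Proof.
have P p q : ev Wx (Psch Dd GamA gA giA i1 i2 p q) = schouten g i x p q.
  by rewrite /Psch evM evB !evM ev_Ric ev_Scal ev_gA !ev_cst.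
by rewrite /Weyl !evB ev_Rlow ![ev Wx (gA _ _ * _)]evM !P !ev_gA.
Qed.
End Bridge.

(** * Obstructions to the conformal Killing equation *)

Section Equivalence.
Variables (R : realType) (n : nat) (M : manifold R n) (i : chart M).
Local Notation W := (chart_opens i).
Local Notation A := (smf W).
Local Notation Dd := (@Dsm R n W).
Variables (sgn : nat) (g : field M).
Hypothesis mg : is_metric sgn g.
Hypothesis n3 : (3 <= n)%N.
Local Notation gA := (gA i g).
Local Notation giA := (giA i g).
Local Notation GamA := (GamA i g).
Local Notation cA := (cA i).
Local Notation nabA := (nab Dd GamA).
Let dP : derivations Dd := Dsm_derivations W.
Let gP : metric_pair gA giA := metric_pairA i mg.
Let gC := GamA_C i mg.
Let gc := gA_compat i mg.
Let tf : tfree A := smf_tfree (U := W).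

Lemma mapc_gA x (Wx : W x) c : mapc (ev Wx) (gA c) = (fun b => g i x [:: c; b]).
Proof. by apply/funext => b; rewrite /mapc /= (ev_gA mg). Qed.
Lemma mapc_giA x (Wx : W x) : (fun a => mapc (ev Wx) (giA a)) = ginv g i x.
Proof. by apply/funext => a; apply/funext => b; rewrite /mapc /= (ev_giA mg). Qed.

Lemma ev_pair x (Wx : W x) : metric_pair (fun a b => g i x [:: a; b]) (ginv g i x : 'I_n -> covec R n).
Proof. exact: (metric_pairR mg Wx). Qed.

Definition muA l F := cA (l.+2%:R^-1) *: \sum_d wedge (dl A d) (nabA d F).
Definition rhoA l F := cA ((n%:R - l.+1%:R + 1)^-1) *: \sum_p up giA p (nabA p F).

(** Pointwise, the projection of nabla G vanishes, so that pure_proj0 gives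
    its exterior and trace parts; their formulas depend smoothly on the point.
    *)
Lemma killing_ckf l G : is_form l.+1 G ->
  (forall x, chart_img i x -> forall c s, size s = l.+1 ->
     proj0 g i x (nabla g G i x) c s = 0) ->
  ckf Dd GamA gA l (formA i l.+1 G) (muA l (formA i l.+1 G)) (rhoA l (formA i l.+1 G)).
Proof.
move=> fG kG; set F := formA i l.+1 G.
have iF : isform l.+1 F by exact: formA_isform.
have iN c : isform l.+1 (nabA c F) by exact: isform_nab.
have iM : isform l.+2 (muA l F) by apply: isformZ; apply: isform_sum => d; exact: isform_wedge.
have iR : isform l (rhoA l F) by apply: isformZ; apply: isform_sum => d; exact: (isform_up _ _ (iN d)).
split=> // c; apply/funext => s; have [sl|sl] := eqVneq (size s) l.+1; last first.
  have [_ ->//] := iN c.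
  by have [_ ->//] := isformD (isform_ctr c iM) (isform_wedge (gA c) iR).
apply: ev_ext => x Wx; have gPx := ev_pair Wx.
have aN d : altern (mapf (ev Wx) (nabA d F)) by apply: altern_mapf; case: (iN d).
have := pure_proj0 gPx (m := l) aN _ c sl.
have nE d u : size u = l.+1 -> mapf (ev Wx) (nabA d F) u = nabla g G i x d u.
  by move=> ul; apply: (ev_nab mg (formA_repr fG)).
rewrite -[ev Wx (_ s)]/(mapf (ev Wx) (nabA c F) s) => ->; last first.
  by move=> d u ul; rewrite -(kG _ Wx d u ul); exact: (proj0_ext g i x nE).
rewrite -[RHS]/(mapf (ev Wx) _ s) mapfD formD mapf_ctr mapf_wedge mapc_gA !mapfZ !mapf_sum /= !ev_cst.
under [in RHS]eq_bigr do rewrite mapf_wedge mapc_dl.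
by under [X in _ = _ + wedge _ (_ *: X) _]eq_bigr do rewrite mapf_up mapc_giA.
Qed.

Section Pair.
Variables (l : nat) (s mu' nu F mu rho : form A n).
Hypotheses (cs : ckf Dd GamA gA 0 s mu' nu) (cF : ckf Dd GamA gA l F mu rho).

(** The exterior part has no divergence, and the trace part contributes
    up_g_sum. *)
Lemma div_ckf : \sum_q up giA q (nabA q F) = (n%:R - l.+1%:R + 1) *: rho.
Proof.
have [iF iM iR E] := cF.
under eq_bigr do rewrite E upD.
rewrite big_split /= (up_ctr_tr gP tf) ?add0r; last by case: iM.
by rewrite (up_g_sum gP iR) -natr1; congr (_ *: _); ring.
Qed.

(** The trace part has no exterior derivative because g is symmetric. *)
Lemma curl_ckf : \sum_z wedge (dl A z) (nabA z F) = l.+2%:R *: mu.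
Proof.
have [iF iM iR E] := cF.
under eq_bigr do rewrite E wedgeDr.
by rewrite big_split /= (euler iM) (sum_dl_g gP tf) addr0.
Qed.

Lemma cov_nab_ckf c : cov (nabA c s) = cov (ctr c mu') + nu [::] *: gA c.
Proof. by have [_ _ _ ->] := cs; rewrite covFD cov_wedge. Qed.

Lemma ctr2_nab_ckf : \sum_p ctrv giA (cov (nabA p s)) (up giA p F) = ctr2 giA mu' F.
Proof.
have [[aF _] _ _ _] := cF.
under eq_bigr do rewrite cov_nab_ckf ctrvD ctrvZ.
rewrite big_split /= -scaler_sumr; under [X in _ *: X]eq_bigr do rewrite (ctrv_g gP) (ctr_up giA _ _ aF).
by rewrite sumrN (up_ctr_tr gP tf aF) oppr0 scaler0 addr0.
Qed.

Lemma wdg2_nab_ckf : \sum_y wedge (dl A y) (wedge (cov (nabA y s)) F) = wdg2 mu' F.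
Proof.
under eq_bigr do rewrite cov_nab_ckf wedgevD wedgevZ wedgeDr wedgeZ.
by rewrite big_split /= -scaler_sumr (sum_dl_g gP tf) scaler0 addr0.
Qed.
End Pair.

(** These are the brackets with the indices arranged by tau_overE and
    tau_underE, now as forms over the ring of smooth functions. *)
Definition overA k s F : form A n := - 2%:R *: ctrv giA (cov s) (\sum_q up giA q (nabA q F))
  + (n%:R - k%:R + 1) *: \sum_p ctrv giA (cov (nabA p s)) (up giA p F).
Definition underA k s F : form A n := cA (k.+2%:R^-1 * k.+1%:R^-1) *:
  (2%:R *: wedge (cov s) (\sum_z wedge (dl A z) (nabA z F))
   + k.+1%:R *: \sum_y wedge (dl A y) (wedge (cov (nabA y s)) F)).

Lemma isform_overA k s F : isform k F -> isform k.-2 (overA k s F).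
Proof.
move=> iF; apply: isformP.
  apply: (@isform_ctrv _ _ _ k.-1); apply: isform_sum => q.
  exact: (isform_up _ _ (isform_nab dP _ _ iF)).
apply: isformZ; apply: isform_sum => p; apply: (@isform_ctrv _ _ _ k.-1).
exact: isform_up.
Qed.

Lemma isform_underA k s F : isform k F -> isform k.+2 (underA k s F).
Proof.
move=> iF; apply: isformZ; apply: isformP.
  apply: isform_wedge; apply: isform_sum => q; apply: isform_wedge.
  exact: (isform_nab dP _ _ iF).
by apply: isformZ; apply: isform_sum => p; do 2 apply: isform_wedge.
Qed.

(** The projection is linear and annihilates p. *)
Lemma proj0_mod_pure x (Wx : W x) m (a b : R) (f h p : 'I_n -> form R n) : (m.+1 <= n)%N ->
  pure g i x m.+1 p ->
  (forall c u, size u = m.+1 -> a * f c u = b * h c u + p c u) ->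
  forall c u, size u = m.+1 -> a * proj0 g i x f c u = b * proj0 g i x h c u.
Proof.
move=> mn pp E c u um; have gPx := ev_pair Wx.
have pz (r : R) (f' : 'I_n -> form R n) : r * proj0 g i x f' c u = proj0 g i x (fun c => r *: f' c + 0) c u.
  rewrite (proj0_lin g i x r f' (fun=> 0)) [X in _ = _ + X](_ : _ = 0) ?addr0 //.
  apply: (proj0_pure gPx mn _ c um); exists 0, 0; split; try exact: altern0.
  by move=> d v _; rewrite [wedge _ _](linear0 (wedge _)) [RHS]addr0.
rewrite (pz a f) -[RHS]addr0 -(proj0_pure gPx mn pp c um) -proj0_lin.
apply: (proj0_ext g i x _ c um) => d v vm.
by rewrite formD formZ E // formD formZ addr0.
Qed.

Section Fields.
Variables (k : nat) (sigma tau : field M -> field M).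
Hypotheses (fs : is_form 1 (sigma g)) (ft : is_form k (tau g)).
Let s := formA i 1 (sigma g).
Let F := formA i k (tau g).
Let iF : isform k F := formA_isform i ft.
Let FE : repr k F (tau g) := formA_repr ft.
Let sE : repr 1 s (sigma g) := formA_repr fs.

Section Point.
Variables (x : 'rV[R]_n) (Wx : W x).
Local Notation E := (mapf (ev Wx)).
Let aF : altern (E F). Proof. by apply: altern_mapf; case: iF. Qed.
Let aT c : altern (E (nabA c F)).
Proof. by apply: altern_mapf; case: (isform_nab dP GamA c iF). Qed.
Let tauF u : size u = k -> tau g i x u = E F u.
Proof. by move=> uk; rewrite -(FE Wx). Qed.
Let nabT c u : size u = k -> nabla g (tau g) i x c u = E (nabA c F) u.
Proof. by move=> uk; rewrite -(ev_nab mg FE Wx). Qed.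
Let nabS c a : nabla g (sigma g) i x c [:: a] = mapc (ev Wx) (cov (nabA c s)) a.
Proof. by rewrite -(ev_nab mg sE Wx). Qed.
Let sgE : (fun a => sigma g i x [:: a]) = mapc (ev Wx) (cov s).
Proof. by apply/funext => a; rewrite -(sE Wx). Qed.

Lemma mapf_ctrvR v G : E (ctrv giA v G) = ctrv (ginv g i x) (mapc (ev Wx) v) (E G).
Proof. by rewrite mapf_ctrv mapc_giA. Qed.
Lemma mapf_upR p G : E (up giA p G) = up (ginv g i x) p (E G).
Proof. by rewrite mapf_up mapc_giA. Qed.

(** tau_overE at the point x, read as the value of an identity between smooth
    functions. *)
Lemma ev_over u : (size u).+2 = k -> ev Wx (overA k s F u) = tau_over k sigma tau g i x u.
Proof.
move=> uk; rewrite (tau_overE (ev_pair Wx) aF aT tauF nabT nabS uk).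
rewrite -[LHS]/(E (overA k s F) u) mapfD !mapfZ mapf_ctrvR !mapf_sum sgE.
rewrite /= evN ev_natr evD evB ev1 !ev_natr; congr ((_ *: ctrv _ _ _ + _ *: _ : form R n) u).
  by apply: eq_bigr => q _; exact: mapf_upR.
by apply: eq_bigr => q _; rewrite mapf_ctrvR mapf_upR.
Qed.

Lemma ev_under u : size u = k.+2 -> ev Wx (underA k s F u) = tau_under k sigma tau g i x u.
Proof.
move=> uk; rewrite (tau_underE aF aT tauF nabT nabS uk).
rewrite -[LHS]/(E (underA k s F) u) mapfZ mapfD !mapfZ mapf_wedge !mapf_sum sgE formZ /=.
rewrite ev_cst !ev_natr; congr (_ * _).
congr ((_ *: wedge _ _ + _ *: _ : form R n) u).
  by apply: eq_bigr => q _; rewrite mapf_wedge mapc_dl.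
by apply: eq_bigr => q _; rewrite !mapf_wedge mapc_dl.
Qed.
End Point.

Lemma repr_over m : k = m.+2 -> repr m (overA k s F) (tau_over k sigma tau g).
Proof. by move=> km x Wx u um; apply: ev_over; rewrite um. Qed.
Lemma repr_under : repr k.+2 (underA k s F) (tau_under k sigma tau g).
Proof. by move=> x Wx u um; exact: ev_under. Qed.

Section Killing.
Variable l : nat.
Hypothesis kl : k = l.+1.
Hypothesis hs : forall x, chart_img i x -> forall c u, size u = 1 ->
  proj0 g i x (nabla g (sigma g) i x) c u = 0.
Hypothesis ht : forall x, chart_img i x -> forall c u, size u = k ->
  proj0 g i x (nabla g (tau g) i x) c u = 0.
Let cs : ckf Dd GamA gA 0 s (muA 0 s) (rhoA 0 s) := killing_ckf fs hs.
Let cF : ckf Dd GamA gA l F (muA l F) (rhoA l F).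
Proof. by move: (ht) (ft); rewrite /F kl => h f; apply: killing_ckf. Qed.
Let i1E := i1P i n3.
Let i2E := i2P i n3.

Lemma overA_killing : overA k s F =
  (n%:R - k%:R + 1) *: over0 giA s (muA 0 s) F (rhoA l F).
Proof.
rewrite /overA (div_ckf cF) (ctr2_nab_ckf cs cF) ctrvZr -kl /over0.
rewrite scalerBr !scalerA; form_ring.
Qed.

Lemma underA_killing : underA k s F =
  cA k.+2%:R^-1 *: under0 s (muA 0 s) F (muA l F).
Proof.
rewrite /underA (curl_ckf cF) (wdg2_nab_ckf F cs) wedgeZ -kl /under0.
have -> : cA (k.+2%:R^-1 / k.+1%:R) = cA k.+2%:R^-1 * cA k.+1%:R^-1.
  by apply: ev_ext => x Wx; rewrite evM !ev_cst.
have E : cA k.+1%:R^-1 * k.+1%:R = 1.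
  by apply: ev_ext => x Wx; rewrite evM ev_natr ev_cst ev1 mulVf ?pnatr_eq0.
rewrite (scalerA 2%:R) (mulrC 2%:R) -(scalerA _ 2%:R) -scalerDr scalerA.
by rewrite -(mulrA (cA _)) E mulr1.
Qed.

Let weylC x (Wx : W x) a b c d : weyl g i x a b c d = mapc (ev Wx) (Weyl Dd GamA gA giA (i1 i) (i2 i) a b c) d.
Proof. by rewrite -(ev_Weyl mg Wx). Qed.
Let tauF x (Wx : W x) u : size u = k -> tau g i x u = mapf (ev Wx) F u.
Proof. by move=> uk; rewrite -(FE Wx). Qed.
Let sgE x (Wx : W x) : (fun a => sigma g i x [:: a]) = mapc (ev Wx) (cov s).
Proof. by apply/funext => a; rewrite -(sE Wx). Qed.
Let sgr x (Wx : W x) e : rais (ginv g i x) (fun a => sigma g i x [:: a]) e = ev Wx (up giA e s [::]).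
Proof.
rewrite -[RHS]/(mapf (ev Wx) (up giA e s) [::]) mapf_upR upE form_sum sgE.
by apply: eq_bigr.
Qed.

Lemma d_nat_cst c (a b : nat) : Dd c (a%:R - b%:R + 1) = 0.
Proof. by rewrite (dD dP) (dB dP) !(dnat dP) (d1 dP) subr0 addr0. Qed.

Lemma d_cst c r : Dd c (cA r) = 0.
Proof. by apply: ev_ext => x Wx; rewrite ev_Dmk pd_cst rmorph0. Qed.

(** overA_killing, nab_over0 and W_overE, evaluated at x and projected. *)
Lemma over_proj m : l = m.+2 -> (l < n)%N -> forall x, chart_img i x -> forall c u,
  size u = m.+1 -> (n%:R - k%:R) * proj0 g i x (nabla g (tau_over k sigma tau g) i x) c u =
  (n%:R - k%:R + 1) * proj0 g i x (weyl_over k sigma tau g i x) c u.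
Proof.
move=> lm ln x ix; have Wx : W x := ix; move=> c0 u0 um0; have mn : (m.+1 <= n)%N by rewrite (leq_trans _ ln) // lm ltnW.
have [om [th [ao ath E]]] := nab_over0 dP gP gC gc tf i1E i2E ln cs cF.
pose K : R := n%:R - k%:R + 1.
apply: (@proj0_mod_pure x Wx m _ _ _ _ (fun c => K *: (ctr c (mapf (ev Wx) om) +
   wedge (fun b => g i x [:: c; b]) (mapf (ev Wx) th))) mn _ _ c0 u0 um0).
  exists (K *: mapf (ev Wx) om), (K *: mapf (ev Wx) th).
  split; try by apply: alternZ; exact: altern_mapf.
  by move=> c u um; rewrite ctrZ wedgeZ !formE; ring.
move=> c u um; have uk : size u = m.+1 by [].
rewrite -(ev_nab mg (repr_over (m := m.+1) _) Wx) //; last by rewrite kl lm.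
rewrite overA_killing (nabZ dP) (_ : Dd c _ = 0); last exact: d_nat_cst.
rewrite scale0r add0r formZ evM.
have -> : ev Wx (n%:R - k%:R + 1) = K by rewrite evD evB ev1 !ev_natr.
rewrite mulrCA formZ -mulrDr; congr (_ * _).
have -> : n%:R - k%:R = ev Wx (n%:R - l.+1%:R) :> R by rewrite evB !ev_natr kl.
rewrite -evM -formZ E (W_overE dP gP gC gc tf i1E i2E _ cF).
rewrite -[LHS]/(mapf (ev Wx) _ u) !mapfD !formD mapf_ctr mapf_wedge (mapc_gA Wx) -addrA; congr (_ + _).
rewrite (weyl_overE (ev_pair Wx) sigma (altern_mapf _ _) (tauF Wx) (weylC Wx) c um); first last.
- by rewrite kl lm.
- by case: iF.
rewrite mapfZ /weyl_overP !mapf_sum -formD; congr ((_ *: _ + _ : form R n) u).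
- by rewrite /= evD evB ev1 !ev_natr kl.
- apply: eq_bigr => r _; rewrite mapfZ (sgr Wx) !mapf_sum; congr (_ *: _).
  apply: eq_bigr => p _; rewrite mapf_sum; apply: eq_bigr => q _.
  by rewrite mapfZ !mapf_upR.
apply: eq_bigr => p _; rewrite mapf_sum; apply: eq_bigr => q _.
by rewrite mapf_wedge mapf_ctrvR !mapf_upR -(sgE Wx).
Qed.

(** underA_killing, nab_under0 and W_underE, evaluated at x and projected; the
    factor compensates the normalisation of the alternation in weyl_under. *)
Lemma under_proj : (l.+3 <= n)%N -> forall x, chart_img i x -> forall c u,
  size u = l.+3 -> k%:R * proj0 g i x (nabla g (tau_under k sigma tau g) i x) c u =
  (- (k.+1%:R * k%:R)) * proj0 g i x (weyl_under k sigma tau g i x) c u.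
Proof.
move=> ln x ix; have Wx : W x := ix; move=> c0 u0 um0.
have [om [th [ao ath E]]] := nab_under0 dP gP gC gc tf i1E i2E cs cF.
pose K : R := k.+2%:R^-1.
apply: (@proj0_mod_pure x Wx l.+2 _ _ _ _ (fun c => K *: (ctr c (mapf (ev Wx) om) +
   wedge (fun b => g i x [:: c; b]) (mapf (ev Wx) th))) ln _ _ c0 u0 um0).
  exists (K *: mapf (ev Wx) om), (K *: mapf (ev Wx) th).
  split; try by apply: alternZ; exact: altern_mapf.
  by move=> c u um; rewrite ctrZ wedgeZ !formE; ring.
move=> c u um.
rewrite -(ev_nab mg repr_under Wx) //; last by rewrite um kl.
rewrite underA_killing (nabZ dP) (_ : Dd c _ = 0); last exact: d_cst.
rewrite scale0r add0r formZ evM ev_cst mulrCA.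
have -> : k%:R = ev Wx (l.+1%:R) :> R by rewrite ev_natr kl.
rewrite -evM -[X in _ * ev _ X]formZ E (W_underE dP gP gC gc tf i1E i2E).
rewrite -[X in _ * X]/(mapf (ev Wx) _ u) !mapfD !formD mapf_ctr mapf_wedge (mapc_gA Wx) -[X in _ * X]addrA mulrDr.
rewrite formZ formD; congr (_ + _).
have C34' a b p q : mapc (ev Wx) (Weyl Dd GamA gA giA (i1 i) (i2 i) a b p) q =
    - mapc (ev Wx) (Weyl Dd GamA gA giA (i1 i) (i2 i) a b q) p.
  have [_ H _ _] := weyl_likeP dP gP gC gc tf i1E i2E.
  by rewrite /mapc /= H evN.
rewrite (weyl_underE (ev_pair Wx) sigma (altern_mapf _ _) (tauF Wx) (weylC Wx) C34' c um kl); last by case: iF.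
have cst (a b e y : R) : a != 0 -> b != 0 -> - (a * b) * (- (e * (a^-1 / b)) * y) = e * y.
  by move=> a0 b0; field; rewrite a0 b0.
rewrite ev_natr -[in X in - (_ * X)]kl cst ?pnatr_eq0 ?kl //; congr (_ * _).
rewrite !mapfZ mapf_wedge -(sgE Wx) !mapf_sum /weyl_underP -formD; congr ((_ *: wedge _ _ + _ *: _ : form R n) u).
- by rewrite /= evN ev_natr.
- apply: eq_bigr => d _; rewrite mapf_wedge mapc_dl mapf_sum; congr (wedge _ _).
  by apply: eq_bigr => e _; rewrite mapf_wedge mapf_upR.
- exact: ev_natr.
apply: eq_bigr => e _; rewrite mapfZ (sgr Wx) mapf_sum; congr (_ *: _).
by apply: eq_bigr => d _; rewrite !mapf_wedge mapc_dl.
Qed.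
End Killing.
End Fields.
End Equivalence.

(** * Pull-back of tensors by a linear map *)

Section Pull.
Variables (A : comPzRingType) (n : nat).
Local Notation form := (form A n).
Local Notation covec := (covec A n).
Implicit Types (F G H : form) (v w : covec) (a b c d : 'I_n) (s : seq 'I_n).
Variable J : 'I_n -> covec.

Definition pullv v : covec := fun a => \sum_b J a b * v b.
(** The pull-back of covariant tensors by the linear map J, one index at a
    time; pull_tuple is the usual formula. *)
Fixpoint pull_rec G s : A :=
  if s is a :: s' then \sum_b J a b * pull_rec (ctr b G) s' else G [::].
Definition pull G : form := pull_rec G.

Lemma pull_nil G : pull G [::] = G [::]. Proof. by []. Qed.
Lemma pull_cons G a s : pull G (a :: s) = \sum_b J a b * pull (ctr b G) s. Proof. by []. Qed.

Lemma ctr_pull a G : ctr a (pull G) = \sum_b J a b *: pull (ctr b G).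
Proof. by apply/funext => s; rewrite form_sum /ctr pull_cons. Qed.

Lemma pull_linear : linear pull.
Proof.
move=> r F G; apply/funext => s; rewrite !formE; elim: s F G => [|a s IH] F G.
  by rewrite !pull_nil !formE.
rewrite !pull_cons mulr_sumr -big_split; apply: eq_bigr => b _ /=.
by rewrite (linearP (ctr b)) IH mulrDr mulrCA.
Qed.
HB.instance Definition _ := GRing.isLinear.Build A form form _ pull pull_linear.

Lemma pullD F G : pull (F + G) = pull F + pull G. Proof. exact: linearD. Qed.
Lemma pullN F : pull (- F) = - pull F. Proof. exact: linearN. Qed.
Lemma pullZ r F : pull (r *: F) = r *: pull F. Proof. exact: linearZ. Qed.
Lemma pull_sum (K : finType) (f : K -> form) : pull (\sum_j f j) = \sum_j pull (f j).
Proof. exact: linear_sum. Qed.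

Lemma pull_wedge v G : pull (wedge v G) = wedge (pullv v) (pull G).
Proof.
apply/funext => s; elim: s G => [|a s IH] G; first by rewrite pull_nil !wedge_nil.
rewrite pull_cons wedge_cons ctr_pull linear_sum form_sum mulr_suml -sumrB.
apply: eq_bigr => b _; rewrite ctr_wedge pullD pullN pullZ /= wedgeZ formD formN !formZ -IH.
by rewrite mulrDr mulrN mulrA.
Qed.

Lemma pull_ext m F G : (forall s, size s = m -> F s = G s) ->
  forall s, size s = m -> pull F s = pull G s.
Proof.
move=> FG s; elim: s m F G FG => [|a s IH] m F G FG sm; first by rewrite !pull_nil FG.
rewrite !pull_cons; apply: eq_bigr => b _; congr (_ * _).
by apply: (IH (size s)) => // u us; rewrite /ctr FG //= us.
Qed.

Lemma pull_trunc k G : pull (fun s => if size s == k then G s else 0) =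
  (fun s => if size s == k then pull G s else 0).
Proof.
apply/funext => s; elim: s k G => [|a s IH] k G //.
rewrite pull_cons /=; case: k => [|k].
  by apply: big1 => b _; rewrite (pull_ext (m := size s) (G := 0)) ?linear0 ?mulr0.
transitivity (\sum_b J a b * (if size s == k then pull (ctr b G) s else 0)).
  by apply: eq_bigr => b _; rewrite -IH.
by rewrite eqSS; case: ifP => // _; apply: big1 => b _; rewrite mulr0.
Qed.

Lemma pull_tuple k G (a : k.-tuple 'I_n) :
  pull G a = \sum_(b : k.-tuple 'I_n) (\prod_(t < k) J (tnth a t) (tnth b t)) * G b.
Proof.
elim: k G a => [|k IH] G a.
  rewrite (bigD1 [tuple]) //= [X in _ = _ + X]big1 ?addr0 => [|b]; last by move/eqP; case; exact: (tuple0 b).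
  by rewrite big_ord0 mul1r (tuple0 a).
case/tupleP: a => a0 a; transitivity (pull G (a0 :: a)) => //; rewrite pull_cons.
transitivity (\sum_b0 \sum_(b : k.-tuple 'I_n) J a0 b0 *
    ((\prod_(t < k) J (tnth a t) (tnth b t)) * G (b0 :: b))).
  by apply: eq_bigr => b0 _; rewrite IH mulr_sumr.
rewrite pair_big /= (reindex (fun p : 'I_n * k.-tuple 'I_n => [tuple of p.1 :: p.2])) /=; last first.
  exists (fun b : k.+1.-tuple 'I_n => (thead b, [tuple of behead b])) => [[b0 b] _|b _] /=.
    by apply: congr2; [rewrite theadE|apply: val_inj].
  by rewrite -tuple_eta.
apply: eq_bigr => -[b0 b] _ /=; rewrite big_ord_recl !tnth0 mulrA; congr (_ * _ * _).
by apply: eq_bigr => t _; rewrite !tnthS.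
Qed.

Section Metric.
Variables (gi gi' : 'I_n -> covec).
Hypothesis giJ : forall b d, gi' b d = \sum_a \sum_c J a b * J c d * gi a c.

(** giJ says that J maps the inverse metric gi to gi'. *)
Lemma pull_ctrv v G : ctrv gi (pullv v) (pull G) = pull (ctrv gi' v G).
Proof.
transitivity (\sum_d \sum_b (v d * gi' d b) *: pull (ctr b G)); last first.
  rewrite ctrvE pull_sum; apply: eq_bigr => d _; rewrite pullZ upE pull_sum scaler_sumr.
  by apply: eq_bigr => b _; rewrite pullZ scalerA.
rewrite ctrvE; under eq_bigr => p _.
  rewrite upE /pullv scaler_suml; under eq_bigr => d _.
    rewrite scaler_sumr; under eq_bigr => a _ do rewrite ctr_pull !scaler_sumr.
    over.
  over.
rewrite exchange_big; apply: eq_bigr => d _ /=.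
under eq_bigr do rewrite exchange_big.
rewrite exchange_big; apply: eq_bigr => b _ /=.
rewrite giJ mulr_sumr scaler_suml; apply: eq_bigr => p _.
rewrite mulr_sumr scaler_suml; apply: eq_bigr => a _; rewrite !scalerA; congr (_ *: _).
ring.
Qed.

Lemma pull_div (T : 'I_n -> form) :
  \sum_q up gi q (\sum_d J q d *: pull (T d)) = pull (\sum_q up gi' q (T q)).
Proof.
transitivity (\sum_d \sum_b gi' d b *: pull (ctr b (T d))); last first.
  rewrite pull_sum; apply: eq_bigr => d _; rewrite upE pull_sum.
  by apply: eq_bigr => b _; rewrite pullZ.
under eq_bigr => q _.
  rewrite upE; under eq_bigr => a _.
    rewrite linear_sum /= scaler_sumr; under eq_bigr => d _ do rewrite ctrZ ctr_pull !scaler_sumr.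
    over.
  over.
under eq_bigr do rewrite exchange_big.
rewrite exchange_big; apply: eq_bigr => d _ /=.
under eq_bigr do rewrite exchange_big.
rewrite exchange_big; apply: eq_bigr => b _ /=.
rewrite giJ exchange_big scaler_suml exchange_big /=; apply: eq_bigr => p _.
rewrite scaler_suml; apply: eq_bigr => a _; rewrite !scalerA; congr (_ *: _).
ring.
Qed.

Lemma pull_ctr2 (S : 'I_n -> covec) G :
  \sum_p ctrv gi (\sum_d J p d *: pullv (S d)) (up gi p (pull G)) =
  pull (\sum_p ctrv gi' (S p) (up gi' p G)).
Proof.
transitivity (\sum_d \sum_b gi' d b *: pull (ctrv gi' (S d) (ctr b G))); last first.
  rewrite pull_sum; apply: eq_bigr => d _; rewrite upE (linear_sum (ctrv gi' (S d))) pull_sum /=.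
  by apply: eq_bigr => b _; rewrite ctrvZr pullZ.
under eq_bigr => p _.
  rewrite ctrv_suml; under eq_bigr => d _.
    rewrite ctrvZ upE (linear_sum (ctrv gi (pullv (S d)))) scaler_sumr /=; under eq_bigr => a _.
      rewrite ctrvZr ctr_pull (linear_sum (ctrv gi (pullv (S d)))) !scaler_sumr /=.
      under eq_bigr => b _ do rewrite ctrvZr pull_ctrv.
      over.
    over.
  over.
rewrite exchange_big; apply: eq_bigr => d _ /=.
under eq_bigr do rewrite exchange_big.
rewrite exchange_big; apply: eq_bigr => b _ /=.
rewrite giJ exchange_big scaler_suml exchange_big /=; apply: eq_bigr => p _.
rewrite scaler_suml; apply: eq_bigr => a _; rewrite !scalerA; congr (_ *: _).
ring.
Qed.
End Metric.

Lemma pullv_dl d : pullv (dl A d) = (fun a => J a d).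
Proof. by apply/funext => a; rewrite /pullv -[RHS](sum_dlr (J a : 'I_n -> A^o)); apply: eq_bigr => b _; rewrite mulrC /dl eq_sym. Qed.

Lemma cov_J d : (fun a => J a d) = \sum_z J z d *: dl A z.
Proof. exact: cov_dl. Qed.

Lemma pull_curl (T : 'I_n -> form) :
  \sum_z wedge (dl A z) (\sum_d J z d *: pull (T d)) = pull (\sum_z wedge (dl A z) (T z)).
Proof.
rewrite pull_sum; under eq_bigr do rewrite linear_sum /=.
rewrite exchange_big; apply: eq_bigr => d _ /=.
rewrite pull_wedge pullv_dl cov_J wedgev_sum; apply: eq_bigr => z _.
by rewrite wedgevZ wedgeZ.
Qed.

Lemma pull_wdg2 (S : 'I_n -> covec) G :
  \sum_y wedge (dl A y) (wedge (\sum_d J y d *: pullv (S d)) (pull G)) =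
  pull (\sum_y wedge (dl A y) (wedge (S y) G)).
Proof.
rewrite -pull_curl; apply: eq_bigr => y _; congr wedge; rewrite wedgev_sum.
by apply: eq_bigr => d _; rewrite wedgevZ pull_wedge.
Qed.

(** The product rule for the factors J of a pull-back: dJ replaces J in one
    slot at a time. *)
Fixpoint dpull_rec (dJ : 'I_n -> covec) G s : A :=
  if s is a :: s' then
    \sum_b (dJ a b * pull (ctr b G) s' + J a b * dpull_rec dJ (ctr b G) s')
  else 0.

(** The hypothesis is the transformation law of connection coefficients M and
    N; applied in every slot it exchanges the two derivation terms. *)
Lemma dpullE (dJ M N : 'I_n -> covec) G s :
  (forall a b, dJ a b = \sum_f M f a * J f b - \sum_e N b e * J a e) ->
  dpull_rec dJ G s = der M (pull G) s - pull (der N G) s.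
Proof.
move=> dJE; elim: s G => [|a s IH] G.
  by rewrite der_nil pull_nil der_nil subr0.
rewrite der_cons [X in _ = _ - X]pull_cons [LHS]/=; under eq_bigr do rewrite IH dJE.
have E1 : \sum_d M d a * pull G (d :: s) = \sum_b (\sum_f M f a * J f b) * pull (ctr b G) s.
  under eq_bigr do rewrite pull_cons mulr_sumr.
  rewrite exchange_big; apply: eq_bigr => b _; rewrite mulr_suml.
  by apply: eq_bigr => f _; rewrite mulrA.
have E2 : der M (ctr a (pull G)) s = \sum_b J a b * der M (pull (ctr b G)) s.
  rewrite ctr_pull; elim/big_rec2: _ => [|b y z _ <-]; first by rewrite -(scale0r 0) derZr !scale0r.
  by rewrite derDr derZr formD formZ.
have E3 : \sum_b J a b * pull (ctr b (der N G)) s =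
   \sum_b ((\sum_e N b e * J a e) * pull (ctr b G) s + J a b * pull (der N (ctr b G)) s).
  rewrite big_split /=.
  under eq_bigr do rewrite ctr_der pullD formD mulrDr.
  rewrite big_split /=; congr (_ + _).
  under eq_bigr do rewrite pull_sum form_sum mulr_sumr.
  rewrite exchange_big; apply: eq_bigr => b _; rewrite mulr_suml.
  by apply: eq_bigr => e _; rewrite pullZ formZ mulrA; congr (_ * _); rewrite mulrC.
rewrite E1 E2 E3 -big_split -sumrB; apply: eq_bigr => b _ /=.
ring.
Qed.
End Pull.

(** * Change of chart *)

Lemma tensor_smooth (R : realType) n (M : manifold R n) p (F : field M) : is_tensor p F ->
  forall i u, size u = p -> smooth_on (chart_img i) (fun y => F i y u).
Proof. by move=> [sF _] i u up; subst p; exact: (sF i (in_tuple u)). Qed.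

Lemma der_suml (A : comPzRingType) n (r : 'I_n -> A) (N : 'I_n -> 'I_n -> covec A n)
    (G : form A n) s :
  der (fun b e => \sum_d r d * N d b e) G s = \sum_d r d * der (N d) G s.
Proof.
rewrite der_set_nth; under [RHS]eq_bigr do rewrite der_set_nth mulr_sumr.
rewrite [RHS]exchange_big; apply: eq_bigr => t _ /=.
under [RHS]eq_bigr do rewrite mulr_sumr.
rewrite [RHS]exchange_big; apply: eq_bigr => b _ /=; rewrite mulr_suml.
by apply: eq_bigr => d _; rewrite mulrA.
Qed.

Section Overlap.
Variables (R : realType) (n : nat) (M : manifold R n) (i j : chart M).
Local Notation V := 'rV[R]_n.
Implicit Types (x y : V) (a b c d e : 'I_n) (s : seq 'I_n).

Definition overlap : set V := chart_map i @` (chart_dom i `&` chart_dom j).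
Definition trans y : V := chart_map j (chart_inv i y).
Definition Jac x : 'I_n -> covec R n := fun a b => Defs.jacobian i j x a b.

Lemma overlap_img x : overlap x -> chart_img i x.
Proof. by case=> m [im jm] <-; exists m. Qed.
Lemma trans_map m : chart_dom i m -> trans (chart_map i m) = chart_map j m.
Proof. by move=> im; rewrite /trans chart_mapK. Qed.
Lemma trans_img x : overlap x -> chart_img j (trans x).
Proof. by case=> m [im jm] <-; rewrite trans_map //; exists m. Qed.

(** The preimage of an open chart domain under the continuous inverse chart.
    *)
Lemma overlap_open : open overlap.
Proof.
rewrite openE => x [m [im jm] mx]; rewrite /interior.
have ix : chart_img i x by exists m.
have n1 : nbhs x (chart_img i) by apply: open_nbhs_nbhs; split => //; exact: chart_img_open.
have n2 : \forall y \near x, chart_dom j (chart_inv i y).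
  apply: (@chart_inv_continuous _ _ M i x ix); rewrite -mx chart_mapK //.
  by apply: open_nbhs_nbhs; split => //; exact: chart_dom_open.
near=> y; have : chart_img i y by near: y.
have : chart_dom j (chart_inv i y) by near: y.
by move=> jy [p ip pE]; exists p => //; split=> //; move: jy; rewrite -pE chart_mapK.
Unshelve. all: by end_near. Qed.

Lemma trans_smooth b : smooth_on overlap (fun y => trans y 0 b).
Proof. exact: chart_transition_smooth. Qed.

Lemma Jac_smooth a b : smooth_on overlap (fun x => Jac x a b).
Proof. exact: smooth_pd (trans_smooth b). Qed.

(** Second derivatives of the transition map. *)
Definition dJac x c : 'I_n -> covec R n := fun a b => pd c (fun y => Jac y a b) x.

Lemma dJacC x c a b : overlap x -> dJac x c a b = dJac x a c b.
Proof. by move=> Vx; apply: (pdC overlap_open) => //; exact: trans_smooth. Qed.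

Lemma derive_trans (f : V -> R) x c : smooth_on (chart_img j) f -> overlap x ->
  is_derive x (delta_mx 0 c) (f \o trans) (\sum_b Jac x c b * pd b f (trans x)).
Proof.
move=> sf Vx; apply: (pd_comp (U := overlap) (W := chart_img j)) => //.
- exact: chart_img_open.
- exact: trans_img.
- exact: overlap_open.
exact: trans_smooth.
Qed.

(** The product rule, by induction on the index sequence. *)
Lemma derive_pull (P : V -> 'I_n -> covec R n) (H : V -> form R n) (dP : 'I_n -> covec R n)
  (dH : form R n) x v m :
  (forall a b, is_derive x v (fun y => P y a b) (dP a b)) ->
  (forall s, size s = m -> is_derive x v (fun y => H y s) (dH s)) ->
  forall s, size s = m -> is_derive x v (fun y => pull (P y) (H y) s)
    (pull (P x) dH s + dpull_rec (P x) dP (H x) s).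
Proof.
move=> hP hH s; elim: s m H dH hH => [|a s IH] m H dH hH sm.
  by rewrite /= addr0; apply: hH.
have E b : is_derive x v (fun y => P y a b * pull (P y) (ctr b (H y)) s)
    (P x a b *: (pull (P x) (ctr b dH) s + dpull_rec (P x) dP (ctr b (H x)) s)
     + pull (P x) (ctr b (H x)) s *: dP a b).
  apply: (is_deriveM (hP a b)).
  apply: (IH (size s)) => // u us; apply: hH; rewrite /= us; exact: sm.
have := @is_derive_sum _ _ _ n (fun b y => P y a b * pull (P y) (ctr b (H y)) s) x v _ E.
rewrite (_ : \sum_(b < n) _ = fun y => pull (P y) (H y) (a :: s)); last first.
  by apply/funext => y; rewrite pull_cons fct_sumE.
rewrite (_ : \sum_(b < n) _ = pull (P x) dH (a :: s) + dpull_rec (P x) dP (H x) (a :: s)) //.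
rewrite pull_cons /= -big_split; apply: eq_bigr => b _ /=.
by rewrite /GRing.scale /=; ring.
Qed.

Lemma tensor_pull p F : is_tensor p F -> forall x, overlap x -> forall s, size s = p ->
  F i x s = pull (Jac x) (F j (trans x)) s.
Proof.
move=> [_ H] x [m [im jm] <-] s sp; subst p.
rewrite trans_map //; apply: etrans (H i j m im jm (in_tuple s)) _.
by rewrite -(pull_tuple (Jac _) _ (in_tuple s)).
Qed.

Lemma pd_tensor p F x c s : is_tensor p F -> overlap x -> size s = p ->
  pd c (fun y => F i y s) x =
  pull (Jac x) (fun u => \sum_f Jac x c f * pd f (fun y => F j y u) (trans x)) s
  + dpull_rec (Jac x) (dJac x c) (F j (trans x)) s.
Proof.
move=> tF Vx sp.
rewrite (pd_ext overlap_open (g := fun y => pull (Jac y) (F j (trans y)) s)) //; last first.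
  by move=> y Vy; exact: (tensor_pull tF Vy).
have hJ a b : is_derive x (delta_mx 0 c) (fun y => Jac y a b) (dJac x c a b).
  by apply: DeriveDef => //; apply: smooth_derivable (Jac_smooth a b) Vx.
have hF u : size u = p -> is_derive x (delta_mx 0 c) (fun y => F j (trans y) u)
    (\sum_f Jac x c f * pd f (fun y => F j y u) (trans x)).
  move=> up; apply: (@derive_trans (fun y => F j y u) x c) => //.
  exact: (tensor_smooth tF).
by have [_] := derive_pull hJ hF sp.
Qed.

Section Metric.
Variables (sgn : nat) (g : field M).
Hypothesis mg : is_metric sgn g.
Variable (x : V).
Hypothesis Vx : overlap x.
Local Notation J := (Jac x).
Local Notation x' := (trans x).
Let ix : chart_img i x := overlap_img Vx.
Let jx : chart_img j x' := trans_img Vx.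
Let tg : is_tensor 2 g. Proof. by case: mg. Qed.

Lemma metric_trans y : overlap y -> forall a b, g i y [:: a; b] =
  \sum_d Jac y a d * \sum_e Jac y b e * g j (trans y) [:: d; e].
Proof. by move=> Vy a b; rewrite (tensor_pull tg Vy). Qed.

Let Jm : 'M[R]_n := \matrix_(a, b) J a b.

Let gramE : gram g i x = Jm *m gram g j x' *m Jm^T.
Proof.
apply/matrixP => a b; rewrite !mxE (metric_trans Vx).
under [RHS]eq_bigr do rewrite !mxE mulr_suml.
rewrite exchange_big; apply: eq_bigr => d _ /=; rewrite mulr_sumr; apply: eq_bigr => e _.
by rewrite !mxE; ring.
Qed.

Let uG : gram g i x \in unitmx. Proof. by case: (metric_gram mg ix). Qed.
Let uG' : gram g j x' \in unitmx. Proof. by case: (metric_gram mg jx). Qed.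
Let uJ : Jm \in unitmx.
Proof. by move: uG; rewrite gramE !unitmx_mul => /andP[/andP[]]. Qed.

(** Inversion of the matrix identity that expresses g in the first chart by g
    in the second. *)
Lemma ginv_trans b d : ginv g j x' b d = \sum_a \sum_c J a b * J c d * ginv g i x a c.
Proof.
have uJT : Jm^T \in unitmx by rewrite unitmx_tr.
have -> : ginv g j x' b d = (Jm^T *m invmx (gram g i x) *m Jm) b d.
  rewrite gramE /ginv; congr (fun_of_matrix _ b d).
  have E : (Jm *m gram g j x' *m Jm^T) *m (invmx Jm^T *m invmx (gram g j x') *m invmx Jm) = 1%:M.
    by rewrite !mulmxA mulmxK // mulmxK // mulmxV.
  have uA : Jm *m gram g j x' *m Jm^T \in unitmx by rewrite -gramE.
  have -> : invmx (Jm *m gram g j x' *m Jm^T) = invmx Jm^T *m invmx (gram g j x') *m invmx Jm.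
    by rewrite -[LHS]mulmx1 -E mulKmx.
  by rewrite !mulmxA mulmxV // mul1mx -mulmxA mulVmx // mulmx1.
rewrite mxE exchange_big; apply: eq_bigr => c _ /=; rewrite mxE mulr_suml.
by apply: eq_bigr => a _; rewrite !mxE /ginv; ring.
Qed.

(** The Jacobian matrix and the Gram matrix are invertible. *)
Lemma J_cancel (X : 'I_n -> R) :
  (forall b, \sum_q (\sum_p J b p * g j x' [:: p; q]) * X q = 0) -> forall q, X q = 0.
Proof.
move=> H q; pose c := \col_q X q.
have : (Jm *m gram g j x') *m c = 0.
  apply/matrixP => b z; rewrite mxE [RHS]mxE; apply: etrans (H b).
  apply: eq_bigr => r _; rewrite !mxE; congr (_ * _).
  by apply: eq_bigr => p _; rewrite !mxE.
move=> /(congr1 (mulmx (invmx (Jm *m gram g j x')))); rewrite mulKmx ?unitmx_mul ?uJ // mulmx0.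
by move=> /matrixP /(_ q 0); rewrite !mxE.
Qed.

Local Notation h := (dJac x).
Let g' d e : R := g j x' [:: d; e].
(* In the derivative of g, K collects the second derivatives of the transition
   map that fall on the first index, and Q the derivatives of g in the other
   chart. *)
Let K c a b : R := \sum_d \sum_e h c a d * J b e * g' d e.
Let Q c a b : R := \sum_f \sum_d \sum_e J c f * J a d * J b e * pd f (fun y => g j y [:: d; e]) x'.

Lemma pd_metric c a b : pd c (fun y => g i y [:: a; b]) x = K c a b + K c b a + Q c a b.
Proof.
rewrite (pd_tensor c (s := [:: a; b]) tg Vx) // addrC; congr (_ + _).
  rewrite /= big_split /=; congr (_ + _); first by apply: eq_bigr => d _; rewrite mulr_sumr; apply: eq_bigr => e _; rewrite mulrA.
  rewrite /K exchange_big; apply: eq_bigr => d _ /=; rewrite mulr_sumr; apply: eq_bigr => e _.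
  by rewrite mulr0 addr0 /g' (metric_sym mg e d jx) /ctr; ring.
rewrite !pull_cons /Q exchange_big; apply: eq_bigr => d _ /=.
rewrite exchange_big mulr_sumr; apply: eq_bigr => e _ /=.
rewrite /ctr !mulr_sumr; apply: eq_bigr => f _; ring.
Qed.

(** The terms K with second derivatives enter the Koszul formula with the
    signs of the first derivatives of g; by symmetry of second derivatives all
    but one of them cancel. *)
Lemma christoffel_trans c a q : \sum_e christoffel g i x e c a * J e q =
  h c a q + \sum_f \sum_d J c f * J a d * christoffel g j x' q f d.
Proof.
apply/eqP; rewrite -subr_eq0; apply/eqP; move: q; apply: J_cancel => b.
have L1 : \sum_q (\sum_p J b p * g' p q) * (\sum_e christoffel g i x e c a * J e q) =
    2^-1 * (pd c (fun y => g i y [:: a; b]) x + pd a (fun y => g i y [:: c; b]) x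
     - pd b (fun y => g i y [:: c; a]) x).
  rewrite -(christoffel_low mg _ _ _ ix).
  under [RHS]eq_bigr do rewrite (metric_trans Vx) mulr_suml.
  rewrite [RHS]exchange_big; under [LHS]eq_bigr do rewrite mulr_suml.
  rewrite [LHS]exchange_big; apply: eq_bigr => p _ /=.
  under [LHS]eq_bigr do rewrite mulr_sumr.
  rewrite exchange_big; apply: eq_bigr => e _ /=; rewrite mulr_sumr mulr_suml.
  by apply: eq_bigr => q _; rewrite /g'; ring.
have L2 : \sum_q (\sum_p J b p * g' p q) * h c a q = K c a b.
  rewrite /K; apply: eq_bigr => d _; rewrite mulr_suml; apply: eq_bigr => e _.
  by rewrite /g' (metric_sym mg _ _ jx); ring.
have L3 : \sum_q (\sum_p J b p * g' p q) * (\sum_f \sum_d J c f * J a d * christoffel g j x' q f d) =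
    2^-1 * (Q c a b + Q a c b - Q b c a).
  transitivity (\sum_f \sum_d \sum_p J c f * J a d * J b p * (2^-1 *
    (pd f (fun y => g j y [:: d; p]) x' + pd d (fun y => g j y [:: f; p]) x'
     - pd p (fun y => g j y [:: f; d]) x'))).
    under eq_bigr do rewrite mulr_sumr; rewrite exchange_big; apply: eq_bigr => f _ /=.
    under eq_bigr do rewrite mulr_sumr; rewrite exchange_big; apply: eq_bigr => d _ /=.
    under eq_bigr do rewrite mulr_suml; rewrite exchange_big; apply: eq_bigr => p _ /=.
    rewrite -(christoffel_low mg _ _ _ jx) mulr_sumr; apply: eq_bigr => q _.
    by rewrite /g'; ring.
  have -> : Q a c b = \sum_f \sum_d \sum_p J c f * J a d * J b p * pd d (fun y => g j y [:: f; p]) x'.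
    rewrite /Q exchange_big; apply: eq_bigr => f _; apply: eq_bigr => d _; apply: eq_bigr => p _ /=; ring.
  have -> : Q b c a = \sum_f \sum_d \sum_p J c f * J a d * J b p * pd p (fun y => g j y [:: f; d]) x'.
    rewrite /Q exchange_big; apply: eq_bigr => f _; rewrite exchange_big; apply: eq_bigr => d _.
    apply: eq_bigr => p _ /=; ring.
  rewrite /Q -!big_split -sumrB mulr_sumr; apply: eq_bigr => f _.
  rewrite -!big_split -sumrB mulr_sumr; apply: eq_bigr => d _.
  rewrite -!big_split -sumrB mulr_sumr; apply: eq_bigr => p _ /=; ring.
under eq_bigr do rewrite mulrBr mulrDr.
rewrite sumrB big_split /= L1 L2 L3 !pd_metric.
have S c1 a1 b1 : K c1 a1 b1 = K a1 c1 b1.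
  by apply: eq_bigr => d _; apply: eq_bigr => e _; rewrite (dJacC c1 a1 d Vx).
rewrite (S a c b) (S c b a) (S a b c).
move: (K c a b) (K b c a) (K b a c) (Q c a b) (Q a c b) (Q b c a) => y1 y2 y3 y4 y5 y6.
by field.
Qed.

Lemma dJac_christoffel c a b : h c a b = \sum_f christoffel g i x f c a * J f b
  - \sum_e (\sum_d J c d * christoffel g j x' b d e) * J a e.
Proof.
rewrite christoffel_trans (_ : \sum_f \sum_d _ = \sum_e (\sum_d J c d * christoffel g j x' b d e) * J a e) ?addrK //.
rewrite exchange_big; apply: eq_bigr => e _ /=; rewrite mulr_suml.
by apply: eq_bigr => d _; ring.
Qed.

(** The derivative of the pull-back of F has an inhomogeneous term, which
    dpullE identifies with the difference of the two Christoffel corrections.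
    *)
Lemma nabla_trans p F c s : is_tensor p F -> size s = p ->
  nabla g F i x c s = \sum_d J c d * pull J (nabla g F j x' d) s.
Proof.
move=> tF sp.
have nE i0 x0 c0 u : nabla g F i0 x0 c0 u = pd c0 (fun y => F i0 y u) x0 -
    der (fun e b => christoffel g i0 x0 e c0 b) (F i0 x0) u by rewrite der_set_nth.
rewrite nE (pd_tensor c tF Vx sp).
rewrite (dpullE (M := fun e b => christoffel g i x e c b)
  (N := fun b e => \sum_d J c d * christoffel g j x' b d e)); last exact: dJac_christoffel.
have -> : der (fun e b => christoffel g i x e c b) (F i x) s =
    der (fun e b => christoffel g i x e c b) (pull J (F j x')) s.
  rewrite !der_set_nth; apply: eq_bigr => t _; apply: eq_bigr => d _; congr (_ * _).
  apply: (tensor_pull tF Vx); rewrite size_set_nth -sp.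
  by apply/maxn_idPr; exact: ltn_ord.
have E (u v w : R) : u + (v - w) - v = u - w by ring.
rewrite E.
rewrite -formN -formD -pullN -pullD; transitivity (pull J (\sum_d J c d *: (nabla g F j x' d : form R n)) s).
  congr (pull J _ s); apply/funext => u; rewrite formD formN form_sum der_suml -sumrB.
  by apply: eq_bigr => d _; rewrite formZ nE mulrBr.
by rewrite pull_sum form_sum; apply: eq_bigr => d _; rewrite pullZ formZ.
Qed.
End Metric.
End Overlap.

(** * The brackets are forms *)

(** Smoothness and skewness are inherited from a form over the ring of smooth
    functions in each chart. *)
Lemma form_of_repr (R : realType) n (M : manifold R n) k (G : field M) :
  (forall i, exists2 F : form (smf (chart_opens i)) n, altern F & repr k F G) ->
  (forall i j x, overlap i j x -> forall s, size s = k ->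
     G i x s = pull (Jac i j x) (G j (trans i j x)) s) -> is_form k G.
Proof.
move=> rG tG; split; first split.
- move=> i a; have [F _ FG] := rG i.
  apply: (@smooth_ext _ _ (chart_img i) _ (F a)); first exact: chart_img_open.
    by move=> y Wy; rewrite -(FG y Wy) ?size_tuple.
  exact: (smooth_smf (F a : smf (chart_opens i))).
- move=> i j m im jm a; have Vx : overlap i j (chart_map i m) by exists m.
  by rewrite (tG i j _ Vx) ?size_tuple // trans_map // pull_tuple.
move=> i x ix s a; have Wx : chart_opens i x := ix; have [F aF FG] := rG i.
have E (b : k.-tuple 'I_n) : mapf (ev Wx) F b = G i x b by rewrite /mapf /= (FG x Wx) ?size_tuple.
exact: (skew_ext E (altern_skew (altern_mapf _ aF))).
Qed.

Section PointForms.
Variables (R : realType) (n : nat) (M : manifold R n) (sgn : nat).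
Implicit Types (g : field M) (i j : chart M) (x : 'rV[R]_n).
Local Notation form := (form R n).
Local Notation covec := (covec R n).

(** Value at the point x, cut off to degree k so that identities hold between
    forms and not only in that degree. *)
Definition ptform k (G : field M) i x : form := trunc k (G i x).
Definition ptnabla k g (G : field M) i x c : form := trunc k (nabla g G i x c).
Definition ptcov (G : field M) i x : covec := fun a => G i x [:: a].
Definition ptnablav g (G : field M) i x c : covec := fun a => nabla g G i x c [:: a].

Lemma isform_ptform k G i x : is_form k G -> chart_img i x -> isform k (ptform k G i x).
Proof.
move=> [_ aG] ix; split; last by move=> s /negbTE sk; rewrite /ptform /trunc sk.
by apply: skew_altern; exact: aG.
Qed.

Lemma isform_ptnabla k g G i x c : is_metric sgn g -> is_form k G -> chart_img i x ->
  isform k (ptnabla k g G i x c).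
Proof.
move=> mg fG ix; have Wx : chart_opens i x := ix.
have -> : ptnabla k g G i x c = mapf (ev Wx) (nab (@Dsm R n _) (GamA i g) c (formA i k G)).
  have [_ dN] := isform_nab (Dsm_derivations (chart_opens i)) (GamA i g) c (formA_isform i fG).
  apply/funext => s; rewrite /ptnabla /trunc /mapf; case: eqP => [sk|/eqP sk].
    by rewrite /= (ev_nab mg (formA_repr fG)).
  by rewrite dN // rmorph0.
have [aN dN] := isform_nab (Dsm_derivations (chart_opens i)) (GamA i g) c (formA_isform i fG).
by split; [exact: altern_mapf|move=> s sk; rewrite /mapf dN // rmorph0].
Qed.

(** The right-hand sides of tau_overE and tau_underE as functions of the
    tensors at a point; they commute with pull-backs and can be compared for
    two conformal metrics. *)
Definition overR k (gi : 'I_n -> covec) (sg : covec) (T : 'I_n -> form) (S : 'I_n -> covec)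
    (F : form) : form :=
  - 2%:R *: ctrv gi sg (\sum_q up gi q (T q))
   + (n%:R - k%:R + 1) *: \sum_p ctrv gi (S p) (up gi p F).
Definition underR k (sg : covec) (T : 'I_n -> form) (S : 'I_n -> covec) (F : form) : form :=
  (k.+2%:R^-1 * k.+1%:R^-1) *: (2%:R *: wedge sg (\sum_z wedge (dl R z) (T z))
    + k.+1%:R *: \sum_y wedge (dl R y) (wedge (S y) F)).

Section Formulas.
Variables (k : nat) (sigma tau : field M -> field M) (g : field M) (i : chart M) (x : 'rV[R]_n).
Hypotheses (mg : is_metric sgn g) (ft : is_form k (tau g)) (ix : chart_img i x).
Local Notation F := (ptform k (tau g) i x).
Local Notation T := (ptnabla k g (tau g) i x).
Local Notation S := (ptnablav g (sigma g) i x).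
Local Notation sg := (ptcov (sigma g) i x).
Local Notation gi := (ginv g i x : 'I_n -> covec).

Let aF : altern F. Proof. by case: (isform_ptform ft ix). Qed.
Let aT c : altern (T c). Proof. by case: (isform_ptnabla c mg ft ix). Qed.
Let FE s : size s = k -> tau g i x s = F s. Proof. by move=> sk; rewrite /ptform trunc_size. Qed.
Let TE c s : size s = k -> nabla g (tau g) i x c s = T c s.
Proof. by move=> sk; rewrite /ptnabla trunc_size. Qed.

Lemma tau_over_pt s : (size s).+2 = k -> tau_over k sigma tau g i x s =
  overR k gi sg T S F s.
Proof.
move=> sk; apply: (tau_overE (metric_pairR mg ix) aF aT FE TE) sk.
by [].
Qed.

Lemma tau_under_pt s : size s = k.+2 -> tau_under k sigma tau g i x s =
  underR k sg T S F s.
Proof. by move=> sk; rewrite /underR formZ; exact: (tau_underE aF aT FE TE _ sk). Qed.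
End Formulas.

Section Transition.
Variables (i j : chart M) (x : 'rV[R]_n).
Hypothesis Vx : overlap i j x.
Local Notation J := (Jac i j x).
Local Notation x' := (trans i j x).

Lemma ptform_trans k G : is_tensor k G -> ptform k G i x = pull J (ptform k G j x').
Proof.
move=> tG; rewrite /ptform /trunc pull_trunc; apply/funext => s.
by case: eqP => // sk; exact: (tensor_pull tG Vx).
Qed.

Lemma ptnabla_trans k g G c : is_metric sgn g -> is_tensor k G ->
  ptnabla k g G i x c = \sum_d J c d *: pull J (ptnabla k g G j x' d).
Proof.
move=> mg tG; apply/funext => s; rewrite form_sum /ptnabla.
rewrite /trunc; case: eqP => [sk|/eqP/negbTE sk].
  rewrite (nabla_trans mg Vx c tG sk); apply: eq_bigr => d _.
  by rewrite formZ pull_trunc sk eqxx.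
by rewrite big1 // => d _; rewrite formZ pull_trunc sk mulr0.
Qed.

Lemma pull1 (G : form) a : pull J G [:: a] = pullv J (cov G) a.
Proof. by rewrite pull_cons. Qed.

Lemma ptcov_trans G : is_tensor 1 G -> ptcov G i x = pullv J (ptcov G j x').
Proof. by move=> tG; apply/funext => a; rewrite /ptcov (tensor_pull tG Vx) // pull1. Qed.

Lemma ptnablav_trans g G c : is_metric sgn g -> is_tensor 1 G ->
  ptnablav g G i x c = \sum_d J c d *: pullv J (ptnablav g G j x' d).
Proof.
move=> mg tG; apply/funext => a; rewrite /ptnablav (nabla_trans mg Vx c tG) // cov_sum.
by apply: eq_bigr => d _; rewrite pull1 covZ.
Qed.

Variables (k : nat) (sigma tau : field M -> field M) (g : field M).
Hypotheses (mg : is_metric sgn g) (fs : is_form 1 (sigma g)) (ft : is_form k (tau g)).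
Let ix : chart_img i x := overlap_img Vx.
Let jx : chart_img j x' := trans_img Vx.
Let ts : is_tensor 1 (sigma g). Proof. by case: fs. Qed.
Let tt : is_tensor k (tau g). Proof. by case: ft. Qed.

Lemma tau_over_trans s : (size s).+2 = k -> tau_over k sigma tau g i x s =
  pull J (tau_over k sigma tau g j x') s.
Proof.
move=> sk; rewrite (tau_over_pt sigma mg ft ix sk).
have E u : size u = size s -> tau_over k sigma tau g j x' u = overR k (ginv g j x')
    (ptcov (sigma g) j x') (ptnabla k g (tau g) j x') (ptnablav g (sigma g) j x') (ptform k (tau g) j x') u.
  by move=> us; apply: (tau_over_pt sigma mg ft jx); rewrite us.
rewrite (pull_ext J E) // /overR; congr ((_ : form) s).
have giJ := ginv_trans mg Vx.
rewrite pullD !pullZ -(pull_ctrv giJ) -(pull_div giJ) -(pull_ctr2 giJ).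
rewrite (ptcov_trans ts) (ptform_trans tt); congr (_ *: ctrv _ _ _ + _ *: _).
  by apply: eq_bigr => q _; rewrite (ptnabla_trans _ mg tt).
by apply: eq_bigr => p _; rewrite (ptnablav_trans _ mg ts).
Qed.

Lemma tau_under_trans s : size s = k.+2 -> tau_under k sigma tau g i x s =
  pull J (tau_under k sigma tau g j x') s.
Proof.
move=> sk; rewrite (tau_under_pt sigma mg ft ix sk).
have E u : size u = size s -> tau_under k sigma tau g j x' u = underR k
    (ptcov (sigma g) j x') (ptnabla k g (tau g) j x') (ptnablav g (sigma g) j x') (ptform k (tau g) j x') u.
  by move=> us; apply: (tau_under_pt sigma mg ft jx); rewrite us.
rewrite (pull_ext J E) // /underR pullZ; congr ((_ *: _ : form) s).
rewrite pullD !pullZ pull_wedge -pull_curl -pull_wdg2.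
rewrite (ptcov_trans ts) (ptform_trans tt); congr (_ *: wedge _ _ + _ *: _).
  by apply: eq_bigr => q _; rewrite (ptnabla_trans _ mg tt).
by apply: eq_bigr => p _; rewrite (ptnablav_trans _ mg ts).
Qed.
End Transition.

Section Sections.
Variables (k : nat) (sigma tau : field M -> field M) (g : field M).
Hypotheses (mg : is_metric sgn g) (fs : is_form 1 (sigma g)) (ft : is_form k (tau g)).

Lemma is_form_over m : k = m.+2 -> is_form m (tau_over k sigma tau g).
Proof.
move=> km; apply: form_of_repr => [i|i j x Vx s sm].
  exists (@overA R n M i g k (formA i 1 (sigma g)) (formA i k (tau g))).
    by have [] := (isform_overA g (formA i 1 (sigma g)) (formA_isform i ft)).
  exact: (repr_over mg fs ft km).
by apply: tau_over_trans => //; rewrite sm.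
Qed.

Lemma is_form_under : is_form k.+2 (tau_under k sigma tau g).
Proof.
apply: form_of_repr => [i|i j x Vx s sm].
  exists (@underA R n M i g k (formA i 1 (sigma g)) (formA i k (tau g))).
    by have [] := (isform_underA g (formA i 1 (sigma g)) (formA_isform i ft)).
  exact: (repr_under mg fs ft).
exact: tau_under_trans.
Qed.
End Sections.
End PointForms.

(** * Change of the metric in its conformal class *)

Lemma is_derive_line (R : realType) n (f : 'rV[R]_n -> R) y a (r : R) :
  is_derive (0 : R) 1 (fun t : R => f (y + t *: delta_mx 0 a)) r ->
  is_derive y (delta_mx 0 a) f r.
Proof.
have E : (fun h : R => h^-1 *: (((fun t : R => f (y + t *: delta_mx 0 a)) \o shift 0) (h *: 1) -
      f (y + 0 *: delta_mx 0 a))) =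
   (fun h => h^-1 *: ((f \o shift y) (h *: delta_mx 0 a) - f y)).
  apply/funext => h /=; rewrite scale0r !addr0; congr (_ *: (f _ - _)).
  by rewrite [h *: 1]mulr1 addrC.
move=> [d1 d2]; apply: DeriveDef; first by move: d1; rewrite /derivable E.
by rewrite -d2 /derive E.
Qed.

Lemma pd_expR (R : realType) n (W : set 'rV[R]_n) (w : R) (U : 'rV[R]_n -> R) x c :
  smooth_on W U -> W x ->
  is_derive x (delta_mx 0 c) (fun y => expR (w * U y)) (expR (w * U x) * (w * pd c U x)).
Proof.
move=> sU Wx; apply: is_derive_line.
have d1 : is_derive (0 : R) 1 (fun t : R => U (x + t *: delta_mx 0 c)) (pd c U x).
  have := @derivable_line R n U x c 0; rewrite scale0r addr0; apply.
  exact: smooth_derivable sU Wx.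
have d2 : is_derive (0 : R) 1 (fun t : R => w * U (x + t *: delta_mx 0 c)) (w * pd c U x).
  exact: (is_deriveZ w d1).
have -> : expR (w * U x) * (w * pd c U x) =
   expR (w * U (x + 0 *: delta_mx 0 c)) *: (w * pd c U x) by rewrite scale0r addr0.
have := @is_derive1_comp R expR (fun t : R => w * U (x + t *: delta_mx 0 c)) 0 _ _ _ d2.
by move=> H; apply: H; exact: is_derive_expR.
Qed.

Section Rescale.
Variables (R : realType) (n : nat).
Local Notation form := (form R n).
Local Notation covec := (covec R n).
Implicit Types (gi : 'I_n -> covec) (v sg : covec) (F : form) (T : 'I_n -> form) (S : 'I_n -> covec).

Lemma up_scale gi gi' (r : R) p F : (forall a b, gi' a b = r * gi a b) ->
  up gi' p F = r *: up gi p F.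
Proof. by move=> H; rewrite !upE scaler_sumr; apply: eq_bigr => a _; rewrite H scalerA. Qed.
Lemma ctrv_scale gi gi' (r : R) v F : (forall a b, gi' a b = r * gi a b) ->
  ctrv gi' v F = r *: ctrv gi v F.
Proof.
move=> H; rewrite !ctrvE scaler_sumr; apply: eq_bigr => a _.
by rewrite (up_scale _ _ H) !scalerA mulrC.
Qed.

Lemma overR_scale k gi gi' (r e e' : R) sg T S F : (forall a b, gi' a b = r * gi a b) -> r * e = 1 ->
  overR k gi' (e *: sg) (fun q => e' *: T q) (fun p => e *: S p) (e' *: F) =
  (r * e') *: overR k gi sg T S F.
Proof.
move=> H re; rewrite /overR (ctrv_scale _ _ H) ctrvZ.
have -> : \sum_q up gi' q (e' *: T q) = (r * e') *: \sum_q up gi q (T q).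
  by rewrite scaler_sumr; apply: eq_bigr => q _; rewrite (up_scale _ _ H) upZ scalerA.
have -> : \sum_p ctrv gi' (e *: S p) (up gi' p (e' *: F)) = (r * e') *: \sum_p ctrv gi (S p) (up gi p F).
  rewrite scaler_sumr; apply: eq_bigr => p _.
  rewrite (ctrv_scale _ _ H) (up_scale _ _ H) ctrvZ upZ !ctrvZr !scalerA; congr (_ *: _).
  by rewrite -[RHS]mul1r -re; ring.
rewrite ctrvZr scalerDr !scalerA; congr (_ *: _ + _ *: _); last exact: mulrC.
by rewrite -[RHS]mul1r -re; ring.
Qed.

Lemma underR_scale k (e e' : R) sg T S F :
  underR k (e *: sg) (fun q => e' *: T q) (fun p => e *: S p) (e' *: F) =
  (e * e') *: underR k sg T S F.
Proof.
rewrite /underR wedgevZ.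
have -> : \sum_z wedge (dl R z) (e' *: T z) = e' *: \sum_z wedge (dl R z) (T z).
  by rewrite scaler_sumr; apply: eq_bigr => q _; rewrite wedgeZ.
have -> : \sum_y wedge (dl R y) (wedge (e *: S y) (e' *: F)) =
    (e * e') *: \sum_y wedge (dl R y) (wedge (S y) F).
  by rewrite scaler_sumr; apply: eq_bigr => p _; rewrite wedgevZ !wedgeZ scalerA.
rewrite wedgeZ !scalerDr !scalerA; congr (_ *: _ + _ *: _); ring.
Qed.

Variables (gg gi : 'I_n -> covec).
Hypothesis gP : metric_pair gg gi.
Variables (m k : nat) (Y sg : covec) (r : R) (F : form) (T : 'I_n -> form) (S : 'I_n -> covec).
Hypothesis iF : isform k F.
Let T' q := T q + ctr q (wedge Y F) + wedge (gg q) (ctrv gi Y F).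
Let S' p := S p + Y p *: sg - sg p *: Y + r *: gg p.
Let tf : tfree R := @tfreeR R.

(** T' and S' are the changed derivatives of tau and sigma, up to the weight
    factors. Both the divergence and the derivative of sigma contribute a
    multiple of the double contraction of F with sg and Y, and the factor in
    front of the second term is the one for which these cancel. *)
Lemma overR_conf : k = m.+1 -> overR k gi sg T' S' F = overR k gi sg T S F.
Proof.
move=> km; have aF : altern F by case: iF.
have iY : isform m (ctrv gi Y F) by move: iF; rewrite km => /(isform_ctrv _ Y).
have E1 : \sum_q up gi q (T' q) = \sum_q up gi q (T q) + (n%:R - k%:R + 1) *: ctrv gi Y F.
  under eq_bigr do rewrite /T' 2!upD.
  rewrite !big_split /= (up_ctr_tr gP tf) ?addr0; last by apply: altern_wedge.
  by rewrite (up_g_sum gP iY) km -natr1; congr (_ + _ *: _); ring.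
have cs v w : \sum_p w p *: ctrv gi v (up gi p F) = ctrv gi v (ctrv gi w F).
  by rewrite [ctrv gi w F]ctrvE (linear_sum (ctrv gi v)); apply: eq_bigr => p _; rewrite /= ctrvZr.
have E2 : \sum_p ctrv gi (S' p) (up gi p F) = \sum_p ctrv gi (S p) (up gi p F)
    + 2%:R *: ctrv gi sg (ctrv gi Y F).
  transitivity (\sum_p (ctrv gi (S p) (up gi p F) + Y p *: ctrv gi sg (up gi p F)
    - sg p *: ctrv gi Y (up gi p F) + r *: ctr p (up gi p F))).
    apply: eq_bigr => p _; rewrite /S' -scaleNr !ctrvD !ctrvZ scaleNr.
    by rewrite (ctrv_g gP).
  rewrite big_split /= sumrB big_split /= !cs -scaler_sumr.
  have -> : \sum_p ctr p (up gi p F) = 0.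
    by under eq_bigr do rewrite (ctr_up gi _ _ aF); rewrite sumrN (up_ctr_tr gP tf aF) oppr0.
  rewrite scaler0 addr0 (ctrvC gi Y sg aF) opprK -addrA; congr (_ + _).
  by rewrite scaler_nat mulr2n.
rewrite /overR E1 E2 ctrvDr ctrvZr !scalerDr !scalerA.
form_ring.
Qed.

(** As for overR_conf, the contributions are multiples of the exterior product
    of sg, Y and F with opposite signs. *)
Lemma underR_conf : underR k sg T' S' F = underR k sg T S F.
Proof.
have E1 : \sum_z wedge (dl R z) (T' z) = \sum_z wedge (dl R z) (T z) + k.+1%:R *: wedge Y F.
  under eq_bigr do rewrite /T' 2!wedgeDr.
  by rewrite !big_split /= (euler (isform_wedge Y iF)) (sum_dl_g gP tf) addr0.
have cs v w : \sum_y wedge (dl R y) (w y *: wedge v F) = wedge w (wedge v F).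
  rewrite [in RHS](cov_dl w) wedgev_sum; apply: eq_bigr => y _.
  by rewrite wedgeZ wedgevZ.
have E2 : \sum_y wedge (dl R y) (wedge (S' y) F) = \sum_y wedge (dl R y) (wedge (S y) F)
    - 2%:R *: wedge sg (wedge Y F).
  transitivity (\sum_y (wedge (dl R y) (wedge (S y) F) + wedge (dl R y) (Y y *: wedge sg F)
    - wedge (dl R y) (sg y *: wedge Y F) + r *: wedge (dl R y) (wedge (gg y) F))).
    apply: eq_bigr => y _; rewrite /S' -scaleNr !wedgevD !wedgevZ !wedgeDr !wedgeZ.
    by rewrite scaleNr.
  rewrite big_split /= sumrB big_split /= !cs -scaler_sumr (sum_dl_g gP tf) scaler0 addr0.
  rewrite (wedgeC Y sg) -addrA; congr (_ + _).
  by rewrite scaler_nat mulr2n opprD.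
rewrite /underR E1 E2 wedgeDr wedgeZ !scalerDr scalerN !scalerA.
form_ring.
Qed.
End Rescale.

Section ConformalChange.
Variables (R : realType) (n : nat) (M : manifold R n) (sgn : nat).
Local Notation form := (form R n).
Local Notation covec := (covec R n).
Variables (g g' : field M) (u : M -> R).
Hypotheses (mg : is_metric sgn g) (mg' : is_metric sgn g') (gg' : conf_related u g g').
Variables (i : chart M) (x : 'rV[R]_n).
Hypothesis ix : chart_img i x.
Let U := u \o chart_inv i.
Let sU : smooth_on (chart_img i) U. Proof. by case: gg' => sU _; exact: sU. Qed.
(** The derivative of u, the logarithm of the factor by which lengths change.
    *)
Definition dlog : covec := fun a => pd a (u \o chart_inv i) x.
Local Notation Y := dlog.
Local Notation E w := (expR (w * u (chart_inv i x))).
Local Notation gx := (fun a b => g i x [:: a; b]).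
Local Notation gi := (ginv g i x : 'I_n -> covec).
Local Notation gi' := (ginv g' i x : 'I_n -> covec).
Let gP : metric_pair gx gi := metric_pairR mg ix.
Let gP' := metric_pairR mg' ix.

Lemma metric_conf y a b : chart_img i y ->
  g' i y [:: a; b] = expR (2 * u (chart_inv i y)) * g i y [:: a; b].
Proof. by case: gg' => _ H iy; exact: (H i y iy [tuple a; b]). Qed.

Lemma ED v w : E v * E w = E (v + w). Proof. by rewrite -expRD mulrDl. Qed.

Lemma ginv_conf a b : gi' a b = E (-2) * gi a b.
Proof.
have H c : \sum_d gi' a d * gx d c = E (-2) * dl R a c.
  rewrite -(gi_g gP' a c) mulr_sumr; apply: eq_bigr => d _; rewrite metric_conf //.
  by rewrite [RHS]mulrCA [_ * (E 2 * _)]mulrA ED addNr mul0r expR0 mul1r.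
transitivity (\sum_c (\sum_d gi' a d * gx d c) * gi c b).
  under eq_bigr do rewrite mulr_suml.
  rewrite exchange_big /= -[LHS](sum_dl (gi' a : 'I_n -> R^o)); apply: eq_bigr => d _.
  under eq_bigr do rewrite -mulrA.
  by rewrite -mulr_sumr (g_gi gP) /dl [d == b]eq_sym [RHS]mulrC.
under eq_bigr do rewrite H -mulrA; rewrite -mulr_sumr; congr (_ * _).
by rewrite -[RHS](sum_dlr (fun c => gi c b : R^o)); apply: eq_bigr => c _; rewrite /dl eq_sym.
Qed.

Lemma rescaledP w p (F F' : field M) v : rescaled w p u F F' -> size v = p ->
  F' i x v = E w * F i x v.
Proof. by move=> rF vp; subst p; exact: (rF i x ix (in_tuple v)). Qed.

Lemma pd_rescaled w p (F F' : field M) c s : is_tensor p F -> rescaled w p u F F' -> size s = p ->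
  pd c (fun y => F' i y s) x = E w * (pd c (fun y => F i y s) x + w * Y c * F i x s).
Proof.
move=> tF rF sp.
have iW : open (chart_img i) by exact: chart_img_open.
rewrite (pd_ext iW (g := fun y => expR (w * U y) * F i y s)) //; last first.
  by move=> y iy; subst p; exact: (rF i y iy (in_tuple s)).
have d1 := pd_expR w c sU ix.
have d2 : derivable (fun y => F i y s) x (delta_mx 0 c).
  apply: (smooth_derivable (U := chart_img i)) => //; exact: (tensor_smooth tF).
rewrite {1}/pd deriveM //; have [_ ->] := d1.
rewrite -[U x]/(u (chart_inv i x)) -/(pd c (fun y => F i y s) x) -[pd c U x]/(Y c).
by rewrite /GRing.scale /=; ring.
Qed.

(** In the Koszul formula the factors of the metric and of its inverse cancel,
    and the derivative of the factor contributes the terms in Y. *)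
Lemma christoffel_conf c a b : christoffel g' i x c a b = christoffel g i x c a b
  + dl R c b * Y a + dl R c a * Y b - gx a b * rais gi Y c.
Proof.
have tg : is_tensor 2 g by case: mg.
have rg : rescaled 2 2 u g g' by case: gg'.
rewrite /christoffel; under eq_bigr => d _ do rewrite ginv_conf !(pd_rescaled _ tg rg) //.
have EE : E (-2) * E 2 = 1 by rewrite ED addNr mul0r expR0.
pose P a0 b0 d := pd a0 (fun y => g i y [:: b0; d]) x.
transitivity (2^-1 * (\sum_d gi c d * (P a b d + P b a d - P d a b)) +
  ((\sum_d gi c d * gx d b) * Y a + (\sum_d gi c d * gx d a) * Y b
   - gx a b * \sum_d gi c d * Y d)).
  rewrite !mulr_suml !mulr_sumr -!big_split -sumrB -big_split; apply: eq_bigr => d _ /=.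
  rewrite (metric_sym mg b d ix) (metric_sym mg a d ix).
  (* The factors from the inverse metric and from the metric are kept together. *)
  transitivity ((E (-2) * E 2) * (2^-1 * (gi c d * (P a b d + P b a d - P d a b
   + 2 * (Y a * gx d b + Y b * gx d a - Y d * gx a b))))).
    rewrite /P; move: (E (-2)) (E 2) => e1 e2; ring.
  by rewrite EE; field.
by rewrite !(gi_g gP) !addrA.
Qed.

(** The diagonal term in the change of the Christoffel symbols contributes - k
    times Y c. With the weight k + 1 one copy of Y c times F remains, and it
    combines with the exterior product of Y and ctr c F to the term in wedge Y
    F. *)
Lemma nabla_conf k (F F' : field M) c : is_form k F -> is_form k F' ->
  rescaled (k%:R + 1) k u F F' ->
  ptnabla k g' F' i x c = E (k%:R + 1) *: (ptnabla k g F i x c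
    + ctr c (wedge Y (ptform k F i x)) + wedge (gx c) (ctrv gi Y (ptform k F i x))).
Proof.
move=> fF fF' rF; have tF : is_tensor k F by case: fF.
set G := ptform k F i x; have iG : isform k G := isform_ptform fF ix.
have aG : altern G by case: iG.
have iN := isform_ptnabla c mg fF ix; have iN' := isform_ptnabla c mg' fF' ix.
have iR : isform k (E (k%:R + 1) *: (ptnabla k g F i x c
    + ctr c (wedge Y G) + wedge (gx c) (ctrv gi Y G))).
  apply: isformZ; apply: isformD; first by apply: isformD => //; exact: (isform_ctr c (isform_wedge Y iG)).
  case: (k) iG => [|k'] iG'; last exact: (isform_wedge (gx c) (isform_ctrv _ Y iG')).
  rewrite ctrvE big1 ?(linear0 (wedge _)) => [|p _]; first exact: isform0.
  by rewrite upE big1 ?scaler0 // => a _; case: iG' => _ /(ctr_deg0 a) ->; rewrite scaler0.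
apply/funext => s; have [sk|sk] := eqVneq (size s) k; last first.
  by case: iN' => _ ->//; case: iR => _ ->.
rewrite /ptnabla [LHS](trunc_size _ sk) formZ !formD (trunc_size _ sk).
have nE (g0 F0 : field M) : nabla g0 F0 i x c s = pd c (fun y => F0 i y s) x -
    der (fun e b => christoffel g0 i x e c b) (F0 i x) s by rewrite der_set_nth.
have dx (M0 : 'I_n -> covec) (F0 G0 : form) (r : R) : (forall v, size v = k -> F0 v = r * G0 v) ->
    der M0 F0 s = r * der M0 G0 s.
  move=> FG; rewrite !der_set_nth mulr_sumr; apply: eq_bigr => t _; rewrite mulr_sumr.
  apply: eq_bigr => d _; rewrite FG ?size_set_nth; last by rewrite -sk; apply/maxn_idPr; exact: ltn_ord.
  by rewrite mulrCA.
rewrite !nE (pd_rescaled c tF rF sk) (dx _ (F' i x) G (E (k%:R + 1))); last first.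
  by move=> v vk; rewrite /G /ptform (trunc_size _ vk); exact: rescaledP rF vk.
rewrite (dx _ (F i x) G 1) => [|v vk]; last by rewrite mul1r /G /ptform trunc_size.
rewrite -mulrBr mul1r; congr (_ * _).
have -> : F i x s = G s by rewrite /G /ptform trunc_size.
have -> : der (fun e b => christoffel g' i x e c b) G s =
   der (fun e b => christoffel g i x e c b) G s + Y c * (k%:R * G s) + wedge Y (ctr c G) s
   - wedge (gx c) (ctrv gi Y G) s.
  rewrite !(der_wedgeE _ aG).
  pose h e : covec := fun b => christoffel g i x e c b.
  have -> : \sum_d wedge (fun b => christoffel g' i x d c b) (ctr d G) = \sum_e
      wedge (h e + Y c *: dl R e + dl R c e *: Y - rais gi Y e *: (gx c : covec)) (ctr e G).
    apply: eq_bigr => e _; congr (wedge _ (ctr e G)); apply/funext => b.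
    rewrite christoffel_conf !(covD, covN, covZ) /h.
    by rewrite /dl [b == e]eq_sym [c == e]eq_sym; ring.
  rewrite -[k%:R * G s]formZ -(euler iG).
  have -> : wedge Y (ctr c G) = \sum_e wedge (dl R c e *: Y) (ctr e G).
    rewrite -[in LHS](sum_dlr (fun e => ctr e G) c) (linear_sum (wedge Y)) /=.
    by apply: eq_bigr => e _; rewrite wedgevZ wedgeZ.
  have -> : wedge (gx c) (ctrv gi Y G) = \sum_e wedge (rais gi Y e *: (gx c : covec)) (ctr e G).
    have -> : ctrv gi Y G = \sum_e rais gi Y e *: ctr e G.
      rewrite ctrvE; under eq_bigr do rewrite upE scaler_sumr.
      rewrite exchange_big; apply: eq_bigr => a _ /=; rewrite scaler_suml.
      by apply: eq_bigr => p _; rewrite scalerA mulrC (gi_sym gP).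
    by rewrite (linear_sum (wedge _)) /=; apply: eq_bigr => e _; rewrite wedgevZ wedgeZ.
  transitivity ((\sum_d wedge (h d) (ctr d G) + Y c *: (\sum_e wedge (dl R e) (ctr e G))
    + \sum_e wedge (dl R c e *: Y) (ctr e G) - \sum_e wedge (rais gi Y e *: (gx c : covec)) (ctr e G) : form) s);
    last by rewrite !formD formN formZ.
  congr ((_ : form) s); rewrite scaler_sumr -!big_split -sumrB; apply: eq_bigr => e _ /=.
  by rewrite !(wedgevD, wedgevN) !wedgevZ.
rewrite ctr_wedge formD formN formZ; ring.
Qed.

Variables (k : nat) (sigma tau : field M -> field M).
Hypotheses (fs : is_form 1 (sigma g)) (fs' : is_form 1 (sigma g')).
Hypotheses (ft : is_form k (tau g)) (ft' : is_form k (tau g')).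
Hypotheses (rs : rescaled 2 1 u (sigma g) (sigma g')).
Hypotheses (rt : rescaled (k%:R + 1) k u (tau g) (tau g')).
Local Notation F := (ptform k (tau g) i x).
Local Notation T := (ptnabla k g (tau g) i x).
Local Notation S := (ptnablav g (sigma g) i x).
Local Notation sg := (ptcov (sigma g) i x).

Lemma ptcov_conf : ptcov (sigma g') i x = E 2 *: sg.
Proof. by apply/funext => a; rewrite covZ /ptcov (rescaledP rs). Qed.

Lemma ptform_conf : ptform k (tau g') i x = E (k%:R + 1) *: F.
Proof.
apply/funext => s; rewrite formZ /ptform /trunc; case: eqP => [sk|_]; last by rewrite mulr0.
exact: rescaledP rt sk.
Qed.

Lemma ptnablav_conf c : ptnablav g' (sigma g') i x c =
  E 2 *: (S c + Y c *: sg - sg c *: Y + (ctrv gi Y (ptform 1 (sigma g) i x)) [::] *: (gx c : covec)).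
Proof.
have rs1 : rescaled (1%:R + 1) 1 u (sigma g) (sigma g') by move: rs; rewrite -natr1.
apply/funext => a; rewrite -[LHS]/(ptnabla 1 g' (sigma g') i x c [:: a]) (nabla_conf c fs fs' rs1).
rewrite covZ formZ natr1; congr (_ * _); rewrite covD covD covD covN !covZ formD.
rewrite wedge_cons wedge_nil subr0 [_ * ctrv _ _ _ _]mulrC; congr (_ + _).
rewrite formD -[RHS]addrA; congr (_ + _).
rewrite -[ctr c _ [:: a]]/(wedge Y (ptform 1 (sigma g) i x) [:: c; a]) wedge2E.
by rewrite [Y a * _]mulrC.
Qed.

Let ptnabla_conf_fun : ptnabla k g' (tau g') i x = fun c => E (k%:R + 1) *:
  (T c + ctr c (wedge Y F) + wedge (gx c) (ctrv gi Y F)) :=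
  funext (fun c => nabla_conf c ft ft' rt).
Let ptnablav_conf_fun : ptnablav g' (sigma g') i x = fun c => E 2 *: (S c + Y c *: sg - sg c *: Y
    + (ctrv gi Y (ptform 1 (sigma g) i x)) [::] *: (gx c : covec)) :=
  funext ptnablav_conf.

Lemma tau_over_conf s : (size s).+2 = k ->
  tau_over k sigma tau g' i x s = E (k%:R - 1) * tau_over k sigma tau g i x s.
Proof.
move=> sk; rewrite (tau_over_pt sigma mg ft ix sk) (tau_over_pt sigma mg' ft' ix sk).
rewrite ptcov_conf ptform_conf.
rewrite ptnabla_conf_fun ptnablav_conf_fun.
rewrite (@overR_scale R n k gi gi' (E (-2)) (E 2) (E (k%:R + 1)) sg _ _ F ginv_conf); last by rewrite ED addNr mul0r expR0.
have -> : k%:R - 1 = - 2 + (k%:R + 1) :> R by ring.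
rewrite formZ ED; apply: congr2; first by [].
exact: (congr1 (fun f : form => f s) (@overR_conf R n gx gi gP (size s).+1 k Y sg
  (ctrv gi Y (ptform 1 (sigma g) i x) [::]) F T S (isform_ptform ft ix) (esym sk))).
Qed.

Lemma tau_under_conf s : size s = k.+2 ->
  tau_under k sigma tau g' i x s = E (k%:R + 3) * tau_under k sigma tau g i x s.
Proof.
move=> sk; rewrite (tau_under_pt sigma mg ft ix sk) (tau_under_pt sigma mg' ft' ix sk).
rewrite ptcov_conf ptform_conf.
rewrite ptnabla_conf_fun ptnablav_conf_fun.
rewrite (@underR_scale R n k (E 2) (E (k%:R + 1)) sg _ _ F).
have -> : k%:R + 3 = 2 + (k%:R + 1) :> R by ring.
rewrite formZ ED; apply: congr2; first by [].
exact: (congr1 (fun f : form => f s) (@underR_conf R n gx gi gP k Y sg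
  (ctrv gi Y (ptform 1 (sigma g) i x) [::]) F T S (isform_ptform ft ix))).
Qed.
End ConformalChange.

(** * The theorem *)

Lemma proj0_0 (R : realType) n (M : manifold R n) (g : field M) i x c s :
  proj0 g i x (fun _ _ => 0) c s = 0.
Proof.
have := proj0_lin g i x 1 (fun _ => 0) (fun _ => 0) c s.
by rewrite scaler0 addr0 mul1r => /eqP; rewrite -[X in X == _]addr0 (inj_eq (addrI _)) eq_sym => /eqP.
Qed.

Lemma eq_proj0_0 (R : realType) n (M : manifold R n) m (g : field M) T :
  eq_proj0 m g T (fun _ _ _ _ => 0) -> forall i x, chart_img i x ->
  forall c s, size s = m -> proj0 g i x (T i x) c s = 0.
Proof.
by move=> H i x ix c s sm; subst m; rewrite (H i x ix c (in_tuple s)) proj0_0.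
Qed.

Theorem theorem5p4 (R : realType) (n : nat) (n_ge3 : (3 <= n)%N)
  (M : manifold R n) (sg : nat) (sg_le : (sg <= n)%N)
  (c : set (field M)) (c_conf : conformal_structure sg c)
  (k : nat) (sigma tau : field M -> field M)
  (sigma_sec : is_section c 1 2 sigma)
  (tau_sec : is_section c k (k%:R + 1) tau) :
  ((2 <= k <= n)%N ->
     is_section c (k - 2) (k%:R - 1) (tau_over k sigma tau)) /\
  ((k <= n - 2)%N ->
     is_section c (k + 2) (k%:R + 3) (tau_under k sigma tau)) /\
  (conformal_killing c 1 sigma -> conformal_killing c k tau ->
     ((3 <= k <= n - 1)%N ->
        (conformal_killing c (k - 2) (tau_over k sigma tau) <->
         forall g, c g ->
           eq_proj0 (k - 2) g (weyl_over k sigma tau g) (fun _ _ _ _ => 0))) /\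
     ((1 <= k <= n - 3)%N ->
        (conformal_killing c (k + 2) (tau_under k sigma tau) <->
         forall g, c g ->
           eq_proj0 (k + 2) g (weyl_under k sigma tau g) (fun _ _ _ _ => 0)))).

Proof.
have mc g : c g -> is_metric sg g by case: c_conf => g0 _ H /H [].
have fs g : c g -> is_form 1 (sigma g) by case: sigma_sec => H _; exact: H.
have ft g : c g -> is_form k (tau g) by case: tau_sec => H _; exact: H.
have rs := sigma_sec.2; have rt := tau_sec.2.
split; [|split].
- case/andP=> k2 _; case: k k2 tau_sec ft rt => [|[|m]] // _ _ {}ft {}rt; rewrite subn2 /=.
  split=> [g cg|g g' u cg cg' gg' i x ix a]; first exact: (is_form_over (mc g cg) (fs g cg) (ft g cg)).
  apply: (tau_over_conf (mc g cg) (mc g' cg') gg' ix (fs g cg) (fs g' cg') (ft g cg) (ft g' cg')).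
  + exact: rs.
  + exact: rt.
  by rewrite size_tuple.
- move=> _; rewrite addn2.
  split=> [g cg|g g' u cg cg' gg' i x ix a]; first exact: (is_form_under (mc g cg) (fs g cg) (ft g cg)).
  apply: (tau_under_conf (mc g cg) (mc g' cg') gg' ix (fs g cg) (fs g' cg') (ft g cg) (ft g' cg')).
  + exact: rs.
  + exact: rt.
  by rewrite size_tuple.
move=> ks kt.
have hs g : c g -> forall i x, chart_img i x -> forall b u, size u = 1 ->
    proj0 g i x (nabla g (sigma g) i x) b u = 0.
  by move=> cg i x ix b u u1; exact: (eq_proj0_0 (ks g cg) ix b u1).
have ht g : c g -> forall i x, chart_img i x -> forall b u, size u = k ->
    proj0 g i x (nabla g (tau g) i x) b u = 0.
  by move=> cg i x ix b u uk; exact: (eq_proj0_0 (kt g cg) ix b uk).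
split=> [/andP[k3 kn]|/andP[k1 kn]].
- have [m km] : exists m, k = m.+3 by exists (k - 3)%N; lia.
  have ln : (m.+2 < n)%N by lia.
  (* Both factors are nonzero for k < n, so the two projections vanish together. *)
  have E g (cg : c g) i x (ix : chart_img i x) b u (um : size u = (k - 2)%N) :
      (n%:R - k%:R) * proj0 g i x (nabla g (tau_over k sigma tau g) i x) b u =
      (n%:R - k%:R + 1) * proj0 g i x (weyl_over k sigma tau g i x) b u.
    apply: (over_proj (mc g cg) n_ge3 (fs g cg) (ft g cg) km (hs g cg i) (ht g cg i) (m := m)) => //.
    by rewrite um km subn2.
  have nk : n%:R - k%:R != 0 :> R by rewrite subr_eq0 eqr_nat; lia.
  have nk1 : n%:R - k%:R + 1 != 0 :> R by rewrite addrAC natr1 subr_eq0 eqr_nat; lia.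
  split=> H g cg i x ix b a; rewrite proj0_0.
    apply: (mulfI nk1); rewrite -(E g cg) ?size_tuple // mulr0.
    by rewrite (eq_proj0_0 (H g cg) ix b (size_tuple a)) mulr0.
  apply: (mulfI nk); rewrite (E g cg) ?size_tuple // mulr0.
  by rewrite (eq_proj0_0 (H g cg) ix b (size_tuple a)) mulr0.
have [l kl] : exists l, k = l.+1 by exists k.-1; lia.
have ln : (l.+3 <= n)%N by lia.
have E g (cg : c g) i x (ix : chart_img i x) b u (um : size u = (k + 2)%N) :
    k%:R * proj0 g i x (nabla g (tau_under k sigma tau g) i x) b u =
    (- (k.+1%:R * k%:R)) * proj0 g i x (weyl_under k sigma tau g i x) b u.
  apply: (under_proj (mc g cg) n_ge3 (fs g cg) (ft g cg) kl (hs g cg i) (ht g cg i)) => //.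
  by rewrite um kl addn2.
have k0 : k%:R != 0 :> R by rewrite pnatr_eq0 kl.
have k10 : - (k.+1%:R * k%:R) != 0 :> R by rewrite oppr_eq0 mulf_neq0 ?pnatr_eq0 // kl.
split=> H g cg i x ix b a; rewrite proj0_0.
  apply: (mulfI k10); rewrite -(E g cg) ?size_tuple // mulr0.
  by rewrite (eq_proj0_0 (H g cg) ix b (size_tuple a)) mulr0.
apply: (mulfI k0); rewrite (E g cg) ?size_tuple // mulr0.
by rewrite (eq_proj0_0 (H g cg) ix b (size_tuple a)) mulr0.
Qed.
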